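(* Let $\Omega\colon\mathbb{R}\to\mathbb{R}_+$ be a continual diagram and let $\epsilon>0$ and $z_0\in\mathbb{R}$ be fixed. Assume that $z_+^{\max}$ is the maximal solution of the equation \[\Omega(z_+^{\max}-\epsilon)-\Omega(z_0-\epsilon)=z_+^{\max}-z_0-2\epsilon.\] Then for every continual diagram $\omega$ with $d(\Omega,\omega)\le\epsilon$, \[\lim_{\tau\to0^+}K_\omega(z_0-\tau)\ \le\ 1-\int_{z_+^{\max}-\epsilon}^{\infty}\left[1-\frac{\epsilon}{z+2\epsilon-z_+^{\max}}\right]d\mu_\Omega(z)=\int_{-\infty}^{\infty}\left(\mathbbm{1}_{(-\infty,\,z_+^{\max}-\epsilon)}(z)+\mathbbm{1}_{[z_+^{\max}-\epsilon,\,\infty)}(z)\,\frac{\epsilon}{z+2\epsilon-z_+^{\max}}\right)d\mu_\Omega(z).\]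
   Context: A continual diagram is a function $\omega\colon\mathbb{R}\to\mathbb{R}_+$ such that $|\omega(z_1)-\omega(z_2)|\le|z_1-z_2|$ for all $z_1,z_2$, and $\omega(z)=|z|$ for all sufficiently large $|z|$. Transition measure: $\log[z\,\mathbf{G}_\omega(z)]=-\int_{-\infty}^\infty\frac{1}{z-w}\big(\frac{\omega(w)-|w|}{2}\big)'\,dw$ for $z\in\mathbb{C}\setminus\mathbb{R}$, and $\mu_\omega$ is the unique probability measure with $\mathbf{G}_\omega(z)=\int\frac{d\mu_\omega(x)}{z-x}$; $K_\omega(z)=\mu_\omega((-\infty,z])$. Metric $d$: for $x,y\ge0$ write $(x,y)\in\omega$ if $\omega(x-y)=x+y$; $\Pi^\omega_Y(x)=\{y\ge0:(x,y)\in\omega\}$, $\Pi^\omega_X(y)=\{x\ge0:(x,y)\in\omega\}$; $d_Y(\omega_1,\omega_2)=\sup_{x\ge0}d_H(\Pi^{\omega_1}_Y(x),\Pi^{\omega_2}_Y(x))$, $d_X(\omega_1,\omega_2)=\sup_{y\ge0}d_H(\Pi^{\omega_1}_X(y),\Pi^{\omega_2}_X(y))$ ($d_H$ = Hausdorff distance), $d=\max(d_X,d_Y)$. *)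

(* Defs.v *)
From HB Require Import structures.
From mathcomp Require Import all_boot all_order all_algebra.
From mathcomp Require Import all_classical all_reals all_analysis.
Set Implicit Arguments. Unset Strict Implicit. Unset Printing Implicit Defensive.
Import Order.TTheory GRing.Theory Num.Theory.
Import numFieldNormedType.Exports.
Local Open Scope classical_set_scope.
Local Open Scope ring_scope.

Section Defs.
Variable R : realType.

Definition continual_diagram (w : R -> R) : Prop :=
  (forall z, 0 <= w z) /\
  (forall z1 z2, `|w z1 - w z2| <= `|z1 - z2|) /\
  (exists M : R, forall z, M <= `|z| -> w z = `|z|).

Definition diag_sigma (w : R -> R) (t : R) : R := (w t - `|t|) / 2.

(* The defining relation of the transition measure, with z = x + i y (y <> 0),
   written out in real and imaginary parts:
   z * G(z) = exp( - \int (1/(z - w)) sigma'(w) dw ),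
   G(z) = \int dmu(t) / (z - t). *)
Definition is_transition_measure (w : R -> R) (mu : probability R R) : Prop :=
  forall x y : R, y != 0 ->
  let D := fun t : R => (x - t) ^+ 2 + y ^+ 2 in
  let ReG := Rintegral mu setT (fun t => (x - t) / D t) in
  let ImG := Rintegral mu setT (fun t => - y / D t) in
  let ReA := - Rintegral lebesgue_measure setT
                 (fun t => derive1 (diag_sigma w) t * (x - t) / D t) in
  let ImA := Rintegral lebesgue_measure setT
                 (fun t => derive1 (diag_sigma w) t * y / D t) in
  x * ReG - y * ImG = expR ReA * cos ImA /\
  x * ImG + y * ReG = expR ReA * sin ImA.

Definition distrK (mu : probability R R) (z : R) : R :=
  fine (mu `]-oo, z]%classic).

(* (x, y) in w  iff  w(x - y) = x + y, for x, y >= 0 *)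
Definition piY (w : R -> R) (x : R) : set R :=
  [set y | 0 <= y /\ w (x - y) = x + y].
Definition piX (w : R -> R) (y : R) : set R :=
  [set x | 0 <= x /\ w (x - y) = x + y].

Definition hausdorff_dist (A B : set R) : \bar R :=
  maxe (ereal_sup [set ereal_inf [set (`|a - b|)%:E | b in B] | a in A])
       (ereal_sup [set ereal_inf [set (`|a - b|)%:E | a in A] | b in B]).

Definition distY (w1 w2 : R -> R) : \bar R :=
  ereal_sup [set hausdorff_dist (piY w1 x) (piY w2 x) | x in [set x : R | 0 <= x]].
Definition distX (w1 w2 : R -> R) : \bar R :=
  ereal_sup [set hausdorff_dist (piX w1 y) (piX w2 y) | y in [set y : R | 0 <= y]].

Definition diagram_dist (w1 w2 : R -> R) : \bar R := maxe (distX w1 w2) (distY w1 w2).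

End Defs.

(* Main.v *)
(** Up to the factor [-pi], the boundary values of [Im G] recover a measure from its Cauchy
transform [G], and [G] is the exponential of a potential of the charge [(om z - |z|) / 2].  The
bound [d(Om, om) <= eps] gives [Om (z - eps) - eps <= om z <= Om (z - eps) + eps], and the equation
for [zmax] allows to continue [om] beyond [z0] with slope [1] until it meets [Om (z - eps) + eps],
which happens at the latest at [zmax].  Let [eta] be the resulting diagram, equal to [om] to the
left of [z0] and to [Om (z - eps) + eps] to the right of [zmax].  On the left half-line the charge
of [eta] exceeds that of [om] by a nonnegative charge supported in [[z0, oo[], so the density of
[eta] dominates that of [om] there.  On the right half-line the charge of [eta] exceeds that of the
translate of [Om], with a minimum added at [zmax - eps] and a maximum at [zmax], by a nonnegative
charge supported in []-oo, zmax]]; the added minimum and maximum multiply the transform by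
[(z - zmax) / (z - zmax + eps)].  As the total mass of [eta] is at most [1], the mass of [om] to the
left of [z0] and the damped mass of [Om] to the right of [zmax - eps] sum up to at most [1]. *)
Require Import Defs.
From HB Require Import structures.
From mathcomp Require Import all_boot all_order all_algebra.
From mathcomp Require Import all_classical all_reals all_analysis.
From mathcomp Require Import measurable_realfun lebesgue_integral_under.
From mathcomp Require Import ring lra.
Import Order.TTheory GRing.Theory Num.Theory.
Import numFieldNormedType.Exports.
Local Open Scope classical_set_scope.
Local Open Scope ring_scope.

Set Implicit Arguments.
Unset Strict Implicit.
Unset Printing Implicit Defensive.

(** * Lipschitz functions as integrals *)

(** No transition measure of [eta] is ever constructed: [eta] enters only through the explicit
    function [expU + i expV] attached to its charge, which stands for [i G]. Two facts replace the
    measure: [expU] is nonnegative, because the phase stays within pi / 2 for the charge of a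
    1-Lipschitz function, and its integral over a horizontal segment is at most pi. Integration by
    parts trades the almost everywhere derivative of the charge for the charge itself, against the
    kernel [(z - w)^-2]. This makes signs visible: off the support of a nonnegative charge the
    boundary value of this potential is a nonnegative real, so its exponential enlarges the density.
    Near the support nothing of the kind holds, so the comparison keeps a distance [d] from [z0] on
    the left and from [zmax] on the right. There the phase of the factor is [O(y)]; this has to be
    weighed against the real part of [G], which is not controlled by the density pointwise. Only
    lower bounds for masses on compact intervals are drawn from Stieltjes inversion, so no
    convergence of densities is needed, and [d] is made small at the end. *)

Section LipschitzFTC.
Context {R : realType}.
Notation mu := (@lebesgue_measure R).

(** A Lebesgue-null set has a cover by half-open intervals of total length below [e / c]; their
    total [F]-length is at most [e]. *)
Lemma lebesgue_stieltjes_dominated (F : cumulative R R) (c : R) :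
  0 < c -> (forall a b, a <= b -> F b - F a <= c * (b - a)) ->
  lebesgue_stieltjes_measure F `<< mu.
Proof.
move=> c0 Fc; apply/null_content_dominatesP => A mA A0.
apply/eqP; rewrite -measure_le0; apply/lee_addgt0Pr => e e0; rewrite add0e.
have ec0 : 0 < e / c by rewrite divr_gt0.
have fA : mu A \is a fin_num by rewrite A0.
have [_ [C [mC AC] <-]] := lb_ereal_inf_adherent ec0 fA.
rewrite -[X in (_ < X + _)%E]/(mu A) A0 add0e => Ce.
have wle X : ocitv X -> (wlength F X <= c%:E * wlength idfun X)%E.
  move=> /ocitvP[->|[[a b] /= ab ->]]; first by rewrite !wlength0 mule0.
  by rewrite !wlength_itv_bnd ?(ltW ab)// -EFinM lee_fin Fc // ltW.
apply: (@le_trans _ _ (\sum_(k <oo) wlength F (C k))%E).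
  by apply: ereal_inf_lbound; exists C.
apply: (@le_trans _ _ (\sum_(k <oo) c%:E * wlength idfun (C k))%E).
  apply: lee_nneseries => [k _ _|k _]; [exact: (wlength_ge0 F)|exact/wle/mC].
rewrite nneseriesZl//.
have -> : e%:E = (c%:E * (e / c)%:E)%E by rewrite -EFinM mulrC mulfVK ?gt_eqF.
by apply: lee_wpmul2l; rewrite ?lee_fin ltW.
Qed.

Lemma is_derive_quotient (f : R -> R) (x l : R) : is_derive x 1 f l ->
  h^-1 * (f (h + x) - f x) @[h --> 0^'] --> l.
Proof.
move=> [df <-].
have -> : (fun h => h^-1 * (f (h + x) - f x)) =
          (fun h => h^-1 *: ((f \o shift x) (h *: 1) - f x)).
  by apply/funext => h; rewrite /= /GRing.scale/= mulr1.
exact: df.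
Qed.

Lemma lipschitz_is_derive_le (f : R -> R) (K x l : R) :
  (forall s t, `|f s - f t| <= K * `|s - t|) -> is_derive x 1 f l -> `|l| <= K.
Proof.
move=> fK /is_derive_quotient fl; apply/ler_addgt0Pr => e e0.
move: fl => /cvgrPdist_lt /(_ _ e0) fl.
near (0 : R)^' => h.
have h0 : h != 0 by near: h; exact: nbhs_dnbhs_neq.
have hl : `|l - h^-1 * (f (h + x) - f x)| < e by near: h.
have : `|h^-1 * (f (h + x) - f x)| <= K.
  rewrite normrM normfV ler_pdivrMl ?normr_gt0// mulrC.
  by have := fK (h + x) x; rewrite addrK.
move=> qK; rewrite -[l](subrK (h^-1 * (f (h + x) - f x))).
by rewrite (le_trans (ler_normD _ _))// addrC lerD// ltW.
Unshelve. all: by end_near. Qed.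

Lemma lipschitz_continuous (f : R -> R) (K : R) :
  (forall s t, `|f s - f t| <= K * `|s - t|) -> continuous f.
Proof.
move=> fK x; apply/(@cvgrPdist_lt _ R^o) => e e0.
have K0 : 0 < `|K| + 1 by rewrite ltr_wpDl.
near=> t; rewrite (le_lt_trans (fK _ _))//.
rewrite (@le_lt_trans _ _ ((`|K| + 1) * `|x - t|))//.
  by rewrite ler_wpM2r// (le_trans (ler_norm _))// lerDl.
rewrite mulrC -ltr_pdivlMr//; near: t.
by apply: (@cvgr_dist_lt _ R^o); [exact: cvg_id|rewrite divr_gt0].
Unshelve. all: by end_near. Qed.

Lemma bounded_integrable (A : set R) (f : R -> R) (C : R) :
  measurable A -> (mu A < +oo)%E -> measurable_fun A f ->
  (forall x, A x -> `|f x| <= C) -> mu.-integrable A (EFin \o f).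
Proof.
move=> mA Aoo mf fC; apply: measurable_bounded_integrable => //.
exists C; split; first exact: num_real.
by move=> y Cy x Ax; exact: (le_trans (fC _ Ax) (ltW Cy)).
Qed.

Lemma lebesgue_itv_lty (a b : R) (s t : bool) :
  (mu [set` Interval (BSide s a) (BSide t b)] < +oo)%E.
Proof. by rewrite lebesgue_measure_itv; case: ifP => // _; rewrite ltry. Qed.

Lemma aeS (P Q : R -> Prop) : {ae mu, forall x, P x} ->
  (forall x, P x -> Q x) -> {ae mu, forall x, Q x}.
Proof.
by move=> H PQ; apply: filterS H => //; exact: (ae_filter_ringOfSetsType mu).
Qed.

Lemma clamp_le (x K : R) : 0 < K -> `|Num.max (- K) (Num.min K x)| <= K.
Proof.
by move=> K0; rewrite ler_norml le_max ge_max ge_min !lexx/= andbT; lra.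
Qed.

(** [f + K x] is nondecreasing with slopes at most [2 K], so its Stieltjes measure has a Lebesgue
    density [h], and Lebesgue differentiation identifies [h - K] with the derivative of [f] almost
    everywhere. The window []- N, N]] makes the measure finite. *)
Lemma lipschitz_FTC (f : R -> R) (K N : R) : 0 < K -> 0 < N ->
  (forall s t, `|f s - f t| <= K * `|s - t|) ->
  exists g : R -> R, [/\ measurable_fun setT g, (forall x, `|g x| <= K),
    {ae mu, forall x, - N < x < N -> is_derive x 1 f (g x)} &
    forall a b, - N <= a -> a <= b -> b <= N ->
      \int[mu]_(x in `[a, b]) g x = f b - f a].
Proof.
move=> K0 N0 fK.
have cf := lipschitz_continuous fK.
pose F0 x := f x + K * x.
have ndF0 : nondecreasing F0.
  move=> x y xy; rewrite /F0; have := fK y x.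
  by rewrite (ger0_norm (_ : 0 <= y - x)) ?subr_ge0// ler_norml => /andP[]; lra.
have cF0 : continuous F0.
  move=> x; apply: cvgD; first exact: cf.
  by apply: cvgM; [exact: cvg_cst|exact: cvg_id].
pose F : cumulative R R := HB.pack F0 (isCumulative.Build R _ R F0 ndF0 (right_continuousW cF0)).
have FE a b : a <= b -> lebesgue_stieltjes_measure F `]a, b]%classic = (F0 b - F0 a)%:E.
  move=> ab; rewrite /lebesgue_stieltjes_measure /measure_extension measurable_mu_extE/=; last exact: is_ocitv.
  by rewrite wlength_itv_bnd.
pose I : set (measurableTypeR R) := `]- N, N]%classic.
have mI : measurable I by exact: measurable_itv.
have fI : (lebesgue_stieltjes_measure F I < +oo)%E.
  by rewrite FE ?ltry//; lra.
pose nu := mfrestr mI fI.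
have numu : nu `<< mu.
  have K20 : 0 < 2 * K by lra.
  have := @lebesgue_stieltjes_dominated F (2 * K) K20.
  have H : forall a b : R, a <= b -> F b - F a <= 2 * K * (b - a).
    move=> a b ab; rewrite /= /F0; have := fK b a.
    by rewrite (ger0_norm (_ : 0 <= b - a)) ?subr_ge0// ler_norml => /andP[]; lra.
  move=> /(_ H)/null_content_dominatesP D.
  apply/null_content_dominatesP => A mA A0.
  rewrite /nu /mfrestr /= /mrestr; apply/eqP; rewrite -measure_le0 -(D _ mA A0).
  by apply: le_measure; rewrite ?inE//; exact: measurableI.
set rn := Radon_Nikodym_SigmaFinite.f nu mu.
have rnf := Radon_Nikodym_SigmaFinite.f_fin_num numu.
have rni := Radon_Nikodym_SigmaFinite.f_integrable numu.
have rnE := Radon_Nikodym_SigmaFinite.f_integral numu.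
pose h x := fine (rn x).
have ih : mu.-integrable setT (EFin \o h).
  by apply: eq_integrable rni => // x _; rewrite /= fineK.
have mh : measurable_fun setT h by apply/measurable_EFinP; exact: measurable_int ih.
have Fh a b : - N <= a -> a <= b -> b <= N -> \int[mu]_(x in `]a, b]) h x = F0 b - F0 a.
  move=> Na ab bN; rewrite /Rintegral.
  under eq_integral do rewrite fineK//.
  have nuE : nu `]a, b]%classic = (F0 b - F0 a)%:E.
    rewrite /nu /mfrestr /mrestr setIidl ?FE//.
    by move=> x /=; rewrite /I/= !in_itv/= => /andP[]; lra.
  by rewrite -rnE// [X in fine X]nuE.
have ihS A : measurable A -> mu.-integrable A (EFin \o h).
  by move=> mA; apply: (integrableS measurableT).
have loch : locally_integrable setT h by exact: (open_integrable_locally openT).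
have FTCh := FTC1 (fun y => ihS _ (measurable_itv (Interval (BRight (- N)) (BRight y)))) loch.
(* Inside the window the truncation changes [h - K] only on a null set, since a derivative of [f]
   has absolute value at most [K]; it makes the bound hold at every point. *)
pose g x := Num.max (- K) (Num.min K (h x - K)).
have mg : measurable_fun setT g.
  apply: measurable_maxr => //; apply: measurable_minr => //.
  exact: measurable_funB.
have gh : {ae mu, forall x, - N < x < N -> is_derive x 1 f (g x) /\ g x = h x - K}.
  apply: (aeS FTCh) => x H /andP[Nx xN].
  have := H; rewrite lte_fin => /(_ Nx) [dG GE].
  have dF0 : is_derive x 1 F0 (h x).
    apply: (@near_eq_is_derive _ _ _ (fun y => \int[mu]_(t in `]- N, y]) h t + F0 (- N))).
    - near=> y; rewrite Fh ?subrK//.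
      + by apply: ltW; near: y; exact: lt_nbhsr.
      + by apply: ltW; near: y; exact: lt_nbhsl.
    - rewrite -[X in is_derive _ _ _ X]addr0; apply: is_deriveD.
      by apply: DeriveDef; [exact: dG|rewrite -derive1E; exact: GE].
  have dfx : is_derive x 1 f (h x - K).
    have -> : f = F0 - (K \*: id).
      by apply/funext => y; rewrite /F0 !fctE/= addrK.
    rewrite -[X in h x - X]mulr1; exact: is_deriveB.
  have := lipschitz_is_derive_le fK dfx; rewrite ler_norml => /andP[h1 h2].
  have gE : g x = h x - K by rewrite /g min_r// max_r.
  by rewrite gE.
exists g; split => //.
- by move=> x; exact: clamp_le.
- by apply: (aeS gh) => x H /H[].
- move=> a b Na ab bN.
  have mgo : measurable_fun `]a, b[ (EFin \o g).
    by apply/measurable_EFinP; exact: measurable_funS mg.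
  have mho : measurable_fun `]a, b[ (fun x => (h x - K)%:E).
    by apply/measurable_EFinP; apply: measurable_funB => //; exact: measurable_funS mh.
  have ihab : mu.-integrable `]a, b] (EFin \o h) by exact: ihS.
  have icst : mu.-integrable `]a, b] (EFin \o (cst K)).
    by apply: (@bounded_integrable _ _ `|K|) => //; exact: lebesgue_itv_lty.
  transitivity (\int[mu]_(x in `]a, b]) (h x - K)).
    rewrite /Rintegral integral_itv_bndoo// [in RHS]integral_itv_bndoo//.
    congr fine; apply: ae_eq_integral => //.
    apply: (aeS gh) => x H /=; rewrite in_itv/= => /andP[ax xb].
    by have [|_ ->] := H => //; apply/andP; split; lra.
  rewrite RintegralB//= Fh// Rintegral_cst//= lebesgue_measure_itv/= lte_fin /F0.
  by move: ab; rewrite le_eqVlt => /predU1P[->|->]/=; rewrite ?ltxx/=; lra.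
Unshelve. all: by end_near. Qed.
End LipschitzFTC.

(** * Almost everywhere comparison of integrals of arbitrary functions *)

Section AEIntegral.
Context d (T : measurableType d) {R : realType} (mu : {measure set T -> \bar R}).
Import HBNNSimple.

(** Stated for arbitrary functions because it serves for [derive1 s] with [s] Lipschitz, whose
    measurability is not established. A simple function below [f], set to 0 on the exceptional null
    set, keeps its integral and lies below [g] everywhere. *)
Lemma ae_ge0_le_integral (f g : T -> \bar R) :
  (forall x, 0 <= f x)%E -> (forall x, 0 <= g x)%E ->
  {ae mu, forall x, (f x <= g x)%E} -> (\int[mu]_x f x <= \int[mu]_x g x)%E.
Proof.
move=> f0 g0 [N [mN N0 fgN]].
rewrite (ge0_integralTE mu f0) (ge0_integralTE mu g0).
apply: ge_ereal_sup => _ [h hf <-].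
pose k := mul_nnsfun h (indic_nnsfun R (measurableC mN)).
have <- : sintegral mu k = sintegral mu h.
  rewrite -!integralT_nnsfun; apply: ge0_ae_eq_integral => //.
  - exact/measurable_EFinP.
  - exact/measurable_EFinP.
  - by move=> x _; rewrite lee_fin.
  - by move=> x _; rewrite lee_fin.
  - exists N; split => // x /= /not_implyP[_] H; apply: contrapT => nN; apply: H.
    by rewrite /k /= mindicE mem_set ?mulr1.
apply: ereal_sup_ubound; exists k => //= x.
rewrite /= mindicE; case: (boolP (x \in ~` N)) => [|_]; last by rewrite mulr0 g0.
rewrite inE mulr1 => nN; apply: (le_trans (hf x)).
by apply: contrapT => H; apply: nN; apply: fgN.
Qed.

Lemma ae_integral_eq (f g : T -> \bar R) :
  {ae mu, forall x, f x = g x} -> (\int[mu]_x f x = \int[mu]_x g x)%E.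
Proof.
move=> [N [mN N0 fgN]]; rewrite integralE [in RHS]integralE.
suff H h k : (forall x, 0 <= h x)%E -> (forall x, 0 <= k x)%E ->
    (forall x, f x = g x -> h x = k x) -> (\int[mu]_x h x = \int[mu]_x k x)%E.
  congr (_ - _)%E; apply: H => // x; rewrite ?funeposE ?funenegE => ->//.
move=> h0 k0 fghk; apply/eqP; rewrite eq_le; apply/andP; split;
  apply: ae_ge0_le_integral => //; exists N; split => // x /= H; apply: fgN => /=;
  by apply: contra_not H => /fghk ->.
Qed.
End AEIntegral.

(** * Integration by parts for Lipschitz functions *)

Section IntegrationByParts.
Context {R : realType}.
Notation mu := (@lebesgue_measure R).

Lemma bounded_derive_lipschitz (k k' : R -> R) (C : R) :
  (forall t : R, is_derive t 1 k (k' t)) -> (forall t, `|k' t| <= C) ->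
  forall s t, `|k s - k t| <= C * `|s - t|.
Proof.
move=> dk k'C s t; wlog ts : s t / t < s.
  move=> H; have [|st|->] := ltgtP t s; first exact: H.
    by rewrite distrC (distrC s); exact: H.
  by rewrite !subrr normr0 mulr0.
have [|c _ ->] := MVT ts (fun x _ => dk x).
  by apply: derivable_within_continuous => x _; case: (dk x).
by rewrite normrM ler_wpM2r.
Qed.

(** The product [s k] is Lipschitz, hence the integral of a bounded density, and it vanishes at both
    ends; almost everywhere the density is [g k + s k']. *)
Lemma lipschitz_by_parts (s g k k' : R -> R) (K B C N : R) :
  0 < K -> 0 <= B -> 0 < C -> 0 < N ->
  (forall x y, `|s x - s y| <= K * `|x - y|) -> (forall x, `|s x| <= B) ->
  s N = 0 -> s (- N) = 0 ->
  measurable_fun setT g -> (forall x, `|g x| <= K) ->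
  {ae mu, forall x, - N < x < N -> is_derive x 1 s (g x)} ->
  (forall t : R, is_derive t 1 k (k' t)) -> (forall t, `|k t| <= C) ->
  (forall t, `|k' t| <= C) -> measurable_fun setT k' ->
  \int[mu]_(t in `[- N, N]) (g t * k t) =
  - \int[mu]_(t in `[- N, N]) (s t * k' t).
Proof.
move=> K0 B0 C0 N0 sK sB sN sNN mg gK sg dk kC k'C mk'.
have kL := bounded_derive_lipschitz dk k'C.
have cs := lipschitz_continuous sK.
have ms : measurable_fun setT s by exact: continuous_measurable_fun.
have mk : measurable_fun setT k.
  by apply: continuous_measurable_fun; exact: lipschitz_continuous kL.
have L0 : 0 < B * C + C * K by rewrite ltr_wpDl ?mulr_ge0 ?mulr_gt0// ltW.
have PL x y : `|s x * k x - s y * k y| <= (B * C + C * K) * `|x - y|.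
  have -> : s x * k x - s y * k y = s x * (k x - k y) + k y * (s x - s y) by ring.
  rewrite (le_trans (ler_normD _ _))// !normrM mulrDl -!mulrA.
  by rewrite lerD// ler_pM.
have [G [mG GL sG GE]] := lipschitz_FTC L0 N0 PL.
have itv : measurable `[- N, N]%classic by exact: measurable_itv.
have i1 : mu.-integrable `[- N, N] (EFin \o (fun t => g t * k t)).
  apply: (@bounded_integrable _ _ _ (K * C)) => //.
  - exact: lebesgue_itv_lty.
  - by apply: measurable_funS (measurable_funM mg mk).
  - by move=> x _; rewrite normrM ler_pM.
have i2 : mu.-integrable `[- N, N] (EFin \o (fun t => s t * k' t)).
  apply: (@bounded_integrable _ _ _ (B * C)) => //.
  - exact: lebesgue_itv_lty.
  - by apply: measurable_funS (measurable_funM ms mk').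
  - by move=> x _; rewrite normrM ler_pM.
apply/eqP; rewrite -subr_eq0 opprK -RintegralD//; apply/eqP.
transitivity (\int[mu]_(x in `[- N, N]) G x); last first.
  by rewrite GE ?sN ?sNN ?mul0r ?subrr//; lra.
rewrite /Rintegral; congr fine.
have mgk : measurable_fun setT (fun t => g t * k t + s t * k' t).
  by apply: measurable_funD; exact: measurable_funM.
rewrite integral_itv_bndoo; last first.
  by apply/measurable_EFinP; exact: measurable_funS mgk.
rewrite [in RHS]integral_itv_bndoo; last first.
  by apply/measurable_EFinP; exact: measurable_funS mG.
apply: ae_eq_integral => //.
- by apply/measurable_EFinP; exact: measurable_funS mgk.
- by apply/measurable_EFinP; exact: measurable_funS mG.
have sgG : {ae mu, forall x, (- N < x < N -> is_derive x 1 s (g x)) /\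
    (- N < x < N -> is_derive x 1 (fun t => s t * k t) (G x))}.
  by apply: filterI => //; exact: (ae_filter_ringOfSetsType mu).
apply: (aeS sgG) => x [sgx sGx] /=; rewrite in_itv/= => xN.
congr EFin; have {}sGx := sGx xN; have {}sgx := sgx xN; have dkx := dk x.
have : is_derive x 1 (s * k) (s x *: k' x + k x *: g x) by exact: is_deriveM.
move=> /@derive_val; rewrite [LHS](@derive_val _ _ _ _ _ _ _ sGx) => ->.
by rewrite /GRing.scale/=; ring.
Qed.

(** Where [s] is not differentiable, [derive1 s] may be a default value, but inside the window this
    concerns only a null set. Outside []- N, N[] it is 0: [M < N] makes [s] vanish in a
    neighbourhood of each such point. *)
Lemma derive1_by_parts (s k k' : R -> R) (K B C M N : R) :
  0 < K -> 0 <= B -> 0 < C -> 0 < M -> M < N ->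
  (forall x y, `|s x - s y| <= K * `|x - y|) -> (forall x, `|s x| <= B) ->
  (forall x, M <= `|x| -> s x = 0) ->
  (forall t : R, is_derive t 1 k (k' t)) -> (forall t, `|k t| <= C) ->
  (forall t, `|k' t| <= C) -> measurable_fun setT k' ->
  \int[mu]_t (derive1 s t * k t) = - \int[mu]_(t in `[- N, N]) (s t * k' t).
Proof.
move=> K0 B0 C0 M0 MN sK sB s0 dk kC k'C mk'.
have N0 : 0 < N by lra.
have [g [mg gK sg _]] := lipschitz_FTC K0 N0 sK.
have kL := bounded_derive_lipschitz dk k'C.
have mk : measurable_fun setT k.
  by apply: continuous_measurable_fun; exact: lipschitz_continuous kL.
rewrite -(@lipschitz_by_parts s g k k' K B C N)//; first last.
- by rewrite s0// normrN ger0_norm; lra.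
- by rewrite s0// ger0_norm; lra.
rewrite /Rintegral integral_itv_bndoo; last first.
  by apply/measurable_EFinP; apply: measurable_funS (measurable_funM mg mk).
rewrite [in RHS]integral_mkcond; congr fine.
apply: ae_integral_eq; apply: (aeS sg) => x sgx.
rewrite patchE; case: ifPn => [|xN].
  rewrite inE/= in_itv/= => /sgx H.
  by rewrite derive1E (@derive_val _ _ _ _ _ _ _ H).
rewrite derive1E; suff -> : 'D_1 s x = 0 by rewrite mul0r.
have Nx : N <= `|x|.
  rewrite leNgt ltr_norml; apply: contra xN => xN.
  by rewrite inE/= in_itv.
have Mx : M < `|x| by lra.
apply: (@derive_val _ _ _ _ _ _ 0); apply: (@near_eq_is_derive _ _ _ (cst 0)).
  near=> z; rewrite s0//; apply: ltW; near: z.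
  exact: (@cvgr_norm_gt _ R^o _ _ _ id x (@cvg_id _ _) _ Mx).
Unshelve. all: by end_near. Qed.
End IntegrationByParts.

(** * Derivatives and kernels *)

Section DeriveRules.
Context {R : realType}.
Implicit Types (f g : R -> R) (x c : R).

Lemma derive_cst x c : is_derive x 1 (fun _ : R => c) 0.
Proof. exact: is_derive_cst. Qed.

Lemma derive_id x : is_derive x 1 (fun t : R => t) 1.
Proof. exact: is_derive_id. Qed.

Lemma derive_add x f g df dg : is_derive x 1 f df -> is_derive x 1 g dg ->
  is_derive x 1 (fun t => f t + g t) (df + dg).
Proof. exact: is_deriveD. Qed.

Lemma derive_opp x f df : is_derive x 1 f df -> is_derive x 1 (fun t => - f t) (- df).
Proof. exact: is_deriveN. Qed.

Lemma derive_mul x f g df dg : is_derive x 1 f df -> is_derive x 1 g dg ->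
  is_derive x 1 (fun t => f t * g t) (f x * dg + g x * df).
Proof. exact: is_deriveM. Qed.

Lemma derive_pow x f n df : is_derive x 1 f df ->
  is_derive x 1 (fun t => f t ^+ n) (n%:R * f x ^+ n.-1 * df).
Proof. by move=> H; have := is_deriveX n H; rewrite exprfctE. Qed.

Lemma derive_comp x f g df dg : is_derive (f x) 1 g dg -> is_derive x 1 f df ->
  is_derive x 1 (fun t => g (f t)) (dg * df).
Proof. by move=> dG dF; have := is_derive1_comp dG dF. Qed.

Lemma derive_inv x f df : f x != 0 -> is_derive x 1 f df ->
  is_derive x 1 (fun t => (f t)^-1) (- df / f x ^+ 2).
Proof.
move=> fx0 dF; have := is_deriveV fx0 dF; rewrite /GRing.scale/= => H.
by apply: (is_derive_eq H); rewrite mulrC mulrN mulNr.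
Qed.

Lemma derive_expR x f df : is_derive x 1 f df ->
  is_derive x 1 (fun t => expR (f t)) (expR (f x) * df).
Proof. by move=> dF; apply: derive_comp dF; exact: is_derive_expR. Qed.

Lemma derive_cos x f df : is_derive x 1 f df ->
  is_derive x 1 (fun t => cos (f t)) (- sin (f x) * df).
Proof. by move=> dF; apply: derive_comp dF; exact: is_derive_cos. Qed.

Lemma derive_sin x f df : is_derive x 1 f df ->
  is_derive x 1 (fun t => sin (f t)) (cos (f x) * df).
Proof. by move=> dF; apply: derive_comp dF; exact: is_derive_sin. Qed.

Lemma derive_ln x f df : 0 < f x -> is_derive x 1 f df ->
  is_derive x 1 (fun t => ln (f t)) ((f x)^-1 * df).
Proof. by move=> fx dF; apply: derive_comp dF; exact: is_derive1_ln. Qed.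

Lemma derive_atan x f df : is_derive x 1 f df ->
  is_derive x 1 (fun t => atan (f t)) ((1 + f x ^+ 2)^-1 * df).
Proof. by move=> dF; apply: derive_comp dF; exact: is_derive1_atan. Qed.

Lemma is_derive_continuous x f df : is_derive x 1 f df -> {for x, continuous f}.
Proof. by move=> [+ _] => /derivable1_diffP/differentiable_continuous. Qed.
End DeriveRules.

(** Builds the derivative along the syntax of the function and leaves its value to unification;
    hypotheses about opaque subfunctions take precedence. Conditions on denominators and on
    arguments of logarithms remain as goals. *)
Ltac der :=
  lazymatch goal with
  | H : is_derive ?x 1 ?f _ |- is_derive ?x 1 ?f _ => exact H
  | |- is_derive _ _ (fun t => @?f t + @?g t) _ => eapply (@derive_add _ _ f g); der
  | |- is_derive _ _ (fun t => - @?f t) _ => eapply (@derive_opp _ _ f); der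
  | |- is_derive _ _ (fun t => @?f t * @?g t) _ => eapply (@derive_mul _ _ f g); der
  | |- is_derive _ _ (fun t => (@?f t)^-1) _ => eapply (@derive_inv _ _ f); [|der]
  | |- is_derive _ _ (fun t => @?f t ^+ ?n) _ => eapply (@derive_pow _ _ f n); der
  | |- is_derive _ _ (fun t => expR (@?f t)) _ => eapply (@derive_expR _ _ f); der
  | |- is_derive _ _ (fun t => cos (@?f t)) _ => eapply (@derive_cos _ _ f); der
  | |- is_derive _ _ (fun t => sin (@?f t)) _ => eapply (@derive_sin _ _ f); der
  | |- is_derive _ _ (fun t => ln (@?f t)) _ => eapply (@derive_ln _ _ f); [|der]
  | |- is_derive _ _ (fun t => atan (@?f t)) _ => eapply (@derive_atan _ _ f); der
  | |- is_derive _ _ -%R _ => exact: is_deriveNid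
  | |- is_derive _ _ (fun t => t) _ => exact: derive_id
  | |- is_derive _ _ (fun _ => ?c) _ => exact: derive_cst
  | |- is_derive _ _ _ _ => eassumption
  end.

Section Kernels.
Context {R : realType}.
Implicit Types (x y u t w : R).

(* With [z = u + i y]: [z^-1 = kphi - i kpsi], [z^-2 = kphi2 - i kpsi2] and [z^-3 = kphi3 - i kpsi3]. *)
Definition kphi y u := u / (u ^+ 2 + y ^+ 2).
Definition kpsi y u := y / (u ^+ 2 + y ^+ 2).
Definition kphi2 y u := (u ^+ 2 - y ^+ 2) / (u ^+ 2 + y ^+ 2) ^+ 2.
Definition kpsi2 y u := (2 * u * y) / (u ^+ 2 + y ^+ 2) ^+ 2.
Definition kphi3 y u := (u ^+ 3 - 3 * u * y ^+ 2) / (u ^+ 2 + y ^+ 2) ^+ 3.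
Definition kpsi3 y u := (3 * u ^+ 2 * y - y ^+ 3) / (u ^+ 2 + y ^+ 2) ^+ 3.

Lemma sqrD_gt0 y u : y != 0 -> 0 < u ^+ 2 + y ^+ 2.
Proof. by move=> y0; rewrite ltr_wpDl ?sqr_ge0// exprn_even_gt0. Qed.

Lemma sqrD_neq0 y u : y != 0 -> u ^+ 2 + y ^+ 2 != 0.
Proof. by move=> y0; rewrite gt_eqF// sqrD_gt0. Qed.

Lemma derive_kphi y w x : y != 0 ->
  is_derive w 1 (fun t => kphi y (x - t)) (kphi2 y (x - w)).
Proof.
move=> y0; have D0 := sqrD_neq0 (x - w) y0; rewrite /kphi; (eapply is_derive_eq; first by der).
by rewrite /kphi2 /=; field.
Qed.

Lemma derive_kpsi y w x : y != 0 ->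
  is_derive w 1 (fun t => kpsi y (x - t)) (kpsi2 y (x - w)).
Proof.
move=> y0; have D0 := sqrD_neq0 (x - w) y0; rewrite /kpsi; (eapply is_derive_eq; first by der).
by rewrite /kpsi2 /=; field.
Qed.

Lemma derive_x_kphi y x : y != 0 -> is_derive x 1 (kphi y) (- kphi2 y x).
Proof.
move=> y0; have D0 := sqrD_neq0 x y0; rewrite /kphi; (eapply is_derive_eq; first by der).
by rewrite /kphi2 /=; field.
Qed.

Lemma derive_x_kpsi y x : y != 0 -> is_derive x 1 (kpsi y) (- kpsi2 y x).
Proof.
move=> y0; have D0 := sqrD_neq0 x y0; rewrite /kpsi; (eapply is_derive_eq; first by der).
by rewrite /kpsi2 /=; field.
Qed.

Lemma derive_y_kphi y x : y != 0 -> is_derive y 1 (kphi^~ x) (- kpsi2 y x).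
Proof.
move=> y0; have D0 := sqrD_neq0 x y0; rewrite /kphi; (eapply is_derive_eq; first by der).
by rewrite /kpsi2 /=; field.
Qed.

Lemma derive_y_kpsi y x : y != 0 -> is_derive y 1 (kpsi^~ x) (kphi2 y x).
Proof.
move=> y0; have D0 := sqrD_neq0 x y0; rewrite /kpsi; (eapply is_derive_eq; first by der).
by rewrite /kphi2 /=; field.
Qed.

Lemma derive_x_kphi2 y u : y != 0 ->
  is_derive u 1 (kphi2 y) (- 2 * kphi3 y u).
Proof.
move=> y0; have D0 := sqrD_neq0 u y0; rewrite /kphi2; (eapply is_derive_eq;
  first by der; rewrite expf_neq0).
by rewrite /kphi3 /=; field.
Qed.

Lemma derive_x_kpsi2 y u : y != 0 ->
  is_derive u 1 (kpsi2 y) (- 2 * kpsi3 y u).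
Proof.
move=> y0; have D0 := sqrD_neq0 u y0; rewrite /kpsi2; (eapply is_derive_eq;
  first by der; rewrite expf_neq0).
by rewrite /kpsi3 /=; field.
Qed.

Lemma derive_y_kphi2 y u : y != 0 ->
  is_derive y 1 (kphi2^~ u) (- 2 * kpsi3 y u).
Proof.
move=> y0; have D0 := sqrD_neq0 u y0; rewrite /kphi2; (eapply is_derive_eq;
  first by der; rewrite expf_neq0).
by rewrite /kpsi3 /=; field.
Qed.

Lemma derive_y_kpsi2 y u : y != 0 ->
  is_derive y 1 (kpsi2^~ u) (2 * kphi3 y u).
Proof.
move=> y0; have D0 := sqrD_neq0 u y0; rewrite /kpsi2; (eapply is_derive_eq;
  first by der; rewrite expf_neq0).
by rewrite /kphi3 /=; field.
Qed.

Lemma continuous_kphi y : y != 0 -> continuous (kphi y).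
Proof. by move=> y0 u; exact: is_derive_continuous (derive_x_kphi u y0). Qed.

Lemma continuous_kpsi y : y != 0 -> continuous (kpsi y).
Proof. by move=> y0 u; exact: is_derive_continuous (derive_x_kpsi u y0). Qed.

Lemma continuous_kphi2 y : y != 0 -> continuous (kphi2 y).
Proof. by move=> y0 u; exact: is_derive_continuous (derive_x_kphi2 u y0). Qed.

Lemma continuous_kpsi2 y : y != 0 -> continuous (kpsi2 y).
Proof. by move=> y0 u; exact: is_derive_continuous (derive_x_kpsi2 u y0). Qed.

Lemma continuous_kphi3 y : y != 0 -> continuous (kphi3 y).
Proof.
move=> y0 u; have D0 := sqrD_neq0 u y0; rewrite /kphi3.
by eapply is_derive_continuous; der; rewrite expf_neq0.
Qed.

Lemma continuous_kpsi3 y : y != 0 -> continuous (kpsi3 y).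
Proof.
move=> y0 u; have D0 := sqrD_neq0 u y0; rewrite /kpsi3.
by eapply is_derive_continuous; der; rewrite expf_neq0.
Qed.

Lemma kphi_le y u : 0 < y -> `|kphi y u| <= y^-1.
Proof.
move=> y0; have D0 := sqrD_gt0 u (lt0r_neq0 y0).
rewrite /kphi normrM normfV (gtr0_norm D0) ler_pdivrMr// mulrC ler_pdivlMr//.
have := sqr_ge0 (`|u| - y); rewrite -(real_normK (num_real u)); nra.
Qed.

Lemma kpsi_ge0 y u : 0 < y -> 0 <= kpsi y u.
Proof. by move=> y0; rewrite divr_ge0// ?ltW// ?sqrD_gt0 ?gt_eqF. Qed.

Lemma kpsi_le y u : 0 < y -> `|kpsi y u| <= y^-1.
Proof.
move=> y0; have D0 := sqrD_gt0 u (lt0r_neq0 y0).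
rewrite ger0_norm ?kpsi_ge0// /kpsi ler_pdivrMr// mulrC ler_pdivlMr//.
by have := sqr_ge0 u; nra.
Qed.

Lemma kphi2_leD y u : 0 < y -> `|kphi2 y u| <= (u ^+ 2 + y ^+ 2)^-1.
Proof.
move=> y0; have D0 := sqrD_gt0 u (lt0r_neq0 y0).
rewrite /kphi2 normrM normfV (gtr0_norm (exprn_gt0 2 D0)) ler_pdivrMr ?exprn_gt0//.
rewrite expr2 mulrA mulVf ?gt_eqF// mul1r ler_norml.
by have := sqr_ge0 u; have := sqr_ge0 y; move=> ? ?; apply/andP; split; lra.
Qed.

Lemma kpsi2_leD y u : 0 < y -> `|kpsi2 y u| <= (u ^+ 2 + y ^+ 2)^-1.
Proof.
move=> y0; have D0 := sqrD_gt0 u (lt0r_neq0 y0).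
rewrite /kpsi2 normrM normfV (gtr0_norm (exprn_gt0 2 D0)) ler_pdivrMr ?exprn_gt0//.
rewrite expr2 mulrA mulVf ?gt_eqF// mul1r ler_norml.
have := sqr_ge0 (u - y); have := sqr_ge0 (u + y).
by move=> ? ?; apply/andP; split; nra.
Qed.

Lemma invD_le y u : 0 < y -> (u ^+ 2 + y ^+ 2)^-1 <= y ^- 2.
Proof.
move=> y0; rewrite lef_pV2 ?posrE ?sqrD_gt0 ?gt_eqF ?exprn_gt0//.
by rewrite lerDr sqr_ge0.
Qed.

Lemma kphi2_le y u : 0 < y -> `|kphi2 y u| <= y ^- 2.
Proof. by move=> y0; rewrite (le_trans (kphi2_leD u y0))// invD_le. Qed.

Lemma kpsi2_le y u : 0 < y -> `|kpsi2 y u| <= y ^- 2.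
Proof. by move=> y0; rewrite (le_trans (kpsi2_leD u y0))// invD_le. Qed.

(** Real part of [z^-3 = z^-1 z^-2], which reduces the bounds on the cubic kernels to those on the
    previous ones. *)
Lemma kphi3E y u : y != 0 -> kphi3 y u = kphi y u * kphi2 y u - kpsi y u * kpsi2 y u.
Proof.
move=> y0; have D0 := sqrD_neq0 u y0.
by rewrite /kphi3 /kphi /kphi2 /kpsi /kpsi2; field.
Qed.

Lemma kpsi3E y u : y != 0 -> kpsi3 y u = kphi y u * kpsi2 y u + kpsi y u * kphi2 y u.
Proof.
move=> y0; have D0 := sqrD_neq0 u y0.
by rewrite /kpsi3 /kphi /kphi2 /kpsi /kpsi2; field.
Qed.

Lemma kphi3_le y u : 0 < y -> `|kphi3 y u| <= 2 * y ^- 3.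
Proof.
move=> y0; rewrite kphi3E ?gt_eqF// mulr_natl mulr2n exprS invfM.
rewrite (le_trans (ler_normB _ _))// (normrM (kphi y u)) (normrM (kpsi y u)).
by rewrite lerD// ler_pM ?kphi_le ?kphi2_le ?kpsi_le ?kpsi2_le.
Qed.

Lemma kpsi3_le y u : 0 < y -> `|kpsi3 y u| <= 2 * y ^- 3.
Proof.
move=> y0; rewrite kpsi3E ?gt_eqF// mulr_natl mulr2n exprS invfM.
rewrite (le_trans (ler_normD _ _))// (normrM (kphi y u)) (normrM (kpsi y u)).
by rewrite lerD// ler_pM ?kphi_le ?kphi2_le ?kpsi_le ?kpsi2_le.
Qed.
End Kernels.

(** * Integrals depending on a parameter *)

Section ParamIntegral.
Context {R : realType}.
Notation mu := (@lebesgue_measure R).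

Lemma le_Rintegral_itv_cst (f : R -> R) (a b C : R) : a <= b ->
  measurable_fun `[a, b] f -> (forall x, `[a, b]%classic x -> `|f x| <= C) ->
  `|\int[mu]_(x in `[a, b]) f x| <= C * (b - a).
Proof.
move=> ab mf fC.
have if_ : mu.-integrable `[a, b] (EFin \o f).
  by apply: (@bounded_integrable _ _ _ C) => //; exact: lebesgue_itv_lty.
rewrite (le_trans (le_normr_Rintegral _ if_))//.
apply: (@le_trans _ _ (\int[mu]_(x in `[a, b]) C)).
  apply: le_Rintegral => //.
  - have := integrable_norm if_; exact.
  - apply: (@bounded_integrable _ _ _ `|C|) => //; exact: lebesgue_itv_lty.
rewrite Rintegral_cst//= lebesgue_measure_itv/= lte_fin.
by move: ab; rewrite le_eqVlt => /predU1P[->|->]/=; rewrite ?ltxx ?subrr.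
Qed.

(** Differentiation under the integral, dominated by the constant [B C] on a bounded interval. The
    parameter is confined to []u, v[] because, as functions of the height, the kernels are bounded
    only away from 0. *)
Lemma derive_param_integral (s : R -> R) (k k' : R -> R -> R) (N B C u v a : R) :
  measurable_fun setT s -> (forall w, `|s w| <= B) ->
  (forall t, u < t < v -> measurable_fun setT (k t)) ->
  (forall t w : R, u < t < v -> is_derive t 1 (k ^~ w) (k' t w)) ->
  (forall t w, u < t < v -> `|k t w| <= C) ->
  (forall t w, u < t < v -> `|k' t w| <= C) ->
  u < a < v ->
  is_derive a 1 (fun t => \int[mu]_(w in `[- N, N]) (s w * k t w))
    (\int[mu]_(w in `[- N, N]) (s w * k' a w)).
Proof.
move=> ms sB mk dk kC k'C uav.
pose f t w := s w * k t w.
have df t w : u < t < v -> is_derive t 1 (f ^~ w) (s w * k' t w).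
  move=> utv; have H := dk t w utv; rewrite /f; eapply is_derive_eq; first by der.
  by rewrite mulr0 addr0.
have B0 : 0 <= B by exact: le_trans (normr_ge0 _) (sB 0).
have C0 : 0 <= C by exact: le_trans (normr_ge0 _) (kC _ 0 uav).
have Ia : `]u, v[%classic a by rewrite /= in_itv.
have intf x : `]u, v[%classic x -> mu.-integrable `[- N, N] (EFin \o f x).
  rewrite /= in_itv/= => xuv; apply: (@bounded_integrable _ _ _ (B * C)) => //.
  - exact: lebesgue_itv_lty.
  - by apply: measurable_funS (measurable_funM ms (mk x xuv)).
  - by move=> w _; rewrite normrM ler_pM// kC.
have derf x y : `]u, v[%classic x -> `[- N, N]%classic y -> derivable (f ^~ y) x 1.
  by rewrite /= in_itv/= => xuv _; case: (df x y xuv).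
have intG : mu.-integrable `[- N, N] (EFin \o cst (B * C)).
  by apply: (@bounded_integrable _ _ _ `|B * C|) => //; exact: lebesgue_itv_lty.
have d1f x y : u < x < v -> partial1of2 f x y = s y * k' x y.
  by move=> xuv; rewrite partial1of2E (@derive_val _ _ _ _ _ _ _ (df x y xuv)).
have Gub x y : `]u, v[%classic x -> `[- N, N]%classic y -> `|partial1of2 f x y| <= cst (B * C) y.
  by rewrite /= in_itv/= => xuv _; rewrite d1f// normrM ler_pM// k'C.
have mN : measurable (`[- N, N]%classic : set R) by exact: measurable_itv.
have H1 := @derivable_under_integral R _ _ mu f _ mN a u v Ia intf derf (cst (B * C)) (fun _ => mulr_ge0 B0 C0) intG Gub.
have H2 := @differentiation_under_integral R _ _ mu f _ mN a u v Ia intf derf (cst (B * C)) (fun _ => mulr_ge0 B0 C0) intG Gub.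
apply: DeriveDef; first exact: H1.
by rewrite -derive1E H2; apply: eq_Rintegral => w _; rewrite d1f.
Qed.

(** [f'] agrees almost everywhere with the density from [lipschitz_FTC], so a bound on [f'] takes
    the place of its continuity. Meant for [expW], which is known only as a bounded derivative. *)
Lemma bounded_derive_FTC (f f' : R -> R) (C a b : R) : a <= b ->
  (forall x : R, is_derive x 1 f (f' x)) -> (forall x, `|f' x| <= C) ->
  \int[mu]_(x in `[a, b]) f' x = f b - f a.
Proof.
move=> ab df fC.
have fL x y : `|f x - f y| <= (C + 1) * `|x - y|.
  by rewrite (le_trans (bounded_derive_lipschitz df fC x y))// ler_wpM2r// lerDl.
have C0 : 0 < C + 1 by have := le_trans (normr_ge0 _) (fC 0); lra.
pose N := Num.max `|a| `|b| + 1.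
have aN : `|a| < N by rewrite ltr_pwDr// le_max lexx.
have bN : `|b| < N by rewrite ltr_pwDr// le_max lexx orbT.
have N0 : 0 < N by rewrite (le_lt_trans _ aN).
have [g [mg gC dg gE]] := lipschitz_FTC C0 N0 fL.
move: aN bN; rewrite !ltr_norml => /andP[Na aN] /andP[Nb bN].
transitivity (\int[mu]_(x in `[a, b]) g x); last by rewrite gE// ltW.
rewrite /Rintegral integral_mkcond [in RHS]integral_mkcond.
congr fine; apply: ae_integral_eq; apply: (aeS dg) => x dgx.
rewrite !patchE; case: ifPn => //; rewrite inE/= in_itv/= => /andP[ax xb].
have H : is_derive x 1 f (g x) by apply: dgx; apply/andP; split; lra.
by rewrite -(@derive_val _ _ _ _ _ _ _ H) (@derive_val _ _ _ _ _ _ _ (df x)).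
Qed.

Lemma Rintegral_support (f : R -> R) (M a b : R) : a <= - M -> M <= b ->
  (forall w, M <= `|w| -> f w = 0) ->
  \int[mu]_(w in `[a, b]) f w = \int[mu]_(w in `[- M, M]) f w.
Proof.
move=> aM Mb f0; rewrite Rintegral_mkcond [in RHS]Rintegral_mkcond.
apply: eq_Rintegral => w _; rewrite !patchE.
have [wM|Mw] := ltP `|w| M; last by rewrite f0//; case: ifP; case: ifP.
move: wM; rewrite ltr_norml => /andP[? ?].
by rewrite !mem_set//= in_itv/=; apply/andP; split; lra.
Qed.

Lemma Rintegral_shift (f : R -> R) (a b e : R) : a <= b -> continuous f ->
  \int[mu]_(w in `[a - e, b - e]) f w = \int[mu]_(w in `[a, b]) f (w - e).
Proof.
move=> ab cf; rewrite /Rintegral; congr fine.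
have dF (w : R) : is_derive w 1 (fun t => t - e) 1.
  by eapply is_derive_eq; [der|rewrite oppr0 addr0].
have F1 : derive1 (fun t => t - e) = cst 1.
  by apply/funext => w; rewrite derive1E (@derive_val _ _ _ _ _ _ _ (dF w)).
have cF : continuous (fun t : R => t - e).
  by move=> w; exact: is_derive_continuous (dF w).
rewrite (@integration_by_substitution_increasing _ (fun t => t - e) f a b)//.
- by apply: eq_integral => w _; rewrite F1 /= mulr1.
- by move=> x y _ _ xy; rewrite ltrD2r.
- by rewrite F1 => x _; exact: cvg_cst.
- by rewrite F1; exact: is_cvg_cst.
- by rewrite F1; exact: is_cvg_cst.
- split.
  + by move=> x _; case: (dF x).
  + by apply: cvg_at_right_filter; exact: cF.
  + by apply: cvg_at_left_filter; exact: cF.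
- by apply: continuous_subspaceT.
Qed.
End ParamIntegral.

(** * Potentials and their exponentials *)

Section Potential.
Context {R : realType}.
Notation mu := (@lebesgue_measure R).
Implicit Types (s : R -> R) (k : R -> R -> R) (N B C x y : R).

(** Convolution truncated to [[- N, N]], a window that will contain the supports of all charges, so
    that bounds on charge and kernel suffice for integrability. *)
Definition conv s N k y x := \int[mu]_(w in `[- N, N]) (s w * k y (x - w)).

Lemma measurable_kernel k y x : continuous (k y) ->
  measurable_fun setT (fun w : R => k y (x - w)).
Proof.
move=> ck; apply: measurableT_comp; first exact: continuous_measurable_fun.
exact: measurable_funB.
Qed.

Lemma conv_integrable s N k B C y x : measurable_fun setT s ->
  (forall w, `|s w| <= B) -> continuous (k y) -> (forall u, `|k y u| <= C) ->
  mu.-integrable `[- N, N] (EFin \o (fun w => s w * k y (x - w))).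
Proof.
move=> ms sB ck kC; apply: (@bounded_integrable _ _ _ (B * C)) => //.
- exact: lebesgue_itv_lty.
- by apply: measurable_funS (measurable_funM ms (measurable_kernel x ck)).
- by move=> w _; rewrite normrM ler_pM.
Qed.

Lemma conv_le s N k B C y x : 0 <= N -> measurable_fun setT s ->
  (forall w, `|s w| <= B) -> continuous (k y) ->
  (forall w, - N <= w <= N -> `|k y (x - w)| <= C) ->
  `|conv s N k y x| <= B * C * (2 * N).
Proof.
move=> N0 ms sB ck kC.
have -> : 2 * N = N - - N by ring.
apply: le_Rintegral_itv_cst; first lra.
- by apply: measurable_funS (measurable_funM ms (measurable_kernel x ck)).
- by move=> w /=; rewrite in_itv/= => wN; rewrite normrM ler_pM// kC.
Qed.

Lemma convZ s N k B C c y x : measurable_fun setT s ->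
  (forall w, `|s w| <= B) -> continuous (k y) -> (forall u, `|k y u| <= C) ->
  \int[mu]_(w in `[- N, N]) (s w * (c * k y (x - w))) = c * conv s N k y x.
Proof.
move=> ms sB ck kC; rewrite /conv -RintegralZl//.
  by apply: eq_Rintegral => w _; ring.
exact: (conv_integrable _ _ ms sB ck kC).
Qed.

Section BoundedCharge.
Variables (s : R -> R) (N B : R).
Hypotheses (N0 : 0 < N) (ms : measurable_fun setT s) (sB : forall w, `|s w| <= B).

Let B0 : 0 <= B. Proof. exact: le_trans (normr_ge0 _) (sB 0). Qed.

Lemma derive_x_conv k k' C c y x : continuous (k y) -> continuous (k' y) ->
  (forall u : R, is_derive u 1 (k y) (c * k' y u)) ->
  (forall u, `|k y u| <= C) -> (forall u, `|k' y u| <= C) ->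
  is_derive x 1 (conv s N k y) (c * conv s N k' y x).
Proof.
move=> ck ck' dk kC k'C.
have C0 : 0 <= C by exact: le_trans (normr_ge0 _) (kC 0).
rewrite -(convZ _ _ _ ms sB ck' k'C).
(* A single constant has to dominate both the kernel and [c] times its derivative, hence the sum. *)
apply: (@derive_param_integral R s (fun t w => k y (t - w)) (fun t w => c * k' y (t - w))
  N B (C + `|c| * C) (x - 1) (x + 1) x) => //.
- by move=> t _; exact: measurable_kernel.
- move=> t w _; have H := dk (t - w).
  have H2 : is_derive t 1 (fun v => v - w) 1.
    by eapply is_derive_eq; [der|rewrite oppr0 addr0].
  by have := @derive_comp _ t (fun v => v - w) (k y) _ _ H H2; rewrite mulr1; exact.
- by move=> t w _; rewrite (le_trans (kC _))// lerDl mulr_ge0.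
- by move=> t w _; rewrite normrM ler_wpDl// ler_wpM2l.
- by apply/andP; split; lra.
Qed.

Lemma derive_y_conv k k' C c y x : 0 < y ->
  (forall z, 0 < z -> continuous (k z)) -> (forall z, 0 < z -> continuous (k' z)) ->
  (forall z u : R, 0 < z -> is_derive z 1 (k ^~ u) (c * k' z u)) ->
  (forall z u, y / 2 < z -> `|k z u| <= C) -> (forall z u, y / 2 < z -> `|k' z u| <= C) ->
  is_derive y 1 (fun z => conv s N k z x) (c * conv s N k' y x).
Proof.
move=> y0 ck ck' dk kC k'C.
have C0 : 0 <= C by apply: le_trans (normr_ge0 _) (kC y 0 _); lra.
have k'Cy u : `|k' y u| <= C by apply: k'C; lra.
rewrite -(convZ _ _ _ ms sB (ck' _ y0) k'Cy).
apply: (@derive_param_integral R s (fun t w => k t (x - w)) (fun t w => c * k' t (x - w))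
  N B (C + `|c| * C) (y / 2) (y + 1) y) => //.
- by move=> t /andP[yt _]; apply: measurable_kernel; apply: ck; lra.
- by move=> t w /andP[yt _]; apply: dk; lra.
- by move=> t w /andP[yt _]; rewrite (le_trans (kC _ _ yt))// lerDl mulr_ge0.
- by move=> t w /andP[yt _]; rewrite normrM ler_wpDl// ler_wpM2l// k'C.
- by apply/andP; split; lra.
Qed.

End BoundedCharge.
End Potential.

(** * The exponential of a potential and its mass on horizontal lines *)

Section ExpPotential.
Context {R : realType}.
Notation mu := (@lebesgue_measure R).
Variables (s : R -> R) (N B : R).
Hypotheses (N0 : 0 < N) (ms : measurable_fun setT s) (sB : forall w, `|s w| <= B).
Implicit Types x y : R.

Let B0 : 0 <= B. Proof. exact: le_trans (normr_ge0 _) (sB 0). Qed.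

(* [expR p * (cos q + i sin q)] is the exponential of [int s w / (z - w)^2 dw], [z = x + i y],
   and [expU + i expV] is [i / z] times that exponential. *)
Definition potp y x := conv s N kphi2 y x.
Definition potq y x := - conv s N kpsi2 y x.
Definition expU y x := expR (potp y x) * (kpsi y x * cos (potq y x) - kphi y x * sin (potq y x)).
Definition expV y x := expR (potp y x) * (kpsi y x * sin (potq y x) + kphi y x * cos (potq y x)).
(** Minus the imaginary part of the complex derivative of [expU + i expV]: the quadratic kernels
    come from differentiating [i / z], the cubic ones from differentiating the potential. *)
Definition expW y x := expR (potp y x) * (kphi2 y x * cos (potq y x) + kpsi2 y x * sin (potq y x))
  + 2 * conv s N kphi3 y x * expV y x - 2 * conv s N kpsi3 y x * expU y x.

Let y_le (y z : R) n : 0 < y -> y / 2 < z -> z ^- n <= (y / 2) ^- n.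
Proof.
move=> y0 yz; have z0 : 0 < z by lra.
have y20 : 0 < y / 2 by lra.
rewrite lef_pV2 ?posrE ?exprn_gt0//.
by rewrite lerXn2r ?nnegrE ?ltW.
Qed.

Lemma derive_x_potp y x : 0 < y -> is_derive x 1 (potp y) (- 2 * conv s N kphi3 y x).
Proof.
move=> y0; have y1 : y != 0 by rewrite gt_eqF.
apply: (@derive_x_conv _ s N B ms sB kphi2 kphi3 (y ^- 2 + 2 * y ^- 3)).
- exact: continuous_kphi2.
- exact: continuous_kphi3.
- by move=> u; exact: derive_x_kphi2.
- by move=> u; rewrite (le_trans (kphi2_le u y0))// lerDl mulr_ge0// ltW// invr_gt0 exprn_gt0.
- by move=> u; rewrite (le_trans (kphi3_le u y0))// lerDr ltW// invr_gt0 exprn_gt0.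
Qed.

Lemma derive_x_potq y x : 0 < y -> is_derive x 1 (potq y) (2 * conv s N kpsi3 y x).
Proof.
move=> y0; have y1 : y != 0 by rewrite gt_eqF.
have H : is_derive x 1 (conv s N kpsi2 y) (- 2 * conv s N kpsi3 y x).
  apply: (@derive_x_conv _ s N B ms sB kpsi2 kpsi3 (y ^- 2 + 2 * y ^- 3)).
  - exact: continuous_kpsi2.
  - exact: continuous_kpsi3.
  - by move=> u; exact: derive_x_kpsi2.
  - by move=> u; rewrite (le_trans (kpsi2_le u y0))// lerDl mulr_ge0// ltW// invr_gt0 exprn_gt0.
  - by move=> u; rewrite (le_trans (kpsi3_le u y0))// lerDr ltW// invr_gt0 exprn_gt0.
by rewrite /potq; eapply is_derive_eq; [der|ring].
Qed.

Lemma derive_y_potp y x : 0 < y -> is_derive y 1 (potp ^~ x) (- 2 * conv s N kpsi3 y x).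
Proof.
move=> y0; have y20 : 0 < y / 2 by lra.
apply: (@derive_y_conv _ s N B ms sB kphi2 kpsi3 ((y / 2) ^- 2 + 2 * (y / 2) ^- 3)) => //.
- by move=> z z0; apply: continuous_kphi2; rewrite gt_eqF.
- by move=> z z0; apply: continuous_kpsi3; rewrite gt_eqF.
- by move=> z u z0; apply: derive_y_kphi2; rewrite gt_eqF.
- move=> z u yz; rewrite (le_trans (@kphi2_le _ z u _))//; first lra.
  by rewrite (le_trans (y_le 2 y0 yz))// lerDl mulr_ge0// ltW// invr_gt0 exprn_gt0.
- move=> z u yz; rewrite (le_trans (@kpsi3_le _ z u _))//; first lra.
  by rewrite ler_wpDl ?ler_wpM2l ?(y_le 3 y0 yz)// ltW// invr_gt0 exprn_gt0.
Qed.

Lemma derive_y_potq y x : 0 < y -> is_derive y 1 (potq ^~ x) (- 2 * conv s N kphi3 y x).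
Proof.
move=> y0; have y20 : 0 < y / 2 by lra.
have H : is_derive y 1 (fun z => conv s N kpsi2 z x) (2 * conv s N kphi3 y x).
  apply: (@derive_y_conv _ s N B ms sB kpsi2 kphi3 ((y / 2) ^- 2 + 2 * (y / 2) ^- 3)) => //.
  - by move=> z z0; apply: continuous_kpsi2; rewrite gt_eqF.
  - by move=> z z0; apply: continuous_kphi3; rewrite gt_eqF.
  - by move=> z u z0; apply: derive_y_kpsi2; rewrite gt_eqF.
  - move=> z u yz; rewrite (le_trans (@kpsi2_le _ z u _))//; first lra.
    by rewrite (le_trans (y_le 2 y0 yz))// lerDl mulr_ge0// ltW// invr_gt0 exprn_gt0.
  - move=> z u yz; rewrite (le_trans (@kphi3_le _ z u _))//; first lra.
    by rewrite ler_wpDl ?ler_wpM2l ?(y_le 3 y0 yz)// ltW// invr_gt0 exprn_gt0.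
by rewrite /potq; eapply is_derive_eq; [der|ring].
Qed.

(* Cauchy-Riemann for the holomorphic function [expU + i expV]. *)
Lemma derive_x_expV y x : 0 < y -> is_derive x 1 (expV y) (- expW y x).
Proof.
move=> y0; have y1 : y != 0 by rewrite gt_eqF.
have := derive_x_potp x y0; have := derive_x_potq x y0.
have := derive_x_kphi x y1; have := derive_x_kpsi x y1 => ? ? ? ?.
rewrite /expV; eapply is_derive_eq; first by der.
by rewrite /expW /expU /expV; ring.
Qed.

Lemma derive_y_expU y x : 0 < y -> is_derive y 1 (expU ^~ x) (expW y x).
Proof.
move=> y0; have y1 : y != 0 by rewrite gt_eqF.
have := derive_y_potp x y0; have := derive_y_potq x y0.
have := derive_y_kphi x y1; have := derive_y_kpsi x y1 => ? ? ? ?.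
rewrite /expU; eapply is_derive_eq; first by der.
by rewrite /expW /expU /expV; ring.
Qed.

Lemma continuous_expU y : 0 < y -> continuous (expU y).
Proof.
move=> y0 x; have y1 : y != 0 by rewrite gt_eqF.
have := derive_x_potp x y0; have := derive_x_potq x y0.
have := derive_x_kphi x y1; have := derive_x_kpsi x y1 => ? ? ? ?.
by rewrite /expU; eapply is_derive_continuous; der.
Qed.

Lemma potp_le y x : 0 < y -> `|potp y x| <= B * y ^- 2 * (2 * N).
Proof.
move=> y0; apply: (@conv_le _ s N kphi2 B (y ^- 2)) => //; first exact: ltW.
  by apply: continuous_kphi2; rewrite gt_eqF.
by move=> w _; exact: kphi2_le.
Qed.

Lemma mix_le (a b t : R) : `|a * cos t + b * sin t| <= `|a| + `|b|.
Proof.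
rewrite (le_trans (ler_normD _ _))// lerD// normrM ler_piMr//.
  by rewrite ler_norml cos_geN1 cos_le1.
by rewrite ler_norml sin_geN1 sin_le1.
Qed.

Lemma expV_le y x : `|expV y x| <= expR (potp y x) * (`|kpsi y x| + `|kphi y x|).
Proof.
rewrite /expV normrM ger0_norm ?expR_ge0// ler_wpM2l ?expR_ge0//.
by rewrite addrC [leRHS]addrC mix_le.
Qed.

Lemma expU_le y x : `|expU y x| <= expR (potp y x) * (`|kpsi y x| + `|kphi y x|).
Proof.
rewrite /expU normrM ger0_norm ?expR_ge0// ler_wpM2l ?expR_ge0//.
by have := mix_le (kpsi y x) (- kphi y x) (potq y x); rewrite mulNr normrN.
Qed.

(** Uniformity in [h <= y] provides the domination needed to differentiate in the height. *)
Lemma expUVW_bounded (h : R) : 0 < h -> exists2 C, 0 <= C & forall y x, h <= y ->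
  [/\ `|expU y x| <= C, `|expV y x| <= C & `|expW y x| <= C].
Proof.
move=> h0.
have hinv n y : h <= y -> y ^- n <= h ^- n.
  move=> hy; have y0 : 0 < y by exact: lt_le_trans hy.
  by rewrite lef_pV2 ?posrE ?exprn_gt0// lerXn2r ?nnegrE ?(ltW h0) ?(ltW y0).
pose E := expR (B * h ^- 2 * (2 * N)).
pose A := B * (2 * h ^- 3) * (2 * N).
have E0 : 0 <= E by exact: expR_ge0.
have hi0 n : 0 <= h ^- n by rewrite invr_ge0 exprn_ge0// ltW.
have h10 : 0 <= h^-1 by rewrite invr_ge0 ltW.
have A0 : 0 <= A by rewrite !mulr_ge0// ltW.
have N20 : 0 <= 2 * N by rewrite mulr_ge0// ltW.
pose D := E * (h^-1 + h^-1).
have D0 : 0 <= D by rewrite mulr_ge0// addr_ge0.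
pose F := E * (h ^- 2 + h ^- 2) + 2 * A * D + 2 * A * D.
have F0 : 0 <= E * (h ^- 2 + h ^- 2) by rewrite mulr_ge0 ?addr_ge0.
have AD0 : 0 <= 2 * A * D by rewrite mulr_ge0// mulr_ge0.
have F1 : 0 <= F by rewrite addr_ge0// addr_ge0.
exists (D + F); first by rewrite addr_ge0.
move=> y x hy; have y0 : 0 < y by exact: lt_le_trans hy.
have pE : expR (potp y x) <= E.
  rewrite ler_expR (le_trans (ler_norm _))// (le_trans (potp_le x y0))//.
  by rewrite ler_wpM2r// ler_wpM2l// hinv.
have k1 : `|kpsi y x| + `|kphi y x| <= h^-1 + h^-1.
  have := hinv 1%N y hy; rewrite !expr1 => yh.
  by rewrite lerD// ?(le_trans (kpsi_le x y0))// (le_trans (kphi_le x y0)).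
have UD : `|expU y x| <= D.
  by rewrite (le_trans (expU_le y x))// ler_pM ?expR_ge0// addr_ge0.
have VD : `|expV y x| <= D.
  by rewrite (le_trans (expV_le y x))// ler_pM ?expR_ge0// addr_ge0.
have c3 : `|conv s N kphi3 y x| <= A.
  apply: conv_le => //; first exact: ltW.
    by apply: continuous_kphi3; rewrite gt_eqF.
  by move=> w _; rewrite (le_trans (kphi3_le _ y0))// ler_wpM2l// hinv.
have s3 : `|conv s N kpsi3 y x| <= A.
  apply: conv_le => //; first exact: ltW.
    by apply: continuous_kpsi3; rewrite gt_eqF.
  by move=> w _; rewrite (le_trans (kpsi3_le _ y0))// ler_wpM2l// hinv.
split.
- by rewrite (le_trans UD)// lerDl.
- by rewrite (le_trans VD)// lerDl.
- apply: (@le_trans _ _ F); last by rewrite lerDr.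
  rewrite /expW /F (le_trans (ler_normB _ _))// lerD//.
    rewrite (le_trans (ler_normD _ _))// lerD//.
      rewrite normrM ger0_norm ?expR_ge0// ler_pM ?expR_ge0//.
      rewrite (le_trans (mix_le _ _ _))// lerD//.
        by rewrite (le_trans (kphi2_le x y0))// hinv.
      by rewrite (le_trans (kpsi2_le x y0))// hinv.
    by rewrite (normrM (2 * conv _ _ _ _ _)) (normrM 2) (ger0_norm (ler0n _ 2)) ler_pM ?mulr_ge0// ler_wpM2l.
  by rewrite (normrM (2 * conv _ _ _ _ _)) (normrM 2) (ger0_norm (ler0n _ 2)) ler_pM ?mulr_ge0// ler_wpM2l.
Qed.

(** By Cauchy-Riemann the height derivative of [expU] is the [x]-derivative of [- expV], so only the
    values at the two ends remain. *)
Lemma derive_massU (L y : R) : 0 < L -> 0 < y ->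
  is_derive y 1 (fun z => \int[mu]_(x in `[- L, L]) expU z x)
    (expV y (- L) - expV y L).
Proof.
move=> L0 y0; have y20 : 0 < y / 2 by lra.
have [C C0 CUVW] := expUVW_bounded y20.
have H : is_derive y 1 (fun z => \int[mu]_(x in `[- L, L]) ((fun=> 1) x * expU z x))
    (\int[mu]_(x in `[- L, L]) ((fun=> 1) x * expW y x)).
  apply: (@derive_param_integral R (fun=> 1) expU expW L 1 C (y / 2) (y + 1) y) => //.
  - by move=> _; rewrite normr1.
  - move=> z /andP[yz _]; apply: continuous_measurable_fun; apply: continuous_expU; lra.
  - move=> z x /andP[yz _]; apply: derive_y_expU; lra.
  - by move=> z x /andP[yz _]; case: (CUVW z x (ltW yz)).
  - by move=> z x /andP[yz _]; case: (CUVW z x (ltW yz)).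
  - by apply/andP; split; lra.
have LL : - L <= L by lra.
have dV (x : R) : is_derive x 1 (fun t => - expV y t) (expW y x).
  by have H2 := derive_x_expV x y0; eapply is_derive_eq; [der|rewrite opprK].
have WC x : `|expW y x| <= C by case: (CUVW y x _) => //; lra.
have -> : expV y (- L) - expV y L = \int[mu]_(x in `[- L, L]) ((fun=> 1) x * expW y x).
  have := bounded_derive_FTC LL dV WC; rewrite opprK addrC => <-.
  by apply: eq_Rintegral => x _; rewrite mul1r.
have -> // : (fun z => \int[mu]_(x in `[- L, L]) expU z x) =
    (fun z => \int[mu]_(x in `[- L, L]) ((fun=> 1) x * expU z x)).
by apply/funext => z; apply: eq_Rintegral => x _; rewrite mul1r.
Qed.

Lemma int_kpsi (L y : R) : 0 < L -> 0 < y ->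
  \int[mu]_(x in `[- L, L]) kpsi y x <= pi.
Proof.
move=> L0 y0; have y1 : y != 0 by rewrite gt_eqF.
have H x : is_derive x 1 (fun t => atan (t / y)) (kpsi y x).
  eapply is_derive_eq; first by der.
  have D0 := sqrD_neq0 x y1.
  by rewrite /kpsi; field; rewrite D0 y1.
rewrite (@bounded_derive_FTC _ (fun t => atan (t / y)) (kpsi y) (y^-1)) => //; first last.
- by move=> x; exact: kpsi_le.
- lra.
by have := atan_ltpi2 (L / y); have := atan_gtNpi2 (- L / y); lra.
Qed.

Lemma expU_integrable (a b y : R) : 0 < y -> mu.-integrable `[a, b] (EFin \o expU y).
Proof.
move=> y0; have [C C0 CU] := expUVW_bounded y0.
apply: (@bounded_integrable _ _ _ C) => //; first exact: lebesgue_itv_lty.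
  by apply: measurable_funS (continuous_measurable_fun (continuous_expU y0)).
by move=> x _; case: (CU y x).
Qed.

(** [kpsi y x / y] is [1 / |z|^2]. For a source [w] in [[- N, N]] and [1 <= y], the bound
    [|z|^2 <= (2 + 2 N^2) |z - w|^2] follows from [x^2 <= 2 (x - w)^2 + 2 w^2]. *)
Let sqD_le (w x y : R) : 1 <= y -> - N <= w <= N ->
  ((x - w) ^+ 2 + y ^+ 2)^-1 <= (2 + 2 * N ^+ 2) * (kpsi y x / y).
Proof.
move=> y1 /andP[Nw wN]; have y0 : 0 < y by lra.
have D1 := sqrD_gt0 (x - w) (lt0r_neq0 y0); have D2 := sqrD_gt0 x (lt0r_neq0 y0).
have -> : (2 + 2 * N ^+ 2) * (kpsi y x / y) = (2 + 2 * N ^+ 2) / (x ^+ 2 + y ^+ 2).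
  by rewrite /kpsi; field; rewrite !gt_eqF.
rewrite ler_pdivlMr// mulrC ler_pdivrMr//.
have wN2 : w ^+ 2 <= N ^+ 2 by nra.
have h1 : x ^+ 2 <= 2 * (x - w) ^+ 2 + 2 * N ^+ 2 by have := sqr_ge0 (x - 2 * w); nra.
have h2 : 1 <= y ^+ 2 by nra.
have h3 : 0 <= N ^+ 2 * (x - w) ^+ 2 by rewrite mulr_ge0 ?sqr_ge0.
have h4 : N ^+ 2 <= N ^+ 2 * y ^+ 2 by rewrite ler_peMr// sqr_ge0.
have h5 := sqr_ge0 (x - w); have h6 := sqr_ge0 y.
by rewrite mulrDl; lra.
Qed.

Let far_cst : R := B * (2 + 2 * N ^+ 2) * (2 * N).
Let far_cst_ge0 : 0 <= far_cst.
Proof.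
have h : 0 <= 2 + 2 * N ^+ 2 by rewrite addr_ge0// mulr_ge0// sqr_ge0.
by apply: mulr_ge0; [exact: mulr_ge0|rewrite mulr_ge0// ltW].
Qed.

Let potp_far y x : 1 <= y -> `|potp y x| <= far_cst * (kpsi y x / y).
Proof.
move=> y1; have y0 : 0 < y by lra.
have -> : far_cst * (kpsi y x / y) = B * ((2 + 2 * N ^+ 2) * (kpsi y x / y)) * (2 * N).
  by rewrite /far_cst; ring.
apply: conv_le => //; first exact: ltW.
  by apply: continuous_kphi2; rewrite gt_eqF.
by move=> w wN; rewrite (le_trans (kphi2_leD _ y0))// sqD_le.
Qed.

Let potq_far y x : 1 <= y -> `|potq y x| <= far_cst * (kpsi y x / y).
Proof.
move=> y1; have y0 : 0 < y by lra.
have -> : far_cst * (kpsi y x / y) = B * ((2 + 2 * N ^+ 2) * (kpsi y x / y)) * (2 * N).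
  by rewrite /far_cst; ring.
rewrite /potq normrN; apply: conv_le => //; first exact: ltW.
  by apply: continuous_kpsi2; rewrite gt_eqF.
by move=> w wN; rewrite (le_trans (kpsi2_leD _ y0))// sqD_le.
Qed.

Lemma sin_norm_le (t : R) : `|sin t| <= `|t|.
Proof.
have := @bounded_derive_lipschitz R sin cos 1 (fun t => is_derive_sin t) _ t 0.
rewrite sin0 !subr0 mul1r; apply=> u.
by rewrite ler_norml cos_geN1 cos_le1.
Qed.

(** The logarithm of the modulus and the phase of the exponential are both at most [m], a multiple
    of [1 / |z|^2]. The kernel [kphi] is not integrable in [x], but the sine that multiplies it
    brings the factor [kpsi y x / y], so bounding [kphi] by 1 is harmless. *)
Lemma expU_far y x : 1 <= y ->
  expU y x <= (1 + 2 * far_cst * expR far_cst / y) * kpsi y x.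
Proof.
move=> y1; have y0 : 0 < y by lra.
set m := far_cst * (kpsi y x / y).
have kp0 := kpsi_ge0 x y0.
have yi0 : 0 < y^-1 by rewrite invr_gt0.
have yi1 : y^-1 <= 1 by rewrite invf_le1.
have kp1 : kpsi y x <= 1.
  by rewrite (le_trans _ yi1)// (le_trans (ler_norm _))// kpsi_le.
have kf1 : `|kphi y x| <= 1 by rewrite (le_trans (kphi_le x y0)).
have m0 : 0 <= m by rewrite mulr_ge0// mulr_ge0// ltW.
have mc : m <= far_cst by rewrite ler_piMr// mulr_ile1// ltW.
have pm := potp_far x y1; have qm := potq_far x y1; rewrite -/m in pm qm.
have Em : expR (potp y x) <= expR m by rewrite ler_expR (le_trans (ler_norm _)).
have Emc : expR m <= expR far_cst by rewrite ler_expR.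
have Em1 : expR m - 1 <= m * expR far_cst.
  apply: (@le_trans _ _ (m * expR m)); last by rewrite ler_wpM2l.
  have : (1 - m) * expR m <= 1.
    by rewrite -ler_pdivlMr ?expR_gt0// div1r -expRN expR_ge1Dx.
  by rewrite mulrBl mul1r; lra.
have E0 := expR_ge0 (potp y x); have F0 := expR_ge0 far_cst.
have qs : `|sin (potq y x)| <= m by rewrite (le_trans (sin_norm_le _)).
have h1 : expR (potp y x) * (kpsi y x * cos (potq y x)) <= expR m * kpsi y x.
  apply: (@le_trans _ _ (expR (potp y x) * kpsi y x)).
    by rewrite ler_wpM2l// ler_piMr// cos_le1.
  by rewrite ler_wpM2r.
have h2 : - (expR (potp y x) * (kphi y x * sin (potq y x))) <= expR far_cst * m.
  rewrite (le_trans (ler_norm _))// normrN (normrM (expR _)) (ger0_norm E0).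
  rewrite ler_pM//; first exact: le_trans Em Emc.
  by rewrite normrM -[leRHS]mul1r ler_pM.
have h3 : (expR m - 1) * kpsi y x <= m * expR far_cst.
  apply: (@le_trans _ _ (m * expR far_cst * kpsi y x)); first by rewrite ler_wpM2r.
  by rewrite ler_piMr// mulr_ge0.
have -> : (1 + 2 * far_cst * expR far_cst / y) * kpsi y x =
    kpsi y x + 2 * (m * expR far_cst) by rewrite /m; ring.
rewrite /expU mulrBr; rewrite mulrBl mul1r in h3; rewrite (mulrC (expR far_cst)) in h2.
by lra.
Qed.

Lemma kphi_le_inv (y u : R) : 0 < y -> 0 < u -> `|kphi y u| <= u^-1.
Proof.
move=> y0 u0; have D0 := sqrD_gt0 u (lt0r_neq0 y0).
rewrite /kphi normrM normfV (gtr0_norm D0) (gtr0_norm u0) ler_pdivrMr// mulrC ler_pdivlMr//.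
by have := sqr_ge0 y; nra.
Qed.

Lemma kpsi_le_inv (y u : R) : 0 < y -> 0 < u -> `|kpsi y u| <= u^-1.
Proof.
move=> y0 u0; have D0 := sqrD_gt0 u (lt0r_neq0 y0).
rewrite ger0_norm ?kpsi_ge0// /kpsi ler_pdivrMr// mulrC ler_pdivlMr//.
by have := sqr_ge0 (y - u); nra.
Qed.

(** At [x = L] and [x = - L] both kernels are at most [1 / L], while the exponential stays bounded
    for [h <= y]. The 4 counts two ends and two kernels. *)
Lemma expV_far (h : R) : 0 < h -> exists2 E, 0 < E & forall y L, h <= y -> 0 < L ->
  `|expV y (- L) - expV y L| <= E / L.
Proof.
move=> h0; exists (4 * expR (B * h ^- 2 * (2 * N))); first by rewrite mulr_gt0 ?expR_gt0.
move=> y L hy L0; have y0 : 0 < y by exact: lt_le_trans hy.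
have pE x : expR (potp y x) <= expR (B * h ^- 2 * (2 * N)).
  rewrite ler_expR (le_trans (ler_norm _))// (le_trans (potp_le x y0))//.
  rewrite ler_wpM2r ?ler_wpM2l//; first by rewrite mulr_ge0// ltW.
  by rewrite lef_pV2 ?posrE ?exprn_gt0// lerXn2r ?nnegrE ?(ltW h0) ?(ltW y0).
have kL : `|kpsi y L| + `|kphi y L| <= 2 * L^-1.
  by rewrite mulr_natl mulr2n lerD ?kphi_le_inv ?kpsi_le_inv.
have kNL : `|kpsi y (- L)| + `|kphi y (- L)| <= 2 * L^-1.
  by rewrite /kphi /kpsi sqrrN mulNr normrN.
have VE x : `|kpsi y x| + `|kphi y x| <= 2 * L^-1 ->
    `|expV y x| <= 2 * expR (B * h ^- 2 * (2 * N)) / L.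
  move=> k2; rewrite (le_trans (expV_le y x))// -mulrA mulrCA.
  by rewrite ler_pM ?expR_ge0// addr_ge0.
rewrite (le_trans (ler_normB _ _))//.
by have := VE _ kL; have := VE _ kNL; move: (expR _) => e; lra.
Qed.

(* By the Cauchy-Riemann equations the mass of [expU] on a horizontal segment [[- L, L]] varies with
   the height only by the flux of [expV] through the vertical sides, which is [O(1 / L)]; at a large
   height [Y], [expU] is close to the Poisson kernel, of mass at most [pi]. *)
Lemma int_expU_le (M y : R) : 0 < M -> 0 < y -> (forall x, 0 <= expU y x) ->
  \int[mu]_(x in `[- M, M]) expU y x <= pi.
Proof.
move=> M0 y0 U0; apply/ler_addgt0Pr => g g0.
have [E E0 EV] := expV_far y0.
pose c := 2 * far_cst * expR far_cst.
have c0 : 0 <= c by rewrite mulr_ge0 ?expR_ge0// mulr_ge0.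
have p0 : 0 < pi :> R by exact: pi_gt0.
(* [Y] makes the relative error [c / Y] of the comparison with the Poisson kernel cost at most
   [g / 2]; below, [L] does the same for the lateral flux [E / L] accumulated over the heights from
   [y] to [Y]. *)
pose Y := 1 + y + 2 * c * pi / g.
have cpg0 : 0 <= 2 * c * pi / g by rewrite divr_ge0 ?(ltW g0)// mulr_ge0 ?(ltW p0)// mulr_ge0.
have Y1 : 1 <= Y by rewrite /Y; move: cpg0 y0; move: (2 * c * pi / g) => *; lra.
have yY : y < Y by rewrite /Y; move: cpg0 y0; move: (2 * c * pi / g) => *; lra.
have Y0 : 0 < Y by exact: lt_le_trans Y1.
pose L := M + 2 * E * (Y - y) / g.
have Eg0 : 0 <= 2 * E * (Y - y) / g.
  by rewrite divr_ge0 ?(ltW g0)// mulr_ge0 ?subr_ge0 ?(ltW yY)// mulr_ge0// ltW.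
have ML : M <= L by rewrite lerDl.
have L0 : 0 < L by exact: lt_le_trans ML.
have step1 : \int[mu]_(x in `[- M, M]) expU y x <= \int[mu]_(x in `[- L, L]) expU y x.
  rewrite Rintegral_mkcond [leRHS]Rintegral_mkcond.
  have mI (z : R) : measurable (`[- z, z]%classic : set R) by exact: measurable_itv.
  have iz z : mu.-integrable setT (EFin \o (expU y \_ `[- z, z])).
    rewrite -restrict_EFin; apply/integrable_restrict => //.
    by rewrite setTI; exact: expU_integrable.
  apply: le_Rintegral => // x _; rewrite !patchE; case: ifPn => [|_].
    rewrite inE/= in_itv/= => /andP[? ?]; rewrite mem_set//= in_itv/=.
    by apply/andP; split; lra.
  by case: ifP.
have step2 : `|\int[mu]_(x in `[- L, L]) expU Y x - \int[mu]_(x in `[- L, L]) expU y x|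
    <= E / L * (Y - y).
  have dI (z : R) : z \in `]y, Y[ -> is_derive z 1 (fun z => \int[mu]_(x in `[- L, L]) expU z x)
    (expV z (- L) - expV z L).
    by rewrite in_itv/= => /andP[yz _]; apply: derive_massU => //; lra.
  have [|z zyY ->] := MVT yY dI.
    apply: derivable_within_continuous => z; rewrite in_itv/= => /andP[yz _].
    have z0 : 0 < z by lra.
    by case: (derive_massU L0 z0).
  move: zyY; rewrite in_itv/= => /andP[yz _].
  rewrite normrM (ger0_norm (_ : 0 <= Y - y)) ?subr_ge0 ?(ltW yY)//.
  by rewrite ler_wpM2r ?subr_ge0 ?(ltW yY)// EV// ltW.
have step3 : \int[mu]_(x in `[- L, L]) expU Y x <= (1 + c / Y) * pi.
  have ik : mu.-integrable `[- L, L] (EFin \o kpsi Y).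
    apply: (@bounded_integrable _ _ _ (Y^-1)) => //; first exact: lebesgue_itv_lty.
      apply: measurable_funS (continuous_measurable_fun _) => //.
      by apply: continuous_kpsi; rewrite gt_eqF.
    by move=> x _; exact: kpsi_le.
  have ick : mu.-integrable `[- L, L] (EFin \o (fun x => (1 + c / Y) * kpsi Y x)).
    apply: (@eq_integrable _ _ _ mu _ _ (fun x => (1 + c / Y)%:E * (EFin \o kpsi Y) x)%E) => //.
    exact: integrableZl.
  apply: (@le_trans _ _ (\int[mu]_(x in `[- L, L]) ((1 + c / Y) * kpsi Y x))).
    apply: le_Rintegral => //; first exact: expU_integrable.
    by move=> x _; exact: expU_far.
  rewrite RintegralZl// ler_wpM2l ?int_kpsi//.
  by rewrite addr_ge0// divr_ge0// ltW.
have s2 : E / L * (Y - y) <= g / 2.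
  rewrite mulrAC ler_pdivrMr//.
  apply: (@le_trans _ _ (g / 2 * (2 * E * (Y - y) / g))); last first.
    by rewrite ler_wpM2l ?divr_ge0 ?(ltW g0)// lerDr ltW.
  by rewrite le_eqVlt; apply/orP; left; apply/eqP; field; rewrite gt_eqF.
have s3 : c / Y * pi <= g / 2.
  rewrite mulrAC ler_pdivrMr//.
  apply: (@le_trans _ _ (g / 2 * (2 * c * pi / g))); last first.
    by rewrite ler_wpM2l ?divr_ge0 ?(ltW g0)// lerDr addr_ge0// ltW.
  by rewrite le_eqVlt; apply/orP; left; apply/eqP; field; rewrite gt_eqF.
move: step2; rewrite ler_norml => /andP[+ _].
move: step1 step3 s2 s3; rewrite mulrDl mul1r.
move: (\int[mu]_(x in `[- M, M]) _) (\int[mu]_(x in `[- L, L]) expU Y x)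
  (\int[mu]_(x in `[- L, L]) expU y x) (E / L * _) (c / Y * _).
by move=> i1 i2 i3 i4 i5; lra.
Qed.
End ExpPotential.

(** * Cauchy transforms of diagrams *)

Section Polar.
Context {R : realType}.
Notation mu := (@lebesgue_measure R).
Implicit Types (s : R -> R) (x y N : R).

Lemma expR_half_sqr (t : R) : expR (t / 2) ^+ 2 = expR t.
Proof. by rewrite -expRM_natr divfK. Qed.

Lemma cos_atan_gt0 (t : R) : 0 < cos (atan t).
Proof. by apply: cos_gt0_pihalf; rewrite atan_gtNpi2 atan_ltpi2. Qed.

(** [i / z = (y + i x) / |z|^2] has modulus [1 / |z|] and, as [0 < y], argument [atan (x / y)]. Both
    sides are nonnegative, so it suffices to compare squares. *)
Lemma kpsi_polar y x : 0 < y ->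
  kpsi y x = expR (- ln (x ^+ 2 + y ^+ 2) / 2) * cos (atan (x / y)).
Proof.
move=> y0; have D0 := sqrD_gt0 x (lt0r_neq0 y0).
have c0 := cos_atan_gt0 (x / y).
have H : kpsi y x ^+ 2 = (expR (- ln (x ^+ 2 + y ^+ 2) / 2) * cos (atan (x / y))) ^+ 2.
  rewrite [RHS]exprMn expR_half_sqr expRN lnK ?posrE//.
  rewrite -[cos _ ^+ 2]invrK cos2_tan2 ?gt_eqF// atanK.
  rewrite /kpsi; field; rewrite !gt_eqF//; first by move: D0; rewrite addrC.
have := kpsi_ge0 x y0; have : 0 <= expR (- ln (x ^+ 2 + y ^+ 2) / 2) * cos (atan (x / y)).
  by rewrite mulr_ge0 ?expR_ge0 ?ltW.
by move=> h1 h2; apply/eqP; rewrite -(@eqrXn2 _ 2)// H.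
Qed.

Lemma kphi_polar y x : 0 < y ->
  kphi y x = expR (- ln (x ^+ 2 + y ^+ 2) / 2) * sin (atan (x / y)).
Proof.
move=> y0; have D0 := sqrD_neq0 x (lt0r_neq0 y0).
have -> : kphi y x = kpsi y x * (x / y).
  by rewrite /kphi /kpsi; field; rewrite D0 gt_eqF.
rewrite kpsi_polar// -mulrA; congr (_ * _).
rewrite -[X in _ * X](atanK) /tan mulrC divfK// gt_eqF//; exact: cos_atan_gt0.
Qed.

(* [Gmod + i Garg] is the logarithm of [i] times the Cauchy transform attached to the charge [s]. *)
Definition Gmod s N y x := potp s N y x - ln (x ^+ 2 + y ^+ 2) / 2.
Definition Garg s N y x := potq s N y x + atan (x / y).

Lemma expU_polar s N y x : 0 < y -> expU s N y x = expR (Gmod s N y x) * cos (Garg s N y x).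
Proof.
move=> y0; rewrite /expU kpsi_polar// kphi_polar// /Gmod /Garg expRD cosD !mulNr; ring.
Qed.

Lemma expV_polar s N y x : 0 < y -> expV s N y x = expR (Gmod s N y x) * sin (Garg s N y x).
Proof.
move=> y0; rewrite /expV kpsi_polar// kphi_polar// /Gmod /Garg expRD sinD !mulNr; ring.
Qed.

(** The charge of a diagram is 1-Lipschitz. The constant 2 leaves room for [al], half of a
    combination of four 1-Lipschitz functions. *)
Definition tame s (M : R) := [/\ 0 < M, (forall x y, `|s x - s y| <= 2 * `|x - y|)
  & forall x, M <= `|x| -> s x = 0].

Lemma tame_bound s M : tame s M -> forall w, `|s w| <= 4 * M.
Proof.
move=> [M0 sL s0] w; have [wM|Mw] := ltP `|w| M; last by rewrite s0// normr0 mulr_ge0// ltW.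
have sM : s M = 0 by rewrite s0// ger0_norm// ltW.
rewrite -[s w]subr0 -sM (le_trans (sL _ _))//.
move: wM; rewrite ltr_norml => /andP[h1 h2].
by rewrite ler0_norm; lra.
Qed.

Lemma tame_measurable s M : tame s M -> measurable_fun setT s.
Proof.
by move=> [_ sL _]; apply: continuous_measurable_fun; exact: lipschitz_continuous sL.
Qed.

Lemma tame_continuous s M : tame s M -> continuous s.
Proof. by move=> [_ sL _]; exact: lipschitz_continuous sL. Qed.

Lemma tameW s M M' : tame s M -> M <= M' -> tame s M'.
Proof.
move=> [M0 sL s0] MM'; split => //; first exact: lt_le_trans MM'.
by move=> x Mx; rewrite s0// (le_trans MM').
Qed.

Lemma diagram_tame (w : R -> R) : continual_diagram w -> exists M, tame (diag_sigma w) M.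
Proof.
move=> [w0 [wL [M wM]]]; exists (`|M| + 1); split; first by rewrite ltr_wpDl.
  move=> x y; rewrite /diag_sigma.
  have -> : (w x - `|x|) / 2 - (w y - `|y|) / 2 = ((w x - w y) - (`|x| - `|y|)) / 2 by ring.
  rewrite normrM (ger0_norm (_ : 0 <= 2^-1))// ler_pdivrMr//.
  rewrite (le_trans (ler_normB _ _))//.
  have h1 := wL x y; have h2 := ler_dist_dist x y; have h3 := normr_ge0 (x - y).
  by move: h1 h2 h3; move: `|w x - w y| `| `|x| - `|y| | `|x - y| => a b c; lra.
move=> x Mx; rewrite /diag_sigma wM ?subrr ?mul0r//.
by have := ler_norm M; lra.
Qed.

(** By parts, the exponent in the defining relation becomes the potential [potp + i potq]. Dividing
    [z G] by [z] and multiplying by [i] gives [i G = expU + i expV], whose real and imaginary parts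
    are the integrals of [kpsi] and [kphi]. *)
Lemma transition_polar (w : R -> R) (P : probability R R) (M N : R) :
  is_transition_measure w P -> tame (diag_sigma w) M -> M < N ->
  forall y x, 0 < y ->
    \int[P]_t kpsi y (x - t) = expU (diag_sigma w) N y x /\
    \int[P]_t kphi y (x - t) = expV (diag_sigma w) N y x.
Proof.
move=> tr tm MN y x y0; have y1 : y != 0 by rewrite gt_eqF.
have [M0 sL s0] := tm.
have kb u : `|kphi y u| <= y^-1 + y ^- 2 /\ `|kphi2 y u| <= y^-1 + y ^- 2 /\
    `|kpsi y u| <= y^-1 + y ^- 2 /\ `|kpsi2 y u| <= y^-1 + y ^- 2.
  have h1 : 0 <= y^-1 by rewrite invr_ge0 ltW.
  have h2 : 0 <= y ^- 2 by rewrite invr_ge0 exprn_ge0// ltW.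
  do !split.
  - by rewrite (le_trans (kphi_le u y0))// lerDl.
  - by rewrite (le_trans (kphi2_le u y0))// lerDr.
  - by rewrite (le_trans (kpsi_le u y0))// lerDl.
  - by rewrite (le_trans (kpsi2_le u y0))// lerDr.
have C0 : 0 < y^-1 + y ^- 2 by rewrite addr_gt0 ?invr_gt0 ?exprn_gt0.
have B0 : 0 <= 4 * M by rewrite mulr_ge0// ltW.
have ReA : \int[mu]_t (derive1 (diag_sigma w) t * kphi y (x - t)) = - potp (diag_sigma w) N y x.
  apply: (@derive1_by_parts _ (diag_sigma w) (fun t => kphi y (x - t)) (fun t => kphi2 y (x - t))
    2 (4 * M) (y^-1 + y ^- 2) M N) => //.
  - exact: tame_bound tm.
  - by move=> t; exact: derive_kphi.
  - by move=> t; case: (kb (x - t)).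
  - by move=> t; case: (kb (x - t)) => _ [].
  - by apply: measurable_kernel; exact: continuous_kphi2.
have ImA : \int[mu]_t (derive1 (diag_sigma w) t * kpsi y (x - t)) = potq (diag_sigma w) N y x.
  apply: (@derive1_by_parts _ (diag_sigma w) (fun t => kpsi y (x - t)) (fun t => kpsi2 y (x - t))
    2 (4 * M) (y^-1 + y ^- 2) M N) => //.
  - exact: tame_bound tm.
  - by move=> t; exact: derive_kpsi.
  - by move=> t; case: (kb (x - t)) => _ [_ []].
  - by move=> t; case: (kb (x - t)) => _ [_ []].
  - by apply: measurable_kernel; exact: continuous_kpsi2.
have iP : P.-integrable setT (EFin \o (fun t => kpsi y (x - t))).
  apply: measurable_bounded_integrable => //.
  - by rewrite (le_lt_trans (probability_le1 P measurableT))// ltry.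
  - by apply: measurable_kernel; exact: continuous_kpsi.
  - exists (y^-1); split; first exact: num_real.
    by move=> z yz t _; exact: (le_trans (kpsi_le _ y0) (ltW yz)).
have := tr x y y1; rewrite /=.
have -> : \int[mu]_t (derive1 (diag_sigma w) t * (x - t) / ((x - t) ^+ 2 + y ^+ 2))
    = - potp (diag_sigma w) N y x.
  by rewrite -ReA; apply: eq_Rintegral => t _; rewrite mulrA.
have -> : \int[mu]_t (derive1 (diag_sigma w) t * y / ((x - t) ^+ 2 + y ^+ 2))
    = potq (diag_sigma w) N y x.
  by rewrite -ImA; apply: eq_Rintegral => t _; rewrite mulrA.
have -> : \int[P]_t (- y / ((x - t) ^+ 2 + y ^+ 2)) = - \int[P]_t kpsi y (x - t).
  transitivity (\int[P]_t (-1 * kpsi y (x - t))).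
    by apply: eq_Rintegral => t _; rewrite /kpsi mulN1r mulNr.
  by rewrite RintegralZl// mulN1r.
rewrite !opprK.
have -> : \int[P]_t ((x - t) / ((x - t) ^+ 2 + y ^+ 2)) = \int[P]_t kphi y (x - t) by [].
rewrite /expU /expV.
move: (\int[P]_t kphi y (x - t)) (\int[P]_t kpsi y (x - t)) (expR _) (cos _) (sin _) => f g E c s.
have D0 := sqrD_neq0 x y1.
move=> [h1 h2]; rewrite /kphi /kpsi; split; apply: (mulfI D0).
  transitivity (y * (E * c) - x * (E * s)); last by field.
  by rewrite -h1 -h2; ring.
transitivity (x * (E * c) + y * (E * s)); last by field.
by rewrite -h1 -h2; ring.
Qed.
End Polar.

Lemma integrable_scale d (T : measurableType d) (R : realType)
    (P : {measure set T -> \bar R}) (A : set T) (f : T -> R) (c : R) :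
  measurable A -> P.-integrable A (EFin \o f) ->
  P.-integrable A (EFin \o (fun x => c * f x)).
Proof.
move=> mA fi; apply: (@eq_integrable _ _ _ P _ mA (fun x => c%:E * (EFin \o f) x)%E) => //.
exact: integrableZl.
Qed.

(** * The phase of the transform of a diagram *)

Section SignAndShift.
Context {R : realType}.
Notation mu := (@lebesgue_measure R).
Implicit Types (s f : R -> R) (x y N a b : R).

Lemma continuous_derive_FTC f f' a b : a <= b ->
  (forall x : R, a <= x <= b -> is_derive x 1 f (f' x)) ->
  (forall x, a <= x <= b -> {for x, continuous f'}) ->
  mu.-integrable `[a, b] (EFin \o f') /\ \int[mu]_(x in `[a, b]) f' x = f b - f a.
Proof.
move=> ab df cf'; have cw : {within `[a, b], continuous f'}.
  apply: continuous_in_subspaceT => x; rewrite inE/= in_itv/=; exact: cf'.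
split; first by apply: continuous_compact_integrable => //; exact: segment_compact.
move: ab; rewrite le_eqVlt => /predU1P[eab|ab].
  by rewrite -eab set_itv1 Rintegral_set1 subrr.
rewrite /Rintegral (@continuous_FTC2 _ f' f)//.
- split.
  + move=> x; rewrite in_itv/= => /andP[ax xb]; have [] // := df x.
    by rewrite !ltW.
  + apply: cvg_at_right_filter; apply: is_derive_continuous (df a _).
    by rewrite lexx ltW.
  + apply: cvg_at_left_filter; apply: is_derive_continuous (df b _).
    by rewrite lexx ltW.
- move=> x; rewrite in_itv/= => /andP[ax xb]; rewrite derive1E.
  by have := df x; rewrite !ltW// => /(_ isT) H; rewrite (@derive_val _ _ _ _ _ _ _ H).
Qed.

Lemma derive_atan_shift y x w : 0 < y ->
  is_derive (w : R) 1 (fun t => atan ((x - t) / y)) (- kpsi y (x - w)).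
Proof.
move=> y0; have y1 : y != 0 by rewrite gt_eqF.
have D0 := sqrD_neq0 (x - w) y1.
eapply is_derive_eq; first by der.
by rewrite /kpsi; field; rewrite D0 y1.
Qed.

Lemma int_kpsi_itv y x a b : 0 < y -> a <= b ->
  \int[mu]_(t in `[a, b]) kpsi y (x - t) = atan ((x - a) / y) - atan ((x - b) / y).
Proof.
move=> y0 ab; have y1 : y != 0 by rewrite gt_eqF.
have H (t : R) : is_derive t 1 (fun t => - atan ((x - t) / y)) (kpsi y (x - t)).
  by have := derive_atan_shift x t y0 => ?; eapply is_derive_eq; [der|rewrite opprK].
rewrite (@bounded_derive_FTC _ _ _ (y^-1) _ _ ab H).
  by rewrite opprK addrC.
by move=> t; exact: kpsi_le.
Qed.

Lemma kpsi_shift_integrable y x a b : 0 < y ->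
  mu.-integrable `[a, b] (EFin \o (fun t => kpsi y (x - t))).
Proof.
move=> y0; apply: (@bounded_integrable _ _ _ (y^-1)) => //; first exact: lebesgue_itv_lty.
  apply: measurable_funS (measurable_kernel x _) => //.
  by apply: continuous_kpsi; rewrite gt_eqF.
by move=> t _; exact: kpsi_le.
Qed.

Definition sgn (t : R) : R := if 0 < t then 1 else -1.

Lemma measurable_sgn : measurable_fun setT sgn.
Proof.
apply: measurable_fun_ifT => //; exact: measurable_fun_ltr.
Qed.

Lemma derive_norm (x : R) : x != 0 -> is_derive x 1 (fun t => `|t|) (sgn x).
Proof.
move=> x0; have [xn|xp|xz] := ltgtP x 0; last by rewrite xz eqxx in x0.
  rewrite /sgn ltNge (ltW xn)/=; apply: (@near_eq_is_derive _ _ _ -%R).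
  near=> z; rewrite ltr0_norm//; near: z; exact: lt_nbhsl.
rewrite /sgn xp; apply: (@near_eq_is_derive _ _ _ id).
near=> z; rewrite gtr0_norm//; near: z; exact: lt_nbhsr.
Unshelve. all: by end_near. Qed.

(* [Garg] stays in [[- pi / 2, pi / 2]] for a diagram: integrating by parts, the charge derivative is a
   density with values in [[0, 1]] on the left of [0] and in [[- 1, 0]] on the right. *)
Lemma Garg_bound (f : R -> R) (M : R) N y x : (forall u v, `|f u - f v| <= `|u - v|) ->
  tame (diag_sigma f) M -> M < N -> 0 < y -> `|Garg (diag_sigma f) N y x| <= pi / 2.
Proof.
move=> fL tm MN y0; have [M0 sL s0] := tm.
have N0 : 0 < N by lra.
have y1 : y != 0 by rewrite gt_eqF.
have fL1 u v : `|f u - f v| <= 1 * `|u - v| by rewrite mul1r.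
have [g [mg g1 dg _]] := lipschitz_FTC ltr01 N0 fL1.
pose G t := (g t - sgn t) / 2.
have g11 t : -1 <= g t <= 1 by rewrite -ler_norml.
have mG : measurable_fun setT G.
  by apply: measurable_funM => //; apply: measurable_funB => //; exact: measurable_sgn.
have Gb t : `|G t| <= 2.
  rewrite /G /sgn ler_norml; have /andP[] := g11 t.
  by case: ifP => _ *; apply/andP; split; lra.
have t0 : {ae mu, forall t : R, t != 0}.
  exists [set 0]; split => //; first exact: lebesgue_measure_set1.
  by move=> t /= /negP; rewrite negbK => /eqP.
have dG : {ae mu, forall t : R, - N < t < N -> is_derive t 1 (diag_sigma f) (G t)}.
  have H : {ae mu, forall t : R, (- N < t < N -> is_derive t 1 f (g t)) /\ t != 0}.
    by apply: filterI => //; exact: (ae_filter_ringOfSetsType mu).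
  apply: (aeS H) => t [dft tn0] tN; have {}dft := dft tN.
  have := derive_norm tn0 => ?; rewrite /diag_sigma; eapply is_derive_eq; first by der.
  by rewrite /G oppr0 mul0r mulr0 add0r mulrC.
have kb u : `|kpsi y u| <= y^-1 + y ^- 2 /\ `|kpsi2 y u| <= y^-1 + y ^- 2.
  have h1 : 0 <= y^-1 by rewrite invr_ge0 ltW.
  have h2 : 0 <= y ^- 2 by rewrite invr_ge0 exprn_ge0// ltW.
  split; first by rewrite (le_trans (kpsi_le u y0))// lerDl.
  by rewrite (le_trans (kpsi2_le u y0))// lerDr.
have qE : potq (diag_sigma f) N y x = \int[mu]_(t in `[- N, N]) (G t * kpsi y (x - t)).
  apply/esym; apply: (@lipschitz_by_parts _ (diag_sigma f) G (fun t => kpsi y (x - t))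
    (fun t => kpsi2 y (x - t)) 2 (4 * M) (y^-1 + y ^- 2) N) => //.
  - by rewrite mulr_ge0// ltW.
  - by rewrite addr_gt0 ?invr_gt0 ?exprn_gt0.
  - exact: tame_bound tm.
  - by rewrite s0// ger0_norm; lra.
  - by rewrite s0// normrN ger0_norm; lra.
  - by move=> t; exact: derive_kpsi.
  - by move=> t; case: (kb (x - t)).
  - by move=> t; case: (kb (x - t)).
  - by apply: measurable_kernel; exact: continuous_kpsi2.
have mN : measurable (`[- N, N]%classic : set R) by exact: measurable_itv.
have iG : mu.-integrable `[- N, N] (EFin \o (fun t => G t * kpsi y (x - t))).
  apply: (@bounded_integrable _ _ _ (2 * y^-1)) => //; first exact: lebesgue_itv_lty.
    apply: measurable_funS (measurable_funM mG (measurable_kernel x _)) => //.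
    exact: continuous_kpsi.
  by move=> t _; rewrite normrM ler_pM// kpsi_le.
pose kk (a b : R) : R -> R := (fun t : R => kpsi y (x - t)) \_ `[a, b].
have ik a b : - N <= a -> b <= N ->
    mu.-integrable `[- N, N] (EFin \o kk a b) /\
    \int[mu]_(t in `[- N, N]) kk a b t =
    \int[mu]_(t in `[a, b]) kpsi y (x - t).
  move=> Na bN; have sub : `[- N, N]%classic `&` `[a, b]%classic = `[a, b]%classic :> set R.
    by apply/setIidr => t /=; rewrite !in_itv/= => /andP[? ?]; apply/andP; split; lra.
  split; last by rewrite /kk -Rintegral_mkcondr sub.
  rewrite /kk -restrict_EFin; apply/integrable_restrict => //.
  by rewrite sub; exact: kpsi_shift_integrable.
have NN : - N <= - N by [].
have N0l : - N <= 0 by lra.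
have N0r : 0 <= N by lra.
have [i1 e1] := ik (- N) 0 NN N0r.
have [i2 e2] := ik 0 N N0l (lexx N).
(* [G] is at most 1 up to 0 and at most 0 beyond, which bounds the phase by a Poisson integral over
   the left half alone; [dn] is the mirror image. The term [atan (x / y)] in [Garg] cancels the
   endpoint 0, and the arctangent that remains is within pi / 2. *)
have up : potq (diag_sigma f) N y x <= \int[mu]_(t in `[- N, 0]) kpsi y (x - t).
  rewrite qE -e1; apply: le_Rintegral => // t /=; rewrite in_itv/= => /andP[h1 h2].
  have kp := kpsi_ge0 (x - t) y0; have /andP[g1t g2t] := g11 t.
  rewrite /kk patchE; case: ifPn => [_|].
    rewrite -[leRHS]mul1r ler_wpM2r// /G /sgn; case: ifP => _; lra.
  rewrite notin_setE/= in_itv/= h1/= => /negP; rewrite -ltNge => tp.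
  by rewrite mulr_le0_ge0// /G /sgn tp; lra.
have dn : - (\int[mu]_(t in `[0, N]) kpsi y (x - t)) <= potq (diag_sigma f) N y x.
  have -> : - (\int[mu]_(t in `[0, N]) kpsi y (x - t)) =
      \int[mu]_(t in `[- N, N]) (-1 * kk 0 N t).
    have := @RintegralZl _ _ _ mu _ (kk 0 N) (-1) mN i2.
    by move=> ->; rewrite e2 mulN1r.
  rewrite qE; apply: le_Rintegral => //.
    exact: integrable_scale.
  move=> t /=; rewrite in_itv/= => /andP[h1 h2].
  have kp := kpsi_ge0 (x - t) y0; have /andP[g1t g2t] := g11 t.
  rewrite /kk patchE; case: ifPn => [_|].
    by rewrite ler_wpM2r// /G /sgn; case: ifP => _; lra.
  rewrite notin_setE/= in_itv/= h2/= andbT => /negP; rewrite -ltNge => tn.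
  by rewrite mulr0 mulr_ge0// /G /sgn ltNge (ltW tn)/=; lra.
move: up dn; rewrite !int_kpsi_itv// subr0 /Garg ler_norml.
have := atan_ltpi2 ((x - - N) / y); have := atan_gtNpi2 ((x - N) / y).
move: (potq _ _ _ _) (atan _) (atan _) (atan _) => q a1 a2 a3 h1 h2 h3 h4.
by apply/andP; split; lra.
Qed.
End SignAndShift.

(** * Translating a diagram and adding one minimum and one maximum *)

Section Shift.
Context {R : realType}.
Notation mu := (@lebesgue_measure R).
Implicit Types (s f : R -> R) (x y N a b e : R).

Lemma Rintegral_split f a b c : a <= c -> c <= b ->
  mu.-integrable `[a, b] (EFin \o f) ->
  \int[mu]_(x in `[a, b]) f x =
  \int[mu]_(x in `[a, c]) f x + \int[mu]_(x in `[c, b]) f x.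
Proof.
move=> ac cb fi.
have := @Rintegral_itvB _ f (BLeft a) (BRight b) c fi.
rewrite !bnd_simp => /(_ ac cb) H; rewrite -[LHS](subrK (\int[mu]_(x in `[a, c]) f x)) H.
rewrite addrC; congr (_ + _); rewrite Rintegral_itv_obnd_cbnd//.
by apply: integrableS fi => //; apply: subset_itvr; rewrite bnd_simp.
Qed.

Lemma continuous_integrable f a b : continuous f -> mu.-integrable `[a, b] (EFin \o f).
Proof.
by move=> cf; apply: continuous_compact_integrable; [exact: segment_compact|exact: continuous_subspaceT].
Qed.

Lemma continuous_abs_mul (k' : R -> R) a : continuous k' -> continuous (fun w => `|w - a| * k' w).
Proof.
move=> ck w; apply: cvgM; last exact: ck.
by apply: cvg_norm; apply: cvgB; [exact: cvg_id|exact: cvg_cst].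
Qed.

(** Two integrations by parts: the second derivative of [|w - a|] is twice the Dirac mass at [a],
    which leaves [- 2 K a] beside the boundary terms. *)
Lemma int_abs_kernel (k k' K : R -> R) (N a : R) : - N <= a -> a <= N ->
  (forall w : R, is_derive w 1 k (k' w)) -> (forall w : R, is_derive w 1 K (- k w)) ->
  continuous k' ->
  \int[mu]_(w in `[- N, N]) (`|w - a| * k' w) =
  (N - a) * k N - (N + a) * k (- N) + K N + K (- N) - 2 * K a.
Proof.
move=> Na aN dk dK ck.
rewrite (@Rintegral_split _ _ _ a)//; last first.
  by apply: continuous_integrable; exact: continuous_abs_mul.
have der_ (w : R) : is_derive w 1 (fun t => (t - a) * k t + K t) ((w - a) * k' w).
  have := dk w; have := dK w => ? ?; eapply is_derive_eq; first by der.
  by rewrite oppr0 addr0 mulr1; ring.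
have dern (w : R) : is_derive w 1 (fun t => - ((t - a) * k t + K t)) (- ((w - a) * k' w)).
  by have := der_ w => ?; der.
have ca : continuous (fun w => (w - a) * k' w).
  move=> w; apply: cvgM; last exact: ck.
  by apply: cvgB; [exact: cvg_id|exact: cvg_cst].
have -> : \int[mu]_(w in `[- N, a]) (`|w - a| * k' w) =
    \int[mu]_(w in `[- N, a]) (- ((w - a) * k' w)).
  apply: eq_Rintegral => w; rewrite inE/= in_itv/= => /andP[_ wa].
  by rewrite ler0_norm ?subr_le0// mulNr.
have -> : \int[mu]_(w in `[a, N]) (`|w - a| * k' w) =
    \int[mu]_(w in `[a, N]) ((w - a) * k' w).
  apply: eq_Rintegral => w; rewrite inE/= in_itv/= => /andP[aw _].
  by rewrite ger0_norm ?subr_ge0.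
have [_ ->] := @continuous_derive_FTC _ _ _ _ _ Na (fun w _ => dern w)
  (fun w _ => @cvgN _ _ _ _ _ _ _ (ca w)).
have [_ ->] := @continuous_derive_FTC _ _ _ _ _ aN (fun w _ => der_ w) (fun w _ => ca w).
by ring.
Qed.

(* Adding [tent e b] to the charge of a diagram translated by [e] multiplies its Cauchy transform by
   [(z - b) / (z - b + e)]: the terms at [0] and [e] only account for the translation of [`|w|]. *)
Definition tent e b (w : R) := (`|w - e| - `|w - 0| + `|w - (b - e)| - `|w - b|) / 2.

(** The boundary terms of the four integrals cancel, since the signs at [e], [0], [b - e], [b] sum
    to 0 and so do the signed positions: [e - 0 + (b - e) - b = 0]. *)
Lemma int_tent (k k' K : R -> R) (N e b : R) : - N <= 0 -> 0 <= N ->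
  - N <= e -> e <= N -> - N <= b - e -> b - e <= N -> - N <= b -> b <= N ->
  (forall w : R, is_derive w 1 k (k' w)) -> (forall w : R, is_derive w 1 K (- k w)) ->
  continuous k' ->
  \int[mu]_(w in `[- N, N]) (tent e b w * k' w) = K 0 - K e + K b - K (b - e).
Proof.
move=> N0 N0' Ne eN Nbe beN Nb bN dk dK ck.
have I a : mu.-integrable `[- N, N] (EFin \o (fun w => `|w - a| * k' w)).
  by apply: continuous_integrable; exact: continuous_abs_mul.
have mN : measurable (`[- N, N]%classic : set R) by exact: measurable_itv.
have I1 : mu.-integrable `[- N, N] (EFin \o (fun w => `|w - e| * k' w - `|w - 0| * k' w)).
  apply: continuous_integrable => w; apply: cvgB; exact: continuous_abs_mul.
have I2 : mu.-integrable `[- N, N] (EFin \o (fun w => `|w - (b - e)| * k' w - `|w - b| * k' w)).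
  apply: continuous_integrable => w; apply: cvgB; exact: continuous_abs_mul.
have I3 : mu.-integrable `[- N, N] (EFin \o (fun w => `|w - e| * k' w - `|w - 0| * k' w +
    (`|w - (b - e)| * k' w - `|w - b| * k' w))).
  apply: continuous_integrable => w; apply: cvgD; apply: cvgB; exact: continuous_abs_mul.
transitivity (\int[mu]_(w in `[- N, N]) (2^-1 * (`|w - e| * k' w - `|w - 0| * k' w +
    (`|w - (b - e)| * k' w - `|w - b| * k' w)))).
  by apply: eq_Rintegral => w _; rewrite /tent; ring.
rewrite RintegralZl// RintegralD// RintegralB//; [|exact: I..].
rewrite RintegralB//; [|exact: I..].
rewrite (int_abs_kernel _ _ dk dK ck)// (int_abs_kernel _ _ dk dK ck)//.
rewrite (int_abs_kernel _ _ dk dK ck)// (int_abs_kernel _ _ dk dK ck)//.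
by field.
Qed.

Lemma derive_half_ln y x (w : R) : 0 < y ->
  is_derive w 1 (fun t => ln ((x - t) ^+ 2 + y ^+ 2) / 2) (- kphi y (x - w)).
Proof.
move=> y0; have D0 := sqrD_gt0 (x - w) (lt0r_neq0 y0).
eapply is_derive_eq; first by der.
by rewrite /kphi /=; field; rewrite gt_eqF.
Qed.

Lemma conv_shift s M N k y x e : tame s M -> 0 <= e -> M + e <= N -> continuous (k y) ->
  conv s N k y (x - e) = \int[mu]_(w in `[- N, N]) (s (w - e) * k y (x - w)).
Proof.
move=> tm e0 MN ck; have [M0 sL s0] := tm; have cs := tame_continuous tm.
pose f w := s w * k y (x - e - w).
have f0 w : M <= `|w| -> f w = 0 by move=> Mw; rewrite /f s0// mul0r.
have cf : continuous f.
  move=> w; apply: cvgM; first exact: cs.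
  apply: continuous_comp; last exact: ck.
  by apply: cvgB; [exact: cvg_cst|exact: cvg_id].
transitivity (\int[mu]_(w in `[- N - e, N - e]) f w).
  transitivity (\int[mu]_(w in `[- M, M]) f w); last by rewrite (@Rintegral_support _ f M)//; lra.
  by rewrite -(@Rintegral_support _ f M (- N) N)//; lra.
rewrite Rintegral_shift//; last lra.
by apply: eq_Rintegral => w _; rewrite /f; congr (_ * k y _); ring.
Qed.

(** The kernel is abstract because there are two instances: [kphi2], whose double primitive is half
    a logarithm, for the modulus, and [kpsi2] with the arctangent for the phase. *)
Lemma potential_shift s1 s0 al M N k k' K y x e b :
  tame s1 M -> tame s0 M -> tame al M -> 0 <= e -> - N <= b - e -> M + e <= N -> b <= N ->
  (forall w, s1 w - s0 (w - e) = al w + tent e b w) ->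
  continuous (k' y) -> (forall w : R, is_derive w 1 (fun t => k y (x - t)) (k' y (x - w))) ->
  (forall w : R, is_derive w 1 K (- k y (x - w))) ->
  conv s1 N k' y x = conv s0 N k' y (x - e) + conv al N k' y x + (K 0 - K e + K b - K (b - e)).
Proof.
move=> t1 t0 ta e0 eb MN bN H ck' dk dK.
have [M0 _ _] := t1.
rewrite (conv_shift _ t0 e0 MN ck').
have ckx : continuous (fun w => k' y (x - w)).
  move=> w; apply: continuous_comp; last exact: ck'.
  by apply: cvgB; [exact: cvg_cst|exact: cvg_id].
have c1 : continuous (fun w => s1 w * k' y (x - w)).
  by move=> w; apply: cvgM; [exact: tame_continuous t1 _|exact: ckx].
have ca : continuous (fun w => al w * k' y (x - w)).
  by move=> w; apply: cvgM; [exact: tame_continuous ta _|exact: ckx].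
have c0 : continuous (fun w => s0 (w - e) * k' y (x - w)).
  move=> w; apply: cvgM; last exact: ckx.
  apply: continuous_comp; last exact: tame_continuous t0 _.
  by apply: cvgB; [exact: cvg_id|exact: cvg_cst].
have mN : measurable (`[- N, N]%classic : set R) by exact: measurable_itv.
rewrite -(int_tent (k := fun t => k y (x - t)) (k' := fun w => k' y (x - w)) (N := N))//; try lra.
rewrite /conv -RintegralD//; [|exact: continuous_integrable..].
have ct : continuous (fun w => tent e b w * k' y (x - w)).
  have -> : (fun w => tent e b w * k' y (x - w)) =
      (fun w => s1 w * k' y (x - w) - s0 (w - e) * k' y (x - w) - al w * k' y (x - w)).
    by apply/funext => w; have := H w => Hw; rewrite -!mulrBl Hw; congr (_ * _); ring.
  by move=> w; apply: cvgB; [apply: cvgB; [exact: c1|exact: c0]|exact: ca].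
rewrite -RintegralD//; last 2 first.
- by apply: continuous_integrable => w; apply: cvgD; [exact: c0|exact: ca].
- exact: continuous_integrable.
apply: eq_Rintegral => w _; rewrite -!mulrDl; congr (_ * _).
by have := H w; lra.
Qed.

(** The part [K 0 - K e] turns the logarithm of [z] in [Gmod] and [Garg] into that of [z - e], as
    the translate requires; the part [K b - K (b - e)] is the logarithm of the factor
    [(z - b) / (z - b + e)]. *)
Lemma G_shift s1 s0 al M N y x e b : 0 < y ->
  tame s1 M -> tame s0 M -> tame al M -> 0 <= e -> - N <= b - e -> M + e <= N -> b <= N ->
  (forall w, s1 w - s0 (w - e) = al w + tent e b w) ->
  Gmod s1 N y x = Gmod s0 N y (x - e) + (potp al N y x +
    (ln ((x - b) ^+ 2 + y ^+ 2) - ln ((x - b + e) ^+ 2 + y ^+ 2)) / 2) /\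
  Garg s1 N y x = Garg s0 N y (x - e) + (potq al N y x +
    (atan ((x - b + e) / y) - atan ((x - b) / y))).
Proof.
move=> y0 t1 t0 ta e0 eb MN bN H; have y1 : y != 0 by rewrite gt_eqF.
have xbe : x - (b - e) = x - b + e by ring.
rewrite /Gmod /Garg /potp /potq; split.
  have -> := @potential_shift s1 s0 al M N kphi kphi2 (fun t => ln ((x - t) ^+ 2 + y ^+ 2) / 2)
    y x e b t1 t0 ta e0 eb MN bN H (continuous_kphi2 y1)
    (fun w => derive_kphi w x y1) (fun w => derive_half_ln x w y0).
  by rewrite subr0 xbe; ring.
have -> := @potential_shift s1 s0 al M N kpsi kpsi2 (fun t => atan ((x - t) / y)) y x e b
  t1 t0 ta e0 eb MN bN H (continuous_kpsi2 y1) (fun w => derive_kpsi w x y1) (fun w => derive_atan_shift x w y0).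
by rewrite subr0 xbe; ring.
Qed.
End Shift.

(** * Stieltjes inversion as a lower bound *)

Section MassLowerBound.
Context {R : realType}.
Notation mu := (@lebesgue_measure R).
Variables (P : probability R R) (e0 : R).
Implicit Types (x y t l r d : R).

(** Poisson integral of [P] translated by [e0], followed by the conjugate one. The translation will
    be 0 for [om] and [e] for [Om]. *)
Let G y x := \int[P]_t kpsi y (x - e0 - t).
Let H y x := \int[P]_t kphi y (x - e0 - t).

Lemma probability_bounded_integrable (f : R -> R) (C : R) : measurable_fun setT f ->
  (forall t, `|f t| <= C) -> P.-integrable setT (EFin \o f).
Proof.
move=> mf fC; apply: measurable_bounded_integrable => //.
  by rewrite (le_lt_trans (probability_le1 P measurableT))// ltry.
by exists C; split; [exact: num_real|move=> z Cz t _; exact: (le_trans (fC t) (ltW Cz))].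
Qed.

Lemma kpsi_P_integrable y x : 0 < y -> P.-integrable setT (EFin \o (fun t => kpsi y (x - t))).
Proof.
move=> y0; apply: (@probability_bounded_integrable _ (y^-1)).
  by apply: measurable_kernel; apply: continuous_kpsi; rewrite gt_eqF.
by move=> t; exact: kpsi_le.
Qed.

Lemma kphi_P_integrable y x : 0 < y -> P.-integrable setT (EFin \o (fun t => kphi y (x - t))).
Proof.
move=> y0; apply: (@probability_bounded_integrable _ (y^-1)).
  by apply: measurable_kernel; apply: continuous_kphi; rewrite gt_eqF.
by move=> t; exact: kphi_le.
Qed.

Lemma Rintegral_prob_cst (c : R) : \int[P]_t c = c.
Proof. by rewrite Rintegral_cst//= probability_setT mulr1. Qed.

Lemma G_ge0 y x : 0 < y -> 0 <= G y x.
Proof. by move=> y0; apply: Rintegral_ge0 => t _; exact: kpsi_ge0. Qed.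

(** A weighted arithmetic-geometric inequality. The conjugate kernel is not dominated by the Poisson
    kernel, but after multiplication by [y] the excess is a constant [k] at one's disposal. *)
Lemma kphi_kpsi (k y u : R) : 0 < k -> 0 < y ->
  y * `|kphi y u| <= k + y / (4 * k) * kpsi y u.
Proof.
move=> k0 y0; have D0 := sqrD_gt0 u (lt0r_neq0 y0).
have u2 : u ^+ 2 = `|u| ^+ 2 by rewrite real_normK ?num_real.
rewrite /kphi /kpsi normrM normfV (gtr0_norm D0) -subr_ge0; rewrite u2 in D0 *.
have -> : k + y / (4 * k) * (y / (`|u| ^+ 2 + y ^+ 2)) - y * (`|u| / (`|u| ^+ 2 + y ^+ 2)) =
    ((2 * k * `|u| - y) ^+ 2 + 4 * (k * y) ^+ 2) / (4 * k * (`|u| ^+ 2 + y ^+ 2)).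
  by field; rewrite !gt_eqF.
by rewrite divr_ge0 ?addr_ge0 ?sqr_ge0// ?mulr_ge0 ?sqr_ge0 ?(ltW D0) ?(ltW k0) ?(ltW y0).
Qed.

Lemma H_le (k y x : R) : 0 < k -> 0 < y -> y * `|H y x| <= k + y / (4 * k) * G y x.
Proof.
move=> k0 y0; have i1 := kphi_P_integrable (x - e0) y0; have i2 := kpsi_P_integrable (x - e0) y0.
have i3 : P.-integrable setT (EFin \o (fun t => `|kphi y (x - e0 - t)|)).
  exact: integrable_norm i1.
have i4 : P.-integrable setT (EFin \o (fun t => y / (4 * k) * kpsi y (x - e0 - t))).
  exact: integrable_scale.
have i5 : P.-integrable setT (EFin \o (fun _ : R => k)).
  by apply: (@probability_bounded_integrable _ `|k|) => //.
apply: (@le_trans _ _ (y * \int[P]_t `|kphi y (x - e0 - t)|)).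
  by rewrite ler_wpM2l ?(ltW y0)// le_normr_Rintegral.
have i6 : P.-integrable setT (EFin \o (fun t => k + y / (4 * k) * kpsi y (x - e0 - t))).
  by have := integrableD measurableT i5 i4; apply: eq_integrable.
have -> : k + y / (4 * k) * G y x = \int[P]_t (k + y / (4 * k) * kpsi y (x - e0 - t)).
  by rewrite RintegralD// RintegralZl// Rintegral_prob_cst.
rewrite -RintegralZl//; apply: le_Rintegral => //; first exact: integrable_scale.
by move=> t _; exact: kphi_kpsi.
Qed.

Variable (m : R -> R).
Hypotheses (mm : measurable_fun setT m) (m01 : forall x, 0 <= m x <= 1)
  (ndm : {homo m : x y / x <= y}).

Let I y l r t := \int[mu]_(x in `[l, r]) (m x * kpsi y (x - e0 - t)).

Lemma mkpsi_integrable y l r t : 0 < y ->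
  mu.-integrable `[l, r] (EFin \o (fun x => m x * kpsi y (x - e0 - t))).
Proof.
move=> y0; apply: (@bounded_integrable _ _ _ (y^-1)) => //; first exact: lebesgue_itv_lty.
  apply: measurable_funS (measurable_funM mm _) => //.
  apply: (measurableT_comp (continuous_measurable_fun (continuous_kpsi _))); first by rewrite gt_eqF.
  by apply: measurable_funB => //; exact: measurable_funB.
move=> x _; have /andP[m0 m1] := m01 x.
by rewrite normrM -[leRHS]mul1r ler_pM// ?kpsi_le// ger0_norm.
Qed.

(** The measurability of [I], needed to integrate a lower bound for it, comes out of the same
    Tonelli argument. *)
Lemma mG_tonelli y l r : 0 < y ->
  (\int[mu]_(x in `[l, r]) (m x * G y x)%:E = \int[P]_t (I y l r t)%:E)%E /\
  measurable_fun setT (I y l r).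
Proof.
move=> y0.
pose f (z : measurableTypeR R * R) : \bar R :=
  (if z.1 \in `[l, r] then m z.1 * kpsi y (z.1 - e0 - z.2) else 0)%:E.
have f0 z : (0 <= f z)%E.
  by rewrite /f; case: ifP => // _; rewrite lee_fin mulr_ge0 ?kpsi_ge0//; case/andP: (m01 z.1).
have mf : measurable_fun setT f.
  apply/measurable_EFinP; apply: measurable_fun_ifT => //.
    under eq_fun do rewrite in_itv/=.
    by apply: measurable_and; apply: measurable_fun_ler.
  apply: measurable_funM.
    apply: measurableT_comp => //.
  apply: (measurableT_comp (continuous_measurable_fun (continuous_kpsi _))); first by rewrite gt_eqF.
  apply: measurable_funB; last exact: measurable_snd.
  by apply: measurable_funB.
have IE t : (I y l r t)%:E = (\int[mu]_x f (x, t))%E.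
  rewrite /I /Rintegral fineK; last by apply: integrable_fin_num => //; exact: mkpsi_integrable.
  rewrite integral_mkcond; apply: eq_integral => x _; rewrite patchE /f/=.
  case: ifPn => [|xN]; first by rewrite inE/= => ->.
  by rewrite ifF//; apply/negbTE; apply: contra xN; rewrite inE.
split; last first.
  apply/measurable_EFinP; have := measurable_fun_fubini_tonelli_G (m1 := mu) f mf f0.
  by apply: eq_measurable_fun => t _; rewrite /= IE.
under [RHS]eq_integral do rewrite IE.
rewrite -(fubini_tonelli (m1 := mu) (m2 := P) f mf f0).
rewrite integral_mkcond; apply: eq_integral => x _.
rewrite patchE /f/=; case: ifPn => [|xN]; last first.
  have -> : (x \in `[l, r]) = false by apply/negbTE; apply: contra xN; rewrite inE.
  by rewrite integral0.
rewrite inE => xlr; have -> : x \in `[l, r] by [].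
rewrite /G -RintegralZl//; last exact: kpsi_P_integrable.
rewrite /Rintegral fineK//; apply: integrable_fin_num => //.
by apply: integrable_scale => //; exact: kpsi_P_integrable.
Qed.

Lemma G_continuous y : 0 < y -> continuous (G y).
Proof.
move=> y0; have y1 : y != 0 by rewrite gt_eqF.
apply: (@lipschitz_continuous _ _ (y ^- 2)) => u v.
have kL : forall a b, `|kpsi y a - kpsi y b| <= y ^- 2 * `|a - b|.
  apply: (@bounded_derive_lipschitz _ (kpsi y) (fun x => - kpsi2 y x)).
    by move=> t; exact: derive_x_kpsi.
  by move=> t; rewrite normrN kpsi2_le.
have iu := kpsi_P_integrable (u - e0) y0; have iv := kpsi_P_integrable (v - e0) y0.
rewrite /G -RintegralB//.
have iuv : P.-integrable setT (EFin \o (fun t => kpsi y (u - e0 - t) - kpsi y (v - e0 - t))).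
  by have := integrableB measurableT iu iv; apply: eq_integrable.
rewrite (le_trans (le_normr_Rintegral _ iuv))// -[leRHS]Rintegral_prob_cst.
apply: le_Rintegral => //.
- exact: integrable_norm iuv.
- by apply: (@probability_bounded_integrable _ `|y ^- 2 * `|u - v| |).
- by move=> t _; rewrite (le_trans (kL _ _))//; have -> : u - e0 - t - (v - e0 - t) = u - v by ring.
Qed.

Lemma G_le y x : 0 < y -> G y x <= y^-1.
Proof.
move=> y0; rewrite -[leRHS]Rintegral_prob_cst; apply: le_Rintegral => //.
- exact: kpsi_P_integrable.
- by apply: (@probability_bounded_integrable _ `|y^-1|).
- by move=> t _; rewrite (le_trans (ler_norm _))// kpsi_le.
Qed.

Lemma mG_integrable y l r : 0 < y -> mu.-integrable `[l, r] (EFin \o (fun x => m x * G y x)).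
Proof.
move=> y0; apply: (@bounded_integrable _ _ _ (y^-1)) => //; first exact: lebesgue_itv_lty.
  by apply: measurable_funS (measurable_funM mm (continuous_measurable_fun (G_continuous y0))).
move=> x _; have /andP[m0 m1] := m01 x.
by rewrite ger0_norm ?mulr_ge0 ?G_ge0// -[leRHS]mul1r ler_pM ?G_ge0 ?G_le.
Qed.

Lemma I_ge0 y l r t : 0 < y -> 0 <= I y l r t.
Proof.
move=> y0; apply: Rintegral_ge0 => x _; rewrite mulr_ge0 ?kpsi_ge0//.
by case/andP: (m01 x).
Qed.

(** On the window of radius [d] about [t + e0] the monotone weight is at least its value at the left
    end, and the Poisson mass of the window is [2 * atan (d / y)]. *)
Lemma I_lower y l r d t : 0 < y -> 0 <= d -> l <= t + e0 - d -> t + e0 + d <= r ->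
  m (t + e0 - d) * (2 * atan (d / y)) <= I y l r t.
Proof.
move=> y0 d0 lt tr; set c := t + e0.
have m00 u : 0 <= m u by case/andP: (m01 u).
have iI a b : mu.-integrable `[a, b] (EFin \o (fun x => m x * kpsi y (x - e0 - t))).
  exact: mkpsi_integrable.
have step : \int[mu]_(x in `[c - d, c + d]) (m x * kpsi y (x - e0 - t)) <= I y l r t.
  rewrite /I Rintegral_mkcond [leRHS]Rintegral_mkcond.
  have J a b : mu.-integrable setT (EFin \o ((fun x => m x * kpsi y (x - e0 - t)) \_ `[a, b])).
    by rewrite -restrict_EFin; apply/integrable_restrict => //; rewrite setTI.
  apply: le_Rintegral => // x _; rewrite !patchE; case: ifPn => [|_].
    rewrite inE/= in_itv/= => /andP[h1 h2]; rewrite mem_set//= in_itv/=.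
    by apply/andP; split; rewrite /c in h1 h2; lra.
  by case: ifP => // _; rewrite mulr_ge0 ?kpsi_ge0.
apply: (le_trans _ step).
have ik : mu.-integrable `[c - d, c + d] (EFin \o (fun x => kpsi y (c - x))).
  exact: kpsi_shift_integrable.
have -> : 2 * atan (d / y) = \int[mu]_(x in `[c - d, c + d]) kpsi y (c - x).
  rewrite int_kpsi_itv//; last lra.
  have -> : c - (c - d) = d by ring.
  have -> : c - (c + d) = - d by ring.
  by rewrite mulNr atanN; ring.
rewrite -RintegralZl//; apply: le_Rintegral => //; first exact: integrable_scale.
move=> x /=; rewrite in_itv/= => /andP[h1 h2].
have -> : kpsi y (x - e0 - t) = kpsi y (c - x).
  by rewrite /kpsi; congr (_ / (_ + _)); rewrite /c; ring.
by rewrite ler_wpM2r ?kpsi_ge0// ndm.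
Qed.

(** The points [t] are those whose window of radius [d] about [t + e0] fits into [[l, r]]. *)
Let S l r d := \int[P]_(t in `[l + d - e0, r - d - e0]) m (t + e0 - d).

Lemma mshift_integrable d (A : set R) : measurable A ->
  P.-integrable A (EFin \o (fun t => m (t + e0 - d))).
Proof.
move=> mA; apply: (integrableS measurableT mA) => //.
apply: (@probability_bounded_integrable _ 1).
  apply: (measurableT_comp mm); apply: measurable_funB => //; exact: measurable_funD.
by move=> t; have /andP[h1 h2] := m01 (t + e0 - d); rewrite ger0_norm.
Qed.

Lemma S_01 l r d : 0 <= S l r d <= 1.
Proof.
have m00 u : 0 <= m u by case/andP: (m01 u).
apply/andP; split; first exact: Rintegral_ge0.
rewrite -[leRHS]Rintegral_prob_cst /S Rintegral_mkcond.
apply: le_Rintegral => //.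
- by rewrite -restrict_EFin; apply/integrable_restrict => //; rewrite setTI; exact: mshift_integrable.
- by apply: (@probability_bounded_integrable _ 1) => // t; rewrite normr1.
- by move=> t _; rewrite patchE; case: ifP => // _; case/andP: (m01 (t + e0 - d)).
Qed.

Lemma int_mG_lower y l r d : 0 < y -> 0 < d ->
  2 * atan (d / y) * S l r d <= \int[mu]_(x in `[l, r]) (m x * G y x).
Proof.
move=> y0 d0; have [E mI] := mG_tonelli l r y0.
have at0 : 0 <= atan (d / y) by rewrite -atan0 le_atan// divr_ge0// ltW.
have m00 u : 0 <= m u by case/andP: (m01 u).
have mms : measurable_fun setT (fun t => m (t + e0 - d)).
  by apply: (measurableT_comp mm); apply: measurable_funB => //; exact: measurable_funD.
have im := mshift_integrable d (measurable_itv `[l + d - e0, r - d - e0]).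
rewrite -lee_fin /S -RintegralZl//.
have -> : (\int[mu]_(x in `[l, r]) (m x * G y x))%:E = (\int[mu]_(x in `[l, r]) (m x * G y x)%:E)%E.
  by rewrite /Rintegral fineK//; apply: integrable_fin_num => //; exact: mG_integrable.
rewrite E.
have -> : (\int[P]_(t in `[(l + d - e0)%R, (r - d - e0)%R]) (2 * atan (d / y) * m (t + e0 - d)))%:E =
    (\int[P]_(t in `[(l + d - e0)%R, (r - d - e0)%R]) (2 * atan (d / y) * m (t + e0 - d))%:E)%E.
  rewrite /Rintegral fineK//; apply: integrable_fin_num => //.
  exact: integrable_scale.
rewrite integral_mkcond; apply: ge0_le_integral => //.
- by move=> t _; rewrite patchE; case: ifP => // _; rewrite lee_fin !mulr_ge0.
- apply/(measurable_restrictT _ _).1 => //; apply/measurable_EFinP.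
  by apply: measurable_funM => //; exact: (measurable_funS measurableT _ mms).
- exact/measurable_EFinP.
- move=> t _; rewrite patchE; case: ifPn => [|_]; last by rewrite lee_fin I_ge0.
  rewrite inE/= in_itv/= => /andP[h1 h2]; rewrite lee_fin mulrC I_lower//; lra.
Qed.

Lemma cos_ge_norm (q : R) : 1 - `|q| <= cos q.
Proof.
have := @bounded_derive_lipschitz R cos (fun q => - sin q) 1 _ _ 0 q.
rewrite cos0 sub0r normrN mul1r => dcos.
suff : 1 - cos q <= `|q| by rewrite lerBlDr lerBlDl addrC.
apply: (le_trans (ler_norm _)); apply: dcos => t.
by rewrite normrN ler_norml sin_geN1 sin_le1.
Qed.

Lemma near_pihalf (d e : R) : 0 < d -> 0 < e ->
  \forall y \near 0^'+, pi / 2 - e <= atan (d / y).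
Proof.
move=> d0 e0'; have /cvgrPdist_le /(_ _ e0') [T [_ HT]] := @cvgy_atan R.
pose T1 := `|T| + 1; have T10 : 0 < T1 by rewrite ltr_wpDl.
have hT : pi / 2 - e <= atan T1.
  have /HT : T < T1 by rewrite (le_lt_trans (ler_norm _))// ltrDl.
  by move=> /(le_trans (ler_norm _)) /=; lra.
near=> y; apply: (le_trans hT); have y0 : 0 < y by near: y; exact: nbhs_right_gt.
rewrite le_atan// ler_pdivlMr// mulrC -ler_pdivlMr//.
by near: y; apply: nbhs_right_le; rewrite divr_gt0.
Unshelve. all: by end_near. Qed.

(* Near the real axis [U] is [m * G] up to a small error: the term [H * sin Q] is absorbed since
   [y * `|H|] is at most [k] plus a small multiple of [G], by [H_le]. *)
Lemma mass_lower (U : R -> R -> R) (l r d m0 K C : R) :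
  l <= r -> 0 < d -> 0 < m0 -> 0 < K -> 0 <= C ->
  (forall x, l <= x <= r -> m0 <= m x) ->
  (\forall y \near 0^'+, mu.-integrable `[l, r] (EFin \o U y) /\
    forall x, l <= x <= r -> exists E Q,
    [/\ U y x = E * (G y x * cos Q - H y x * sin Q), m x <= E, E <= K & `|Q| <= C * y]) ->
  forall eta, 0 < eta ->
  \forall y \near 0^'+, pi * S l r d - eta <= \int[mu]_(x in `[l, r]) U y x.
Proof.
move=> lr d0 m00 K0 C0 mm0 HU eta eta0.
have KC0 : 0 <= K * C by rewrite mulr_ge0 ?(ltW K0).
(* The error [eta] is split in three: [k] controls the constant left over by [H_le], [th2] the
   factor [1 - y * B], and [hat] the deficit of the arctangent. The [+ 1] guards against a vanishing
   denominator. *)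
pose k := eta / (3 * (K * C * (r - l) + 1)).
have D0 : 0 < K * C * (r - l) + 1 by rewrite ltr_wpDl// mulr_ge0// subr_ge0.
have k0 : 0 < k by rewrite divr_gt0// mulr_gt0.
have e1 : K * C * k * (r - l) <= eta / 3.
  rewrite /k; have -> : K * C * (eta / (3 * (K * C * (r - l) + 1))) * (r - l) =
    eta / 3 * (K * C * (r - l) / (K * C * (r - l) + 1)) by field; rewrite gt_eqF.
  rewrite -[leRHS]mulr1 ler_wpM2l ?divr_ge0 ?(ltW eta0)// ler_pdivrMr// mul1r lerDl//.
clearbody k.
(* [C] pays for replacing [cos Q] by 1, the other summand for [H sin Q]; there [m0] converts [G]
   into [m G]. *)
pose B := C + K * C / (4 * k * m0).
have B1 : 0 <= K * C / (4 * k * m0) by rewrite divr_ge0// ltW// !mulr_gt0.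
have B0 : 0 <= B by rewrite addr_ge0.
have pi0 := @pi_gt0 R.
near=> y.
have y0 : 0 < y by near: y; exact: nbhs_right_gt.
have [iU HUy] : mu.-integrable `[l, r] (EFin \o U y) /\
    forall x, l <= x <= r -> exists E Q,
    [/\ U y x = E * (G y x * cos Q - H y x * sin Q), m x <= E, E <= K & `|Q| <= C * y].
  by near: y.
have th1 : y * (B + 1) <= 1.
  rewrite -ler_pdivlMr ?ltr_wpDl//; near: y; apply: nbhs_right_le.
  by rewrite divr_gt0// ltr_wpDl.
have th2 : y * (B + 1) <= eta / (3 * pi).
  rewrite -ler_pdivlMr ?ltr_wpDl//; near: y; apply: nbhs_right_le.
  by rewrite !divr_gt0 ?mulr_gt0// ltr_wpDl.
have hat : pi / 2 - eta / 6 <= atan (d / y).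
  by near: y; apply: near_pihalf => //; rewrite divr_gt0.
have low x : l <= x <= r -> (1 - y * B) * (m x * G y x) - K * C * k <= U y x.
  move=> xlr; have [E [Q [-> mE EK QC]]] := HUy x xlr.
  have G0 := @G_ge0 y x y0; have mx := mm0 x xlr.
  have H1 := @H_le k y x k0 y0.
  have E0 : 0 <= E by rewrite (le_trans _ mE)// (le_trans _ mx)// ltW.
  have GmG : G y x <= m x * G y x / m0.
    by rewrite ler_pdivlMr// mulrC ler_wpM2r.
  have C1 : m x * G y x * (1 - C * y) <= E * (G y x * cos Q).
    have cQ : 1 - C * y <= cos Q by rewrite (le_trans _ (cos_ge_norm Q))// lerB.
    have Cy1 : 0 <= 1 - C * y.
      rewrite subr_ge0 (le_trans _ th1)// mulrC ler_wpM2l ?(ltW y0)//.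
      by rewrite /B -addrA lerDl addr_ge0.
    rewrite mulrA ler_pM//; first by rewrite mulr_ge0// (le_trans _ mx)// ltW.
    by rewrite ler_wpM2r.
  have C2 : E * (H y x * sin Q) <= K * C * k + y * (K * C / (4 * k * m0)) * (m x * G y x).
    have h : H y x * sin Q <= C * (k + y / (4 * k) * G y x).
      apply: (le_trans (ler_norm _)); rewrite normrM.
      apply: (@le_trans _ _ (`|H y x| * (C * y))).
        by rewrite ler_wpM2l// (le_trans (sin_norm_le Q)).
      have -> : `|H y x| * (C * y) = C * (y * `|H y x|) by ring.
      by rewrite ler_wpM2l.
    apply: (@le_trans _ _ (K * (C * (k + y / (4 * k) * G y x)))).
      apply: (le_trans (ler_wpM2l E0 h)); rewrite ler_wpM2r// mulr_ge0//.
      by rewrite addr_ge0 ?(ltW k0)// mulr_ge0// divr_ge0 ?mulr_ge0 ?(ltW k0) ?(ltW y0).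
    have -> : K * (C * (k + y / (4 * k) * G y x)) = K * C * k + K * C * (y / (4 * k)) * G y x by ring.
    rewrite lerD2l; apply: (@le_trans _ _ (K * C * (y / (4 * k)) * (m x * G y x / m0))).
      by rewrite ler_wpM2l// mulr_ge0// divr_ge0 ?mulr_ge0 ?(ltW k0) ?(ltW y0).
    by rewrite le_eqVlt; apply/orP; left; apply/eqP; field; rewrite !gt_eqF.
  have -> : E * (G y x * cos Q - H y x * sin Q) = E * (G y x * cos Q) - E * (H y x * sin Q) by ring.
  apply: le_trans (lerB C1 C2).
  by rewrite le_eqVlt; apply/orP; left; apply/eqP; rewrite /B; ring.
have imG := mG_integrable l r y0.
have step : (1 - y * B) * \int[mu]_(x in `[l, r]) (m x * G y x) - K * C * k * (r - l) <=
    \int[mu]_(x in `[l, r]) U y x.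
  have ic : mu.-integrable `[l, r] (EFin \o (fun _ : R => K * C * k)).
    apply: (@bounded_integrable _ _ _ `|K * C * k|) => //; exact: lebesgue_itv_lty.
  have is1 : mu.-integrable `[l, r] (EFin \o (fun x => (1 - y * B) * (m x * G y x))).
    exact: integrable_scale.
  have <- : \int[mu]_(x in `[l, r]) (K * C * k) = K * C * k * (r - l).
    rewrite Rintegral_cst//= lebesgue_measure_itv/= lte_fin.
    by case: ltgtP lr => // ->; rewrite subrr.
  rewrite -RintegralZl// -RintegralB//; apply: le_Rintegral => //.
  by have := @integrableB _ _ _ mu _ (measurable_itv `[l, r]) _ _ is1 ic; apply: eq_integrable.
apply: (le_trans _ step).
have Bth : 0 <= 1 - y * B.
  rewrite subr_ge0 (le_trans _ th1)// ler_wpM2l ?(ltW y0)// lerDl//.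
have := ler_wpM2l Bth (@int_mG_lower y l r d y0 d0).
have /andP[S0 S1] := S_01 l r d.
have atp := atan_ltpi2 (d / y).
have e2 : pi - eta * 2 / 3 <= (1 - y * B) * (2 * atan (d / y)).
  have t1 : y * B * pi <= eta / 3.
    have : y * B <= eta / (3 * pi).
      by apply: le_trans th2; rewrite ler_wpM2l ?(ltW y0)// lerDl.
    rewrite ler_pdivlMr ?mulr_gt0// ler_pdivlMr// => h; apply: le_trans h.
    by rewrite le_eqVlt; apply/orP; left; apply/eqP; ring.
  have yB : 0 <= y * B by rewrite mulr_ge0// ltW.
  have t2 : y * B * (2 * atan (d / y)) <= y * B * pi.
    by rewrite ler_wpM2l//; lra.
  by rewrite mulrBl mul1r; lra.
have e3 : (pi - eta * 2 / 3) * S l r d <= (1 - y * B) * (2 * atan (d / y)) * S l r d.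
  exact: ler_wpM2r.
have e4 : eta * 2 / 3 * S l r d <= eta * 2 / 3.
  rewrite -[leRHS]mulr1 ler_wpM2l// divr_ge0// mulr_ge0// ltW//.
rewrite mulrBl in e3; rewrite mulrA in e3 *; move: e1 e3 e4.
rewrite [X in _ -> _ -> _ -> X <= _ -> _]mulrA [X in _ -> _ -> _ -> X * _ <= _ -> _]mulrA.
set X1 := K * C * k * (r - l); set X2 := pi * S l r d; set X3 := (1 - y * B) * 2 * _ * _.
set X4 := eta * 2 / 3 * _; set X5 := (1 - y * B) * _.
by move=> *; lra.
Unshelve. all: by end_near. Qed.
End MassLowerBound.

(** * Comparison of diagrams *)

Section FarPotential.
Context {R : realType}.
Notation mu := (@lebesgue_measure R).
Implicit Types (s : R -> R) (M N y x d u : R).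

Lemma kphi2_ge0 y u : y ^+ 2 <= u ^+ 2 -> 0 <= kphi2 y u.
Proof. by move=> yu; rewrite /kphi2 divr_ge0 ?subr_ge0// exprn_ge0// addr_ge0 ?sqr_ge0. Qed.

Lemma sqrD_far y u d : 0 < d -> d <= `|u| -> d ^+ 2 <= u ^+ 2 + y ^+ 2.
Proof.
move=> d0 du; rewrite -[u ^+ 2]real_normK ?num_real// -[leLHS]addr0.
by rewrite lerD ?sqr_ge0// lerXn2r ?nnegrE ?(ltW d0).
Qed.

Lemma kphi2_far y u d : 0 < y -> 0 < d -> d <= `|u| -> `|kphi2 y u| <= d ^- 2.
Proof.
move=> y0 d0 du; rewrite (le_trans (kphi2_leD u y0))//.
rewrite lef_pV2 ?posrE ?exprn_gt0 ?sqrD_gt0 ?gt_eqF//.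
exact: sqrD_far.
Qed.

Lemma kpsi2_far y u d : 0 < y -> 0 < d -> d <= `|u| -> `|kpsi2 y u| <= 2 * d ^- 3 * y.
Proof.
move=> y0 d0 du; have D0 := sqrD_gt0 u (lt0r_neq0 y0).
rewrite /kpsi2 normrM normfV (gtr0_norm (exprn_gt0 2 D0)) ler_pdivrMr ?exprn_gt0//.
rewrite !normrM (gtr0_norm y0) (ger0_norm (ler0n _ 2)).
have D1 : d * `|u| <= u ^+ 2 + y ^+ 2.
  rewrite -[u ^+ 2]real_normK ?num_real// -[leLHS]addr0.
  by rewrite lerD ?sqr_ge0// expr2 ler_wpM2r.
have D2 : d ^+ 2 <= u ^+ 2 + y ^+ 2.
  exact: sqrD_far.
have -> : 2 * `|u| * y = 2 * d ^- 3 * y * (d ^+ 2 * (d * `|u|)) by field; rewrite gt_eqF.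
rewrite ler_wpM2l//; first by rewrite ltW// !mulr_gt0// invr_gt0 exprn_gt0.
by rewrite [leRHS]expr2 ler_pM// ?sqr_ge0// mulr_ge0// ltW.
Qed.

(** For [y <= d <= |x - w|] the real part of [(z - w)^-2] is nonnegative and bounded and its
    imaginary part is [O(y)]. Hence the exponential has modulus at least 1 and almost no phase. *)
Lemma far_potential s M N y x d : tame s M -> 0 <= N -> (forall w, 0 <= s w) -> 0 < y -> y <= d ->
  (forall w, s w = 0 \/ d <= `|x - w|) ->
  [/\ 0 <= potp s N y x, potp s N y x <= 4 * M * d ^- 2 * (2 * N) &
      `|potq s N y x| <= 4 * M * (2 * d ^- 3) * (2 * N) * y].
Proof.
move=> ts N0 s0 y0 yd far; have d0 := lt_le_trans y0 yd; have [M0 _ _] := ts.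
have y1 : y != 0 by rewrite gt_eqF.
have sB := tame_bound ts; have ms := tame_measurable ts.
have mk k : continuous (k y) -> measurable_fun `[- N, N] (fun w => s w * k y (x - w)).
  by move=> ck; apply: measurable_funS (measurable_funM ms (measurable_kernel x ck)).
have NN : - N <= N by rewrite lerNl (le_trans _ N0)// oppr_le0.
have B k C : 0 <= C -> continuous (k y) -> (forall u, d <= `|u| -> `|k y u| <= C) ->
    `|conv s N k y x| <= 4 * M * C * (2 * N).
  move=> C0 ck kC; have -> : 2 * N = N - - N by ring.
  apply: le_Rintegral_itv_cst => //; first exact: mk.
  move=> w _; rewrite normrM.
  have M40 : 0 <= 4 * M by rewrite mulr_ge0// ltW.
  case: (far w) => [->|h]; first by rewrite normr0 mul0r mulr_ge0.
  by rewrite ler_pM ?sB ?kC.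
split.
- apply: Rintegral_ge0 => w _; rewrite /=.
  case: (far w) => [->|h]; first by rewrite mul0r.
  rewrite mulr_ge0// kphi2_ge0// -[leRHS]real_normK ?num_real//.
  by rewrite lerXn2r ?nnegrE ?(ltW y0)// (le_trans yd).
- rewrite (le_trans (ler_norm _))//; apply: B; last by move=> u; exact: kphi2_far.
    by rewrite invr_ge0 exprn_ge0// ltW.
  exact: continuous_kphi2.
- rewrite normrN.
  have -> : 4 * M * (2 * d ^- 3) * (2 * N) * y = 4 * M * (2 * d ^- 3 * y) * (2 * N) by ring.
  apply: B; last by move=> u; exact: kpsi2_far.
    by rewrite ltW// !mulr_gt0// invr_gt0 exprn_gt0.
  exact: continuous_kpsi2.
Qed.

(** The gap is the Poisson integral over [[b - e, b]], at distance at least [d] from [x]. *)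
Lemma atan_gap y x b e d : 0 < y -> 0 < d -> 0 <= e -> b + d <= x ->
  `|atan ((x - b + e) / y) - atan ((x - b) / y)| <= e * d ^- 2 * y.
Proof.
move=> y0 d0 e0 bx; have -> : x - b + e = x - (b - e) by ring.
rewrite -int_kpsi_itv//; last lra.
have -> : e * d ^- 2 * y = d ^- 2 * y * (b - (b - e)) by ring.
apply: le_Rintegral_itv_cst; first lra.
  apply: measurable_funS (measurable_kernel x _) => //.
  by apply: continuous_kpsi; rewrite gt_eqF.
move=> t /=; rewrite in_itv/= => /andP[_ tb].
rewrite ger0_norm ?kpsi_ge0// /kpsi mulrC ler_wpM2r ?(ltW y0)//.
rewrite lef_pV2 ?posrE ?exprn_gt0 ?sqrD_gt0 ?gt_eqF//.
by apply: sqrD_far => //; rewrite ger0_norm; lra.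
Qed.

(** With [a = x - b] the middle term is [|z - b| / |z - b + e|], which increases with the height
    from [a / (a + e)] towards 1. *)
Lemma ratio_bounds y a e : 0 < y -> 0 < a -> 0 <= e ->
  1 - e / (a + e) <= expR ((ln (a ^+ 2 + y ^+ 2) - ln ((a + e) ^+ 2 + y ^+ 2)) / 2) <= 1.
Proof.
move=> y0 a0 e0; have ae0 : 0 < a + e by rewrite ltr_wpDr.
have D1 := sqrD_gt0 a (lt0r_neq0 y0); have D2 := sqrD_gt0 (a + e) (lt0r_neq0 y0).
have D12 : a ^+ 2 + y ^+ 2 <= (a + e) ^+ 2 + y ^+ 2.
  by rewrite lerD2r lerXn2r ?nnegrE ?(ltW a0) ?(ltW ae0)// lerDl.
apply/andP; split; last first.
  rewrite -expR0 ler_expR ler_pdivrMr// mul0r subr_le0 ler_ln ?posrE//.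
have -> : 1 - e / (a + e) = a / (a + e) by field; rewrite gt_eqF.
have q0 : 0 < a / (a + e) by rewrite divr_gt0.
rewrite -[leLHS]lnK ?posrE// ler_expR ler_pdivlMr// mulr_natr -lnXn// -ln_div ?posrE//.
rewrite ler_ln ?posrE ?exprn_gt0 ?divr_gt0//.
rewrite expr_div_n ler_pdivrMr ?exprn_gt0// mulrAC ler_pdivlMr//.
rewrite mulrDr mulrDl lerD2l mulrC ler_wpM2l ?sqr_ge0//.
by rewrite lerXn2r ?nnegrE ?(ltW a0) ?(ltW ae0)// lerDl.
Qed.
End FarPotential.

(** * From the distance of diagrams to pointwise bounds *)

Section DiagramGeometry.
Context {R : realType}.
Implicit Types (w : R -> R) (z e : R).

(** Start at a far point on either side, where the diagram is the absolute value, and come back to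
    [z] with slope at most 1. *)
Lemma diagram_ge_norm w : continual_diagram w -> forall z, `|z| <= w z.
Proof.
move=> [w0 [wL [M wM]]] z.
have [t [tM tz tz' t0]] : exists t, [/\ M <= t, z <= t, - z <= t & 0 <= t].
  exists (`|M| + `|z|); split; last by rewrite addr_ge0.
  - by rewrite (le_trans (ler_norm _))// lerDl.
  - by rewrite (le_trans (ler_norm _))// lerDr.
  - by rewrite (le_trans (ler_norm _))// normrN lerDr.
have wt : w t = t by rewrite wM ger0_norm.
have wt' : w (- t) = t by rewrite wM normrN ger0_norm.
have := wL t z; have := wL z (- t); rewrite wt wt' opprK => h1 h2.
have e1 : `|z + t| = z + t by rewrite ger0_norm//; lra.
have e2 : `|t - z| = t - z by rewrite ger0_norm//; lra.
move: h1 h2; rewrite e1 e2 !ler_norml => /andP[? ?] /andP[? ?].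
by apply/andP; split; lra.
Qed.

(** The infimum need not be attained, hence the strictly larger [e']. *)
Lemma ereal_inf_dist_lt (A : set R) (a e e' : R) :
  (ereal_inf [set (`|a - b|)%:E | b in A] <= e%:E)%E -> e < e' -> exists2 b, A b & `|a - b| < e'.
Proof.
move=> h ee; have : (ereal_inf [set (`|a - b|)%:E | b in A] < e'%:E)%E.
  by rewrite (le_lt_trans h)// lte_fin.
by move=> /ereal_inf_lt[_ [b Ab <-]]; rewrite lte_fin => ?; exists b.
Qed.

Lemma hausdorff_dist_l (A B : set R) (e e' a : R) : (hausdorff_dist A B <= e%:E)%E -> e < e' ->
  A a -> exists2 b, B b & `|a - b| < e'.
Proof.
rewrite /hausdorff_dist ge_max => /andP[h _] ee Aa.
apply: ereal_inf_dist_lt ee; apply: le_trans h.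
by apply: ereal_sup_ubound; exists a.
Qed.

Lemma hausdorff_dist_r (A B : set R) (e e' b : R) : (hausdorff_dist A B <= e%:E)%E -> e < e' ->
  B b -> exists2 a, A a & `|b - a| < e'.
Proof.
rewrite /hausdorff_dist ge_max => /andP[_ h] ee Bb.
have [] := @ereal_inf_dist_lt A b e e' _ ee; last by move=> a ? ?; exists a.
apply: le_trans h; apply: ereal_sup_ubound; exists b => //.
by congr (ereal_inf (image _ _)); apply/funext => a; rewrite distrC.
Qed.

(** In [z], the coordinate [x = (w z + z) / 2] is nondecreasing and [y = (w z - z) / 2]
    nonincreasing. The lower bound moves the point of [w1] over [z - e] vertically to [w2], the
    upper bound moves the point of [w2] over [z] horizontally to [w1]. Either move shifts the
    abscissa by at most [e], up to [g], and monotonicity of the coordinate kept fixed gives the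
    estimate. *)
Lemma diagram_dist_sandwich w1 w2 e z :
  continual_diagram w1 -> continual_diagram w2 -> (diagram_dist w1 w2 <= e%:E)%E ->
  w1 (z - e) - e <= w2 z <= w1 (z - e) + e.
Proof.
move=> d1 d2; rewrite /diagram_dist ge_max => /andP[hX hY].
have n1 := diagram_ge_norm d1; have n2 := diagram_ge_norm d2.
have [_ [L1 _]] := d1; have [_ [L2 _]] := d2.
have up (w : R -> R) : (forall z1 z2, `|w z1 - w z2| <= `|z1 - z2|) ->
    forall u v, u <= v -> w v - w u <= v - u /\ w u - w v <= v - u.
  move=> wL u v uv; have := wL v u; rewrite (ger0_norm (_ : 0 <= v - u)) ?subr_ge0//.
  by rewrite ler_norml => /andP[? ?]; split; lra.
apply/andP; split; apply/ler_addgt0Pr => g g0.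
- pose u := z - e; pose x := (w1 u + u) / 2; pose y := (w1 u - u) / 2.
  have /andP[u1 u2] : - w1 u <= u <= w1 u by rewrite -ler_norml.
  have xy : x - y = u by rewrite /x /y; field.
  have xy2 : x + y = w1 u by rewrite /x /y; field.
  clearbody x y.
  have [] := @hausdorff_dist_l (piY w1 x) (piY w2 x) e (e + g / 2) y.
  + by apply: le_trans hY; apply: ereal_sup_ubound; exists x => //=; lra.
  + lra.
  + by split; [lra|rewrite xy xy2].
  + move=> b [b0 wb]; rewrite ltr_norml => /andP[yb1 yb2].
    have uz : u = z - e by [].
    have [|_ h1] := up w2 L2 (x - b) (u + (e + g / 2)); first lra.
    have [|h2 _] := up w2 L2 z (u + (e + g / 2)); first lra.
    by rewrite -/u; rewrite wb in h1; move: (w1 u) (w2 z) (w2 (u + _)) h1 h2 xy2 => *; lra.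
- pose x := (w2 z + z) / 2; pose y := (w2 z - z) / 2.
  have /andP[u1 u2] : - w2 z <= z <= w2 z by rewrite -ler_norml.
  have xy : x - y = z by rewrite /x /y; field.
  have xy2 : x + y = w2 z by rewrite /x /y; field.
  clearbody x y.
  have [] := @hausdorff_dist_r (piX w1 y) (piX w2 y) e (e + g / 2) x.
  + by apply: le_trans hX; apply: ereal_sup_ubound; exists y => //=; lra.
  + lra.
  + by split; [lra|rewrite xy xy2].
  + move=> a [a0 wa]; rewrite ltr_norml => /andP[xa1 xa2].
    have [|h1 _] := up w1 L1 (z - (e + g / 2)) (a - y); first lra.
    have [|_ h2] := up w1 L1 (z - (e + g / 2)) (z - e); first lra.
    by rewrite wa in h1; move: (w1 _) (w2 z) (w1 (z - e)) h1 h2 xy2 => *; lra.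
Qed.
End DiagramGeometry.

Lemma dist_min_le {R : realDomainType} (p q r s L : R) : `|p - q| <= L -> `|r - s| <= L ->
  `|Num.min p r - Num.min q s| <= L.
Proof.
rewrite !ler_norml => /andP[? ?] /andP[? ?].
by case: (leP p r) => ?; case: (leP q s) => ?; apply/andP; split; lra.
Qed.

(** * The comparison diagram and the signs of its charge differences *)

Section ComparisonDiagram.
Context {R : realType}.
Variables (Om om : R -> R) (e z0 b : R).
Hypotheses (dOm : continual_diagram Om) (dom : continual_diagram om) (e0 : 0 < e)
  (sand : forall z, Om (z - e) - e <= om z <= Om (z - e) + e)
  (hb : Om (b - e) - Om (z0 - e) = b - z0 - 2 * e).
Implicit Types (u v w z : R).

Let LO u v : u <= v -> Om v - Om u <= v - u /\ Om u - Om v <= v - u.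
Proof.
have [_ [OL _]] := dOm; move=> uv; have := OL v u.
rewrite (ger0_norm (_ : 0 <= v - u)) ?subr_ge0//.
by rewrite ler_norml => /andP[? ?]; split; lra.
Qed.

Let Lo u v : u <= v -> om v - om u <= v - u /\ om u - om v <= v - u.
Proof.
have [_ [OL _]] := dom; move=> uv; have := OL v u.
rewrite (ger0_norm (_ : 0 <= v - u)) ?subr_ge0//.
by rewrite ler_norml => /andP[? ?]; split; lra.
Qed.

(* The largest function that agrees with [om] up to [z0], is 1-Lipschitz to the right of [z0] and
   stays below [Om (z - e) + e], the upper bound for diagrams at distance [e] from [Om]. *)
Let eta z := Num.min (Om (z - e) + e) (om (Num.min z z0) + Num.max 0 (z - z0)).

Let eta_cases z : (z <= z0 /\ eta z = om z) \/
  (z0 <= z /\ eta z = Num.min (Om (z - e) + e) (om z0 + (z - z0))).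
Proof.
have /andP[_ s] := sand z; rewrite /eta; case/orP: (le_total z z0) => zz.
  left; split=> //; rewrite (min_idPl zz) (_ : Num.max 0 (z - z0) = 0) ?addr0; first exact/min_idPr.
  by apply/max_idPl; rewrite subr_le0.
right; split=> //; rewrite (min_idPr zz) (_ : Num.max 0 (z - z0) = z - z0)//.
by apply/max_idPr; rewrite subr_ge0.
Qed.

Let eta_left z : z <= z0 -> eta z = om z.
Proof.
have /andP[_ s] := sand z0; move=> zz; case: (eta_cases z) => [[]//|[h ->]].
have -> : z = z0 by apply/eqP; rewrite eq_le zz.
by rewrite subrr addr0 (min_idPr _).
Qed.

Let eta_slope u v : u <= v -> `|eta u - eta v| <= v - u.
Proof.
have mono a c : z0 <= a -> a <= c ->
    `|Num.min (Om (a - e) + e) (om z0 + (a - z0)) - Num.min (Om (c - e) + e) (om z0 + (c - z0))| <= c - a.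
  move=> za ac; have [|h1 h2] := @LO (a - e) (c - e); first lra.
  apply: dist_min_le; rewrite ler_norml; apply/andP; split; lra.
move=> uv; case: (leP v z0) => vz.
  rewrite !eta_left//; last lra.
  by have [h1 h2] := Lo uv; rewrite ler_norml; apply/andP; split; lra.
case: (leP u z0) => uz; last first.
  have := mono u v (ltW uz) uv.
  case: (eta_cases u) => [[h _]|[_ ->]]; first lra.
  by case: (eta_cases v) => [[h _]|[_ ->]]; first lra.
have := mono z0 v (lexx _) (ltW vz).
case: (eta_cases v) => [[h _]|[_ ->]]; first lra.
have /andP[_ s] := sand z0.
rewrite eta_left// subrr addr0 (min_idPr s).
have [h1 h2] := Lo uz.
by rewrite !ler_norml => /andP[? ?]; apply/andP; split; lra.
Qed.

Let eta_lip u v : `|eta u - eta v| <= `|u - v|.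
Proof.
have [uv|/ltW vu] := leP u v.
  by rewrite (le_trans (eta_slope uv))// distrC ler_norm.
by rewrite distrC (le_trans (eta_slope vu))// ler_norm.
Qed.

Let eta_ge z : om z <= eta z.
Proof.
have /andP[_ s] := sand z; case: (eta_cases z) => [[_ ->]//|[h ->]].
by rewrite le_min s/=; have [? ?] := Lo h; lra.
Qed.

(** If [z0 <= b], an increment [b - z0 - 2 * e] is possible with slope at least -1 only if
    [b - z0 >= e]; the opposite order would force [e <= 0]. *)
Lemma contact_point_ge : z0 + e <= b.
Proof.
have hb' := hb; have e0' := e0.
have [h|/ltW h] := leP z0 b.
  by have [|? ?] := @LO (z0 - e) (b - e); lra.
by have [|? ?] := @LO (b - e) (z0 - e); lra.
Qed.

(** The equation for [b] and the lower bound of [sand] at [z0] give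
    [Om (b - e) + e <= om z0 + (b - z0)]: the line of slope 1 has reached the upper barrier by [b],
    and the barrier cannot overtake it afterwards. *)
Let eta_right z : b <= z -> eta z = Om (z - e) + e.
Proof.
have hb' := hb; have e0' := e0.
move=> bz; case: (eta_cases z) => [[h _]|[_ ->]]; first by have := contact_point_ge; lra.
have [|? ?] := @LO (b - e) (z - e); first lra.
by apply: min_idPl; have /andP[? ?] := sand z0; lra.
Qed.

Let eta_far : exists M : R, forall z, M <= `|z| -> eta z = `|z|.
Proof.
have nO := diagram_ge_norm dom; have hz0 := nO z0; have e0' := e0.
have [_ [_ [M1 O1]]] := dOm; have [_ [_ [M2 o2]]] := dom.
exists (`|M1| + `|M2| + `|z0| + e) => z Mz.
have [? ? ?] := And3 (ler_norm M1) (ler_norm M2) (ler_norm z0).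
have [? ? ?] := And3 (normr_ge0 M1) (normr_ge0 M2) (normr_ge0 z0).
have ? : - z0 <= `|z0| by rewrite -normrN ler_norm.
have [zp|zn] := leP 0 z.
  rewrite (ger0_norm zp) in Mz *; case: (eta_cases z) => [[h ->]|[_ ->]].
    by rewrite o2 (ger0_norm zp)//; lra.
  have ze : `|z - e| = z - e by rewrite ger0_norm//; lra.
  by rewrite O1 ze; [rewrite (min_idPl _); lra|lra].
rewrite (ltr0_norm zn) in Mz *.
by rewrite eta_left; [rewrite o2 (ltr0_norm zn)//; lra|lra].
Qed.

Let eta_diagram : continual_diagram eta.
Proof.
split; first by move=> z; rewrite (le_trans _ (eta_ge z))//; case: dom.
by split; [exact: eta_lip|exact: eta_far].
Qed.

(* [eta - 2 * al] is the translate of [Om] by [e] with an extra minimum at [b - e] and an extra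
   maximum at [b]. *)
Let al z := (eta z - Om (z - e) - `|z - (b - e)| + `|z - b|) / 2.
Let be z := (eta z - om z) / 2.

(** Left of [b - e] the two absolute values contribute exactly [e], which compensates the lower
    bound [Om (z - e) - e <= om z <= eta z]. On [[b - e, b]] both [eta] and the translate of [Om]
    are followed back from [b], where they differ by [e], with slopes at most 1 in absolute
    value. *)
Let al_ge0 z : 0 <= al z.
Proof.
have /andP[s1 s2] := sand z; have g := eta_ge z; have e0' := e0.
rewrite /al divr_ge0//; have [bz|/ltW zb] := leP b z.
  rewrite eta_right// !ger0_norm; lra.
rewrite (ler0_norm (_ : z - b <= 0)); last lra.
have [h|h] := leP (b - e) z.
  rewrite ger0_norm; last lra.
  have := eta_slope zb; rewrite (eta_right (lexx b)) ler_norml => /andP[h1 h2].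
  by have [|h3 h4] := @LO (z - e) (b - e); lra.
by rewrite ltr0_norm; lra.
Qed.

Let al_right z : b <= z -> al z = 0.
Proof.
by move=> bz; have e0' := e0; rewrite /al eta_right// !ger0_norm; [field|lra|lra].
Qed.

Let half_lip (f : R -> R) k : (forall u v, `|f u - f v| <= k * `|u - v|) -> k <= 4 ->
  forall u v, `|f u / 2 - f v / 2| <= 2 * `|u - v|.
Proof.
move=> fk k4 u v; rewrite -mulrBl normrM (ger0_norm (_ : 0 <= 2^-1))// ler_pdivrMr//.
apply: (le_trans (fk u v)); rewrite mulrAC ler_wpM2r//; lra.
Qed.

Lemma comparison_diagram : exists (eta al be : R -> R) (M : R),
  [/\ continual_diagram eta, tame al M & tame be M] /\
  (forall w, [/\ 0 <= al w, b <= w -> al w = 0 &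
     diag_sigma eta w - diag_sigma Om (w - e) = al w + tent e b w]) /\
  (forall w, [/\ 0 <= be w, w <= z0 -> be w = 0 &
     diag_sigma eta w - diag_sigma om w = be w]).
Proof.
have [M1 eta1] := eta_far; have [_ [OL [M2 O2]]] := dOm; have [_ [oL [M3 o3]]] := dom.
have [M [MM1 MM2 MM3 Mb [Mb' M0]]] : exists M : R,
    [/\ M1 <= M, M2 <= M, M3 <= M, b <= M & - (b - e) <= M /\ 0 < M].
  exists (`|M1| + `|M2| + `|M3| + `|b| + `|b - e| + 1).
  have [? ? ?] := And3 (ler_norm M1) (ler_norm M2) (ler_norm M3).
  have [? ? ?] := And3 (normr_ge0 M1) (normr_ge0 M2) (normr_ge0 M3).
  have [? ? ? h] := And4 (normr_ge0 b) (ler_norm b) (normr_ge0 (b - e)) (ler_norm (- (b - e))).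
  by rewrite normrN in h; split; [lra|lra|lra|lra|split; lra].
have e0' := e0.
exists eta, al, be, M; split; [split => //|split => w].
- split => //.
    apply: half_lip (_ : 4 <= 4) => // u v.
    have h1 := eta_lip u v; have h2 := OL (u - e) (v - e).
    have h3 := ler_dist_dist (u - (b - e)) (v - (b - e)).
    have h4 := ler_dist_dist (u - b) (v - b).
    have e2 : u - e - (v - e) = u - v by ring.
    have e3 : u - (b - e) - (v - (b - e)) = u - v by ring.
    have e4 : u - b - (v - b) = u - v by ring.
    rewrite e2 in h2; rewrite e3 in h3; rewrite e4 in h4.
    by move: h1 h2 h3 h4; rewrite !ler_norml => /andP[? ?] /andP[? ?] /andP[? ?] /andP[? ?];
      apply/andP; split; lra.
  move=> x Mx; have [bx|xb] := leP b x; first exact: al_right.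
  have xn : x < 0 by have [x0|//] := leP 0 x; rewrite (ger0_norm x0) in Mx; lra.
  rewrite (ltr0_norm xn) in Mx; rewrite /al eta1 (ltr0_norm xn); last lra.
  rewrite O2 (ltr0_norm (_ : x - e < 0)); [|lra|lra|lra].
  by rewrite (ler0_norm (_ : x - (b - e) <= 0)) ?(ltr0_norm (_ : x - b < 0)); [field|lra|lra].
- split => //.
    have k24 : 2 <= 4 :> R by lra.
    apply: (half_lip _ k24) => u v.
    by have := eta_lip u v; have := oL u v; rewrite !ler_norml => /andP[? ?] /andP[? ?];
      apply/andP; split; lra.
  by move=> x Mx; rewrite /be eta1 ?o3 ?subrr ?mul0r//; lra.
- split; [exact: al_ge0|exact: al_right|].
  by rewrite /diag_sigma /al /tent subr0; field.
- split; first by rewrite /be divr_ge0// subr_ge0.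
    by move=> wz; rewrite /be eta_left// subrr mul0r.
  by rewrite /diag_sigma /be; field.
Qed.
End ComparisonDiagram.

(** * The mass inequality *)

Section ShiftedTransform.
Context {R : realType}.
Implicit Types (e b x : R).

(** Real part of a complex product in polar form: [E] and [Q] are the modulus and phase of the
    factor contributed by [al] and [tent]. *)
Lemma expU_shift (s1 s0 al : R -> R) M N y x e b : 0 < y ->
  tame s1 M -> tame s0 M -> tame al M -> 0 <= e -> - N <= b - e -> M + e <= N -> b <= N ->
  (forall w, s1 w - s0 (w - e) = al w + tent e b w) ->
  let E := expR (potp al N y x + (ln ((x - b) ^+ 2 + y ^+ 2) - ln ((x - b + e) ^+ 2 + y ^+ 2)) / 2) in
  let Q := potq al N y x + (atan ((x - b + e) / y) - atan ((x - b) / y)) in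
  expU s1 N y x = E * (expU s0 N y (x - e) * cos Q - expV s0 N y (x - e) * sin Q).
Proof.
move=> y0 t1 t0 ta e0 eb MN bN H E Q; have [g1 g2] := G_shift x y0 t1 t0 ta e0 eb MN bN H.
rewrite !expU_polar// expV_polar// g1 g2 expRD cosD /E /Q; ring.
Qed.

(* The boundary values [(x - b) / (x - b + e)] of the factor [(z - b) / (z - b + e)] for [x >= b],
   extended by [0]. *)
Definition damping e b x := 1 - e / (Num.max (x - b) 0 + e).

Lemma damping01 e b x : 0 < e -> 0 <= damping e b x <= 1.
Proof.
move=> e0; have m0 : 0 <= Num.max (x - b) 0 by rewrite le_max lexx orbT.
have me : 0 < Num.max (x - b) 0 + e by rewrite ltr_wpDl.
rewrite /damping subr_ge0 ler_pdivrMr// mul1r lerDr m0/= gerBl divr_ge0 ?ltW//.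
Qed.

(** Right of [b] the derivative is [e / (x - b + e)^2], between 0 and [1 / e]; left of [b] the
    function is constant. *)
Lemma damping_slope e b x x' : 0 < e -> x <= x' ->
  damping e b x <= damping e b x' <= damping e b x + e^-1 * (x' - x).
Proof.
move=> e0 xx'.
have [p0 q0 pq qp] : [/\ 0 <= Num.max (x - b) 0, 0 <= Num.max (x' - b) 0,
   Num.max (x - b) 0 <= Num.max (x' - b) 0 & Num.max (x' - b) 0 - Num.max (x - b) 0 <= x' - x].
  by case: (leP (x - b) 0) => ?; case: (leP (x' - b) 0) => ?; split; lra.
rewrite /damping; move: (Num.max _ _) (Num.max _ _) p0 q0 pq qp => q p p0 q0 pq qp.
have pe : 0 < p + e by rewrite ltr_wpDl.
have qe : 0 < q + e by rewrite ltr_wpDl.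
have D : 1 - e / (q + e) - (1 - e / (p + e)) = e * (q - p) / ((p + e) * (q + e)).
  by field; rewrite !gt_eqF.
rewrite -subr_ge0 D divr_ge0 ?mulr_ge0 ?subr_ge0 ?(ltW e0) ?(ltW pe) ?(ltW qe)//=.
rewrite -lerBlDl D ler_pdivrMr ?mulr_gt0//.
have -> : e * (q - p) = e^-1 * (q - p) * (e * e) by field; rewrite gt_eqF.
apply: ler_pM; rewrite ?mulr_ge0 ?invr_ge0 ?subr_ge0 ?(ltW e0)//.
  by rewrite ler_wpM2l// invr_ge0 ltW.
by apply: ler_pM; rewrite ?(ltW e0)// lerDr.
Qed.

Lemma damping_continuous e b : 0 < e -> continuous (damping e b).
Proof.
move=> e0; apply: (@lipschitz_continuous _ _ e^-1).
have H u v : u <= v -> `|damping e b v - damping e b u| <= e^-1 * `|v - u|.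
  move=> uv; have /andP[h1 h2] := damping_slope b e0 uv.
  by rewrite !ger0_norm ?subr_ge0// lerBlDl.
move=> s t; have [st|/ltW ts] := leP s t; last exact: H.
by rewrite distrC [leRHS](_ : _ = e^-1 * `|t - s|); [exact: H|rewrite distrC].
Qed.

Lemma damping_right e b x : 0 < e -> b <= x -> damping e b x = 1 - e / (x - b + e).
Proof. by move=> e0 bx; rewrite /damping (max_idPl _)// subr_ge0. Qed.

End ShiftedTransform.

Section MassInequality.
Context {R : realType}.
Notation mu := (@lebesgue_measure R).
Variables (Om om : R -> R) (P0 P1 : probability R R) (e z0 b : R).
Hypotheses (dOm : continual_diagram Om) (dom : continual_diagram om) (e0 : 0 < e)
  (sand : forall z, Om (z - e) - e <= om z <= Om (z - e) + e)
  (hb : Om (b - e) - Om (z0 - e) = b - z0 - 2 * e)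
  (tr0 : is_transition_measure Om P0) (tr1 : is_transition_measure om P1).

(** [[- L, L]] is cut at [z0 - d] and [b + d]. The outer pieces are instances of [mass_lower], on
    the left with weight 1 and no translation, on the right with weight [damping] and translation
    [e]; the middle one contributes its nonnegativity. [d] occurs twice in the inner bounds, as the
    distance from the charges [be] and [al] and as the radius of the Poisson windows. *)
Lemma mass_inequality (L d : R) : 0 < d -> 0 < L -> - L <= z0 - d -> z0 <= b -> b + d <= L ->
  \int[P1]_(t in `[- L + d - 0, z0 - d - d - 0]) 1 +
  \int[P0]_(t in `[b + d + d - e, L - d - e]) damping e b (t + e - d) <= 1.
Proof.
move=> d0 L0 Lz z0b bL.
have [eta [al [be [M [[deta tal tbe] [Hal Hbe]]]]]] := comparison_diagram dOm dom e0 sand hb.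
have [M1 t1] := diagram_tame deta; have [M2 t2] := diagram_tame dOm.
have [M3 t3] := diagram_tame dom.
pose M' : R := `|M| + `|M1| + `|M2| + `|M3|; pose N : R := M' + e + `|b| + 1.
have [? ? ? ?] := And4 (ler_norm M) (ler_norm M1) (ler_norm M2) (ler_norm M3).
have [? ? ? ?] := And4 (normr_ge0 M) (normr_ge0 M1) (normr_ge0 M2) (normr_ge0 M3).
have e0' := e0; have ? := normr_ge0 b; have ? := ler_norm b.
have ? : - b <= `|b| by rewrite -normrN ler_norm.
have {}tal : tame al M' by apply: tameW tal _; rewrite /M'; lra.
have {}tbe : tame be M' by apply: tameW tbe _; rewrite /M'; lra.
have {}t1 : tame (diag_sigma eta) M' by apply: tameW t1 _; rewrite /M'; lra.
have {}t2 : tame (diag_sigma Om) M' by apply: tameW t2 _; rewrite /M'; lra.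
have {}t3 : tame (diag_sigma om) M' by apply: tameW t3 _; rewrite /M'; lra.
have M'0 : 0 < M' by case: t1.
have N1 : 0 < N by rewrite /N; lra.
have N0 := ltW N1.
have M'N : M' < N by rewrite /N; lra.
have MeN : M' + e <= N by rewrite /N; lra.
have bN : b <= N by rewrite /N; lra.
have beN : - N <= b - e by rewrite /N; lra.
clearbody M' N.
pose U := expU (diag_sigma eta) N.
have iU y l r : 0 < y -> mu.-integrable `[l, r] (EFin \o U y).
  by move=> y0; exact: (expU_integrable N1 (tame_measurable t1) (tame_bound t1)).
have U0 y x : 0 < y -> 0 <= U y x.
  move=> y0; rewrite /U expU_polar// mulr_ge0 ?expR_ge0// cos_ge0_pihalf//.
  by rewrite -ler_norml; apply: (Garg_bound (M := M')) => //; case: deta => _ [].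
(* The bounds of [far_potential], common to [al] and [be]; on the right the phase bound also
   receives [e * d ^- 2] from [atan_gap]. *)
pose K1 := expR (4 * M' * d ^- 2 * (2 * N)).
pose C1 := 4 * M' * (2 * d ^- 3) * (2 * N).
have C10 : 0 <= C1.
  by rewrite /C1 mulr_ge0 ?mulr_ge0 ?invr_ge0 ?exprn_ge0 ?(ltW d0) ?(ltW M'0).
have left g : 0 < g -> \forall y \near 0^'+,
    pi * \int[P1]_(t in `[- L + d - 0, z0 - d - d - 0]) 1 - g <= \int[mu]_(x in `[- L, z0 - d]) U y x.
  move=> g0; apply: (@mass_lower R P1 0 (fun=> 1) _ _ _ U (- L) (z0 - d) d 1 K1 C1) => //.
  - by move=> *; rewrite ler01 lexx.
  - exact: expR_gt0.
  near=> y; have y0 : 0 < y by near: y; exact: nbhs_right_gt.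
  have yd : y <= d by near: y; exact: nbhs_right_le.
  split; first exact: iU.
  move=> x /andP[xl xr].
  have far w : be w = 0 \/ d <= `|x - w|.
    have [_ h _] := Hbe w; have [/h|zw] := leP w z0; first by left.
    by right; rewrite distrC (le_trans _ (ler_norm _))//; lra.
  have [p1 p2 q1] := far_potential tbe N0 (fun w => let: And3 h _ _ := Hbe w in h) y0 yd far.
  have [hG hH] := transition_polar tr1 t3 M'N (x - 0) y0.
  exists (expR (potp be N y x)), (potq be N y x); split => //.
  (* With [e = b = 0] the function [tent] vanishes, so the comparison with [om] is the untranslated
     case of the same formula. *)
  + rewrite hG hH /U (@expU_shift R _ _ _ M' N y x 0 0 y0 t1 t3 tbe)//; try lra.
      by rewrite !subr0 !addr0 !subrr mul0r !addr0.
    by move=> w; have [_ _ h] := Hbe w; rewrite subr0 h /tent !subr0; ring.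
  + by rewrite -expR0 ler_expR.
  + by rewrite /K1 ler_expR.
have right g : 0 < g -> \forall y \near 0^'+,
    pi * \int[P0]_(t in `[b + d + d - e, L - d - e]) damping e b (t + e - d) - g
    <= \int[mu]_(x in `[b + d, L]) U y x.
  move=> g0; apply: (@mass_lower R P0 e (damping e b) _ _ _ U (b + d) L d (damping e b (b + d))
    K1 (C1 + e * d ^- 2)) => //.
  - by apply: continuous_measurable_fun; exact: damping_continuous.
  - by move=> x; exact: damping01.
  - by move=> x x' /(damping_slope b e0)/andP[].
  (* [damping] vanishes at [b]; the gap [d] keeps its minimum over the interval positive. *)
  - rewrite damping_right//; last lra.
    by rewrite subr_gt0 ltr_pdivrMr; lra.
  - exact: expR_gt0.
  - by rewrite addr_ge0// mulr_ge0 ?(ltW e0)// invr_ge0 exprn_ge0 ?(ltW d0).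
  - by move=> x /andP[/(damping_slope b e0)/andP[]].
  near=> y; have y0 : 0 < y by near: y; exact: nbhs_right_gt.
  have yd : y <= d by near: y; exact: nbhs_right_le.
  split; first exact: iU.
  move=> x /andP[xl xr].
  have far w : al w = 0 \/ d <= `|x - w|.
    have [_ h _] := Hal w; have [/h|zw] := leP b w; first by left.
    by right; rewrite (le_trans _ (ler_norm _))//; lra.
  have [p1 p2 q1] := far_potential tal N0 (fun w => let: And3 h _ _ := Hal w in h) y0 yd far.
  have [hG hH] := transition_polar tr0 t2 M'N (x - e) y0.
  have /andP[r1 r2] := @ratio_bounds R y (x - b) e y0 ltac:(lra) (ltW e0).
  exists (expR (potp al N y x + (ln ((x - b) ^+ 2 + y ^+ 2) - ln ((x - b + e) ^+ 2 + y ^+ 2)) / 2)),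
    (potq al N y x + (atan ((x - b + e) / y) - atan ((x - b) / y))); split => //.
  + rewrite hG hH /U (@expU_shift R _ _ _ M' N y x e b y0 t1 t2 tal)//; first exact: ltW.
    by move=> w; have [_ _ h] := Hal w.
  + rewrite damping_right//; last lra.
    by rewrite (le_trans r1)// ler_expR lerDr.
  + by rewrite expRD -[leRHS]mulr1 ler_pM ?expR_ge0// ler_expR.
  + rewrite [leRHS]mulrDl; apply: (le_trans (ler_normD _ _)); apply: lerD => //.
    by apply: atan_gap => //; exact: ltW.
apply/ler_addgt0Pr => g g0.
have pi0 := @pi_gt0 R.
have g20 : 0 < pi * g / 2 by rewrite divr_gt0// mulr_gt0.
have key (p1 p2 a1 a2 a3 q : R) : p1 - q / 2 <= a1 -> p2 - q / 2 <= a3 ->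
    a1 + (a2 + a3) <= pi -> 0 <= a2 -> p1 + p2 <= pi + q by move=> h1 h2 h3 h4; lra.
near (0 : R)^'+ => y.
have y0 : 0 < y by near: y; exact: nbhs_right_gt.
have hl : pi * \int[P1]_(t in `[- L + d - 0, z0 - d - d - 0]) 1 - pi * g / 2 <= \int[mu]_(x in `[- L, z0 - d]) U y x.
  by near: y; exact: left.
have hr : pi * \int[P0]_(t in `[b + d + d - e, L - d - e]) damping e b (t + e - d) - pi * g / 2
    <= \int[mu]_(x in `[b + d, L]) U y x.
  by near: y; exact: right.
have hU : \int[mu]_(x in `[- L, L]) U y x <= pi.
  apply: (int_expU_le (B := 4 * M')) => //; last by move=> x; exact: U0.
  - exact: tame_measurable t1.
  - exact: tame_bound t1.
have iUy l r := iU y l r y0.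
have hM : 0 <= \int[mu]_(x in `[z0 - d, b + d]) U y x by apply: Rintegral_ge0 => x _; exact: U0.
have h1 := @Rintegral_split _ (U y) (- L) L (z0 - d) Lz ltac:(lra) (iUy _ _).
have h2 := @Rintegral_split _ (U y) (z0 - d) L (b + d) ltac:(lra) bL (iUy _ _).
rewrite h1 h2 in hU; rewrite -(ler_pM2l pi0) [leLHS]mulrDr [leRHS]mulrDr mulr1.
exact: key hl hr hU hM.
Unshelve. all: by end_near. Qed.
End MassInequality.

(** * Removing the truncation *)

Section Tails.
Context {R : realType}.

Lemma damping_measurable (e b u : R) : 0 < e ->
  measurable_fun setT (fun t : R => damping e b (t + u)).
Proof.
move=> e0; have md : measurable_fun setT (damping e b).
  by apply: continuous_measurable_fun; exact: damping_continuous.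
by apply: (measurableT_comp md); exact: measurable_funD.
Qed.

Lemma probability_tail (P : probability R R) (g : R) : 0 < g ->
  exists n : R, 0 < n /\ fine (P (~` `[- n, n]%classic)) <= g.
Proof.
move=> g0; pose F (n : nat) := `[- n%:R, n%:R]%classic : set R.
have mF n : measurable (F n) by exact: measurable_itv.
have ndF : nondecreasing_seq F.
  move=> m n mn; apply/subsetPset => x; rewrite /F/= !in_itv/= => /andP[h1 h2].
  have := mn; rewrite -(ler_nat R) => ?.
  by apply/andP; split; lra.
have UF : \bigcup_n F n = setT.
  apply/seteqP; split => // x _; exists (Num.bound `|x|) => //.
  have := archi_boundP (normr_ge0 x); rewrite /F/= in_itv/= => h.
  by rewrite -ler_norml ltW.
have := @nondecreasing_cvg_mu _ _ _ P F mF; rewrite UF => /(_ measurableT ndF).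
rewrite [X in _ --> X](probability_setT P).
move=> /fine_cvgP [_ /cvgrPdist_le /(_ g g0) [n _ /(_ n.+1 (leqnSn n))]]/= h.
exists n.+1%:R; split; first by rewrite ltr0n.
rewrite probability_setC//.
have fP : P (F n.+1) \is a fin_num by exact: fin_num_measure.
rewrite -/(F n.+1) -(fineK fP) -EFinB/=.
exact: le_trans (ler_norm _) h.
Qed.

(** Passes from truncated to full masses with explicit errors: [c] is a uniform one, and [T] will be
    a set of small probability. *)
Lemma Rintegral_le_tail (P : probability R R) (A B T : set R) (f h : R -> R) (c : R) :
  measurable A -> measurable B -> measurable T ->
  measurable_fun setT f -> measurable_fun setT h ->
  (forall t, 0 <= f t <= 1) -> (forall t, 0 <= h t <= 1) ->
  (forall t, A t -> f t <= (h \_ B) t + c + \1_T t) -> 0 <= c ->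
  \int[P]_(t in A) f t <= \int[P]_(t in B) h t + c + fine (P T).
Proof.
move=> mA mB mT mf mh f01 h01 fh c0.
have bd (k : R -> R) D : (forall t, 0 <= k t <= 1) -> forall t, `|(k \_ D) t| <= 1.
  move=> k01 t; rewrite patchE; case: ifP => _; last by rewrite normr0 ler01.
  by have /andP[k0 k1] := k01 t; rewrite ger0_norm.
have ir (k : R -> R) D : measurable D -> measurable_fun setT k -> (forall t, 0 <= k t <= 1) ->
    P.-integrable setT (EFin \o (k \_ D)).
  move=> mD mk k01; apply: (@probability_bounded_integrable _ _ _ 1); last exact: bd.
  by apply/(measurable_restrictT _ _).1 => //; exact: measurable_funTS.
have iT : P.-integrable setT (EFin \o (\1_T : R -> R)) by exact: integrable_indic.
have ic : P.-integrable setT (EFin \o (fun _ : R => c)).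
  by apply: (@probability_bounded_integrable _ _ _ `|c|).
have ihB := ir h B mB mh h01; have ifA := ir f A mA mf f01.
have ihc : P.-integrable setT (EFin \o (fun t => (h \_ B) t + c)).
  by have := integrableD measurableT ihB ic; apply: eq_integrable.
have ihcT : P.-integrable setT (EFin \o (fun t => (h \_ B) t + c + \1_T t)).
  by have := integrableD measurableT ihc iT; apply: eq_integrable.
have -> : fine (P T) = \int[P]_t \1_T t.
  by rewrite /Rintegral integral_indic// setIT.
rewrite -[X in _ + X + _](Rintegral_prob_cst P) (Rintegral_mkcond P A f) (Rintegral_mkcond P B h).
rewrite -(RintegralD measurableT ihB ic) -(RintegralD measurableT ihc iT).
apply: le_Rintegral => // t _; rewrite [leLHS]patchE; case: ifPn => [|_].
  by rewrite inE => /fh.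
rewrite !addr_ge0// patchE; case: ifP => // _.
by have /andP[] := h01 t.
Qed.
End Tails.

Section FinalBound.
Context {R : realType}.
Variables (Om om : R -> R) (P0 P1 : probability R R) (e z0 b : R).
Hypotheses (dOm : continual_diagram Om) (dom : continual_diagram om) (e0 : 0 < e)
  (sand : forall z, Om (z - e) - e <= om z <= Om (z - e) + e)
  (hb : Om (b - e) - Om (z0 - e) = b - z0 - 2 * e)
  (tr0 : is_transition_measure Om P0) (tr1 : is_transition_measure om P1).

Let dampE z : z \in `[b - e, +oo[%classic -> 1 - e / (z + 2 * e - b) = damping e b (z + e).
Proof.
rewrite inE/= in_itv/= andbT => bz; rewrite damping_right//; last lra.
by congr (1 - e / _); ring.
Qed.

Lemma distrK_bound (t0 : R) : 0 < t0 ->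
  distrK P1 (z0 - t0) + \int[P0]_(z in `[b - e, +oo[) (1 - e / (z + 2 * e - b)) <= 1.
Proof.
move=> t00; rewrite (eq_Rintegral _ dampE); apply/ler_addgt0Pr => g g0.
have z0b := contact_point_ge dOm e0 hb.
have g30 : 0 < g / 3 by rewrite divr_gt0.
have [n0 [n00 h0]] := probability_tail P0 g30.
have [n1 [n10 h1]] := probability_tail P1 g30.
have [d [d0 dt dg]] : exists d : R, [/\ 0 < d, 2 * d <= t0 & 2 * d / e <= g / 3].
  (* The first entry gives [z0 - t0 <= z0 - 2 * d]; the second bounds by [g / 3] the change of
     [damping], of slope at most [1 / e], over a length [2 * d]. The other two thirds of [g] go to
     the tails of [P0] and [P1]. *)
  exists (Num.min (t0 / 2) (g * e / 6)); split.
  - by rewrite lt_min !divr_gt0// mulr_gt0.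
  - by rewrite mulrC -ler_pdivlMr// ge_min lexx.
  - rewrite ler_pdivrMr// mulrC -ler_pdivlMr// ge_min; apply/orP; right.
    by rewrite le_eqVlt; apply/orP; left; apply/eqP; field.
have e0' := e0.
have [L [L0 L1 L2 L3 L4]] : exists L : R, [/\ 0 < L, - L <= z0 - d, b + d <= L,
    n0 <= L - d - e & - L + d <= - n1].
  have [? ? ? h] := And4 (normr_ge0 b) (ler_norm b) (normr_ge0 z0) (ler_norm (- z0)).
  by exists (`|b| + `|z0| + n0 + n1 + d + e); rewrite normrN in h *; split; lra.
have := mass_inequality dOm dom e0 sand hb tr0 tr1 d0 L0 L1 ltac:(lra) L2.
have mD (u : R) : measurable_fun setT (fun t : R => damping e b (t + u)).
  exact: damping_measurable.
have mD2 : measurable_fun setT (fun t : R => damping e b (t + e - d)).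
  by under eq_fun do rewrite -addrA; exact: mD.
have A1 : distrK P1 (z0 - t0) <= \int[P1]_(t in `[- L + d - 0, z0 - d - d - 0]) 1 + 0 + g / 3.
  have -> : distrK P1 (z0 - t0) = \int[P1]_(t in `]-oo, z0 - t0]) 1.
    by rewrite Rintegral_cst// mul1r.
  apply: le_trans (lerD (lexx _) h1).
  apply: Rintegral_le_tail => //; try by move=> t; rewrite ler01 lexx.
    exact: measurableC.
  move=> t /=; rewrite in_itv/= addr0 patchE => tz; case: ifPn => [_|tN].
    by rewrite lerDl.
  rewrite add0r indicE mem_set//= in_itv/= => /andP[h2 h3].
  by move/negP: tN; apply; rewrite inE/= in_itv/=; apply/andP; split; lra.
have A2 : \int[P0]_(t in `[b - e, +oo[) damping e b (t + e) <=
    \int[P0]_(t in `[b + d + d - e, L - d - e]) damping e b (t + e - d) + 2 * d / e + g / 3.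
  apply: le_trans (lerD (lexx _) h0).
  apply: Rintegral_le_tail => //.
  - exact: measurableC.
  - by move=> t; exact: damping01.
  - by move=> t; exact: damping01.
  - move=> t /=; rewrite in_itv/= andbT => tb; rewrite patchE; case: ifPn => [_|tN].
      have /andP[_ h2] := @damping_slope _ e b (t + e - d) (t + e) e0 ltac:(lra).
      have h3 : e^-1 * (t + e - (t + e - d)) <= 2 * d / e.
        by rewrite mulrC ler_wpM2r ?invr_ge0 ?(ltW e0)//; lra.
      by rewrite (le_trans h2)// (le_trans (lerD (lexx _) h3))// lerDl.
    (* In the strip lost at the left end [damping] is at most [2 * d / e], since it vanishes at [b];
       beyond the right end [t] lies in the tail. *)
    have [tl|tl] := ltP t (b + d + d - e).
      have /andP[_ h2] := @damping_slope _ e b b (t + e) e0 ltac:(lra).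
      have h3 : e^-1 * (t + e - b) <= 2 * d / e.
        by rewrite mulrC ler_wpM2r ?invr_ge0 ?(ltW e0)//; lra.
      rewrite (le_trans h2)// (le_trans (lerD (lexx _) h3))//.
      rewrite /damping subrr maxxx add0r divff ?gt_eqF// subrr lerDl//.
    rewrite indicE mem_set.
      have /andP[_ h2] := damping01 b (t + e) e0.
      by rewrite (le_trans h2)// add0r lerDr divr_ge0 ?mulr_ge0// ltW.
    move=> /=; rewrite in_itv/= => /andP[h2 h3].
    by move/negP: tN; apply; rewrite inE/= in_itv/=; apply/andP; split; lra.
  - by rewrite divr_ge0 ?mulr_ge0// ltW.
by move: A1 A2; rewrite addr0 => *; lra.
Qed.
End FinalBound.

Section DistributionLimit.
Context {R : realType}.

(** [lim] carries information only once convergence is known; here it follows from monotonicity in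
    [t] and the bound [c]. *)
Lemma distrK_left_lim_le (P : probability R R) (z c : R) :
  (forall t, 0 < t -> distrK P (z - t) <= c) ->
  lim (distrK P (z - t) @[t --> 0^'+]) <= c.
Proof.
move=> Kc; apply: limr_le; last by near=> t; apply: Kc; near: t; exact: nbhs_right_gt.
apply: nonincreasing_at_right_is_cvgr.
  near=> y => s t _ _ st; rewrite /distrK fine_le ?fin_num_measure//.
  apply: le_measure; rewrite ?inE//.
  by move=> x /=; rewrite !in_itv/= => /le_trans; apply; rewrite lerB.
near=> y; exists c => _ [t /=] + <-; rewrite in_itv/= => /andP[t0 _].
exact: Kc.
Unshelve. all: by end_near. Qed.

Lemma complement_Rintegral (P : probability R R) (c : R) (g : R -> R) :
  P.-integrable `[c, +oo[ (EFin \o (fun z => 1 - g z)) ->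
  1 - \int[P]_(z in `[c, +oo[) (1 - g z) =
  \int[P]_z (\1_(`]-oo, c[) z + \1_(`[c, +oo[) z * g z).
Proof.
move=> ig; rewrite Rintegral_mkcond -[X in X - _](Rintegral_prob_cst P).
have i1 : P.-integrable setT (EFin \o (fun _ : R => 1 : R)).
  by apply: (@probability_bounded_integrable _ _ _ 1) => // t; rewrite normr1.
have i2 : P.-integrable setT (EFin \o ((fun z => 1 - g z) \_ `[c, +oo[)).
  by rewrite -restrict_EFin; apply/integrable_restrict => //; rewrite setTI.
rewrite -(RintegralB measurableT i1 i2); apply: eq_Rintegral => z _.
rewrite patchE !indicE; have [cz|zc] := leP c z.
  rewrite mem_set/= ?in_itv/= ?cz// memNset/= ?in_itv/= ?ltNge ?cz//.
  by rewrite mul1r add0r opprB addrC subrK.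
rewrite memNset/= ?in_itv/= ?leNgt ?zc// mem_set/= ?in_itv/= ?zc//.
by rewrite mul0r addr0 subr0.
Qed.
End DistributionLimit.

Theorem theorem6p1 (R : realType) (Om : R -> R) (eps z0 zmax : R)
    (muOm : probability R R) :
  continual_diagram Om -> 0 < eps ->
  Om (zmax - eps) - Om (z0 - eps) = zmax - z0 - 2 * eps ->
  (forall z : R, Om (z - eps) - Om (z0 - eps) = z - z0 - 2 * eps -> z <= zmax) ->
  is_transition_measure Om muOm ->
  forall (om : R -> R) (muom : probability R R),
  continual_diagram om -> is_transition_measure om muom ->
  (diagram_dist Om om <= eps%:E)%E ->
  lim (distrK muom (z0 - tau) @[tau --> 0^'+])
    <= 1 - Rintegral muOm `[zmax - eps, +oo[
             (fun z => 1 - eps / (z + 2 * eps - zmax))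
  /\
  1 - Rintegral muOm `[zmax - eps, +oo[ (fun z => 1 - eps / (z + 2 * eps - zmax))
  = Rintegral muOm setT
      (fun z => \1_(`]-oo, zmax - eps[) z
                + \1_(`[zmax - eps, +oo[) z * (eps / (z + 2 * eps - zmax))).
Proof.
move=> dOm e0 hb _ tr0 om muom dom tr1 dist.
have sand z := diagram_dist_sandwich z dOm dom dist.
split.
  apply: distrK_left_lim_le => t t0; rewrite lerBrDr.
  exact: (distrK_bound dOm dom e0 sand hb tr0 tr1).
apply: complement_Rintegral.
(* The integrand is unbounded near [zmax - 2 * eps], but on the half-line it coincides with a
   translate of the bounded function [damping]. *)
have mD : measurable_fun setT (fun z : R => damping eps zmax (z + eps)).
  exact: damping_measurable.
have iD : muOm.-integrable setT (EFin \o (fun z : R => damping eps zmax (z + eps))).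
  apply: (@probability_bounded_integrable _ _ _ 1) => // z.
  by have /andP[h0 h1] := damping01 zmax (z + eps) e0; rewrite ger0_norm.
have := integrableS measurableT (measurable_itv `[zmax - eps, +oo[) (@subsetT _ _) iD.
apply: eq_integrable => // z; rewrite inE/= in_itv/= andbT => hz.
by rewrite /= damping_right//; [congr ((1 - eps / _)%:E); ring|lra].
Qed.
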